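(* Let $n<\alpha_1<\dots<\alpha_N<\alpha$, $T>0$, $v\in(0,1)$, $\mu>0$, and let $a_0,\dots,a_N,b:\mathbb{Q}_p^n\times[0,T]\to\mathbb{R}$ belong (with respect to $x$) to $\mathfrak{M}_0$ uniformly in $t$, with $a_0$ satisfying the Hölder condition in $t$ with exponent $v$ uniformly in $x$, $a_0(x,t)\ge\mu$, and $\alpha_{N+1}:=n+(\alpha-n)(1-v)>\alpha_N$. Assume that $a_k$, $k=0,\dots,N$, are nonnegative bounded continuous functions, $b$ is a bounded continuous function, and $0\le\lambda<\alpha_1-n$ (if $a_1=\dots=a_N\equiv0$, suppose only $0\le\lambda<\alpha-n$). For $\varphi\in\mathfrak{M}_\lambda$ and $f(x,t)$ continuous in $(x,t)$ and belonging to $\mathfrak{M}_\lambda$ uniformly in $t\in[0,T]$, put $$\boldsymbol{L}(\varphi,f)=u,\qquad u(x,t)=\int_0^t\int_{\mathbb{Q}_p^n}\Lambda(x,t,\xi,\tau)f(\xi,\tau)\,d^n\xi\,d\tau+\int_{\mathbb{Q}_p^n}\Lambda(x,t,\xi,0)\varphi(\xi)\,d^n\xi$$ (with $u(x,0)=\varphi(x)$). Then there is a constant $C$, independent of $\varphi$ and $f$, such that $$\|u\|_{\mathfrak{M}_\lambda}\le C\big(\|\varphi\|_{\mathfrak{M}_\lambda}+\|f\|_{\mathfrak{M}_\lambda}\big),$$ i.e. $\boldsymbol{L}:\mathfrak{M}_\lambda\times\mathfrak{M}_\lambda\to\mathfrak{M}_\lambda$ is a continuous operator.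
   Context: $p$ is a prime; on $\mathbb{Q}_p^n$, $\|x\|_p=\max_i|x_i|_p$ and $d^nx$ is the Haar measure giving $\mathbb{Z}_p^n$ volume $1$. $\Psi(y)=\exp(2\pi i\{y\}_p)$ for $y\in\mathbb{Q}_p$, where $\{y\}_p$ is the fractional part, and $x\cdot\xi=\sum_jx_j\xi_j$. For $\lambda\ge0$, $\mathfrak{M}_\lambda$ is the space of functions $\varphi:\mathbb{Q}_p^n\to\mathbb{C}$ for which there are $l\in\mathbb{Z}$ and $C>0$ with $\varphi(x+x')=\varphi(x)$ for all $x$ and all $\|x'\|_p\le p^l$, and $|\varphi(x)|\le C(1+\|x\|_p^\lambda)$. A function depending also on $t$ belongs to $\mathfrak{M}_\lambda$ uniformly in $t$ if $C$ and $l$ can be chosen independent of $t$. In this statement $\mathfrak{M}_\lambda$ is identified with the $\mathbb{R}$-vector space of functions $\phi(x,t)$, $t\in[0,T]$, belonging to $\mathfrak{M}_\lambda$ uniformly in $t$ (functions of $x$ alone being constant in $t$), with the norm $$\|\phi\|_{\mathfrak{M}_\lambda}=\sup_{t\in[0,T]}\sup_{x\in\mathbb{Q}_p^n}\left|\frac{\phi(x,t)}{1+\|x\|_p^\lambda}\right|,$$ and $\mathfrak{M}_\lambda\times\mathfrak{M}_\lambda$ carries the sum of the two norms. For each $\gamma\in\{\alpha_1,\dots,\alpha_N,\alpha\}$, $w_\gamma:\mathbb{Q}_p^n\to[0,\infty)$ is a fixed continuous radial function, $w_\gamma(y)=w_\gamma(\|y\|_p)$, vanishing only at $0$, with positive constants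 $C_0,C_1$ such that $C_0\|y\|_p^\gamma\le w_\gamma(\|y\|_p)\le C_1\|y\|_p^\gamma$. Put $A_{w_\gamma}(\|\xi\|_p)=\int_{\mathbb{Q}_p^n}\frac{1-\Psi(-y\cdot\xi)}{w_\gamma(\|y\|_p)}d^ny$ and $(\boldsymbol{W}_\gamma\varphi)(x)=\int_{\mathbb{Q}_p^n}\frac{\varphi(x-y)-\varphi(x)}{w_\gamma(\|y\|_p)}d^ny$, acting in the variable $x$ (for $Z(x,t;y,\theta)$, in the first argument). $\Lambda$ is the fundamental solution of the Cauchy problem $\frac{\partial u}{\partial t}-a_0\boldsymbol{W}_\alpha u-\sum_{k=1}^Na_k\boldsymbol{W}_{\alpha_k}u+bu=f$, $u(x,0)=\varphi(x)$, constructed as follows, for $x,\xi\in\mathbb{Q}_p^n$, $0\le\tau<t\le T$. For $t>0$, $Z(x,t;y,\theta)=\int_{\mathbb{Q}_p^n}\Psi(x\cdot\xi)e^{-a_0(y,\theta)tA_{w_\alpha}(\|\xi\|_p)}d^n\xi$. Set $$R(x,t,\xi,\tau)=(a_0(x,t)-a_0(\xi,\tau))(\boldsymbol{W}_\alpha Z)(x-\xi,t-\tau;\xi,\tau)+\sum_{k=1}^Na_k(x,t)(\boldsymbol{W}_{\alpha_k}Z)(x-\xi,t-\tau;\xi,\tau)-b(x,t)Z(x-\xi,t-\tau;\xi,\tau),$$ $R_1=R$, $R_{m+1}(x,t,\xi,\tau)=\int_\tau^t\int_{\mathbb{Q}_p^n}R(x,t,\eta,\theta)R_m(\eta,\theta,\xi,\tau)d^n\eta\,d\theta$,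 $\Phi=\sum_{m\ge1}R_m$, and $$\Lambda(x,t,\xi,\tau)=Z(x-\xi,t-\tau;\xi,\tau)+\int_\tau^t\int_{\mathbb{Q}_p^n}Z(x-\eta,t-\theta;\eta,\theta)\Phi(\eta,\theta,\xi,\tau)d^n\eta\,d\theta .$$ *)

(* Defs.v *)
From HB Require Import structures.
From mathcomp Require Import all_boot all_order all_algebra.
From mathcomp Require Import zify ring lra.
From mathcomp Require Import complex.
From mathcomp Require Import all_classical all_reals all_analysis.

Set Implicit Arguments.
Unset Strict Implicit.
Unset Printing Implicit Defensive.
Import Order.TTheory GRing.Theory Num.Theory numFieldNormedType.Exports.

Local Open Scope classical_set_scope.
Local Open Scope ring_scope.
Local Open Scope complex_scope.
Local Open Scope quotient_scope.

(* Z_p is the inverse limit of the rings Z/p^k: a p-adic integer is the sequence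
   of its least nonnegative residues modulo p^k. *)
Record Zp (p : nat) (pp : prime p) := MkZp {
  zres : nat -> nat ;
  zres_coh : forall k, zres k = (zres k.+1 %% p ^ k)%N }.

Section padic_integers.
Local Open Scope nat_scope.
Variables (p : nat) (pp : prime p).
Local Notation Zp := (Zp pp).

HB.instance Definition _ := gen_eqMixin Zp.
HB.instance Definition _ := gen_choiceMixin Zp.

Lemma pX_gt0 k : 0 < p ^ k. Proof. by rewrite expn_gt0 prime_gt0. Qed.

Lemma zres_lt (x : Zp) k : zres x k < p ^ k.
Proof. by rewrite zres_coh ltn_mod pX_gt0. Qed.

Lemma zres_mod (x : Zp) k : zres x k %% p ^ k = zres x k.
Proof. exact: modn_small (zres_lt x k). Qed.

Lemma Zp_ext (x y : Zp) : zres x =1 zres y -> x = y.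
Proof.
case: x => f cf; case: y => g cg /= /funext fg.
by move: cf; rewrite fg => cf; congr (MkZp pp); exact: Prop_irrelevance.
Qed.

Lemma zres_trunc (x : Zp) j k : j <= k -> zres x k %% p ^ j = zres x j.
Proof.
move=> /subnK <-; elim: (k - j) => [|d IH]; first exact: zres_mod.
rewrite addSn -IH (zres_coh x (d + j)) modn_dvdm //.
by rewrite expnD dvdn_mull.
Qed.

Program Definition Zp_of (f : nat -> nat)
    (cf : forall k, f k = f k.+1 %[mod p ^ k]) : Zp :=
  @MkZp p pp (fun k => f k %% p ^ k) _.
Next Obligation.
by move=> f cf k /=; rewrite cf modn_dvdm // expnS dvdn_mull.
Qed.

Lemma zadd_coh (x y : Zp) k :
  zres x k + zres y k = zres x k.+1 + zres y k.+1 %[mod p ^ k].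
Proof. by rewrite [zres x k]zres_coh [zres y k]zres_coh modnDm. Qed.

Lemma zmul_coh (x y : Zp) k :
  zres x k * zres y k = zres x k.+1 * zres y k.+1 %[mod p ^ k].
Proof. by rewrite [zres x k]zres_coh [zres y k]zres_coh modnMm. Qed.

Lemma zopp_coh (x : Zp) k :
  p ^ k - zres x k = p ^ k.+1 - zres x k.+1 %[mod p ^ k].
Proof.
apply/eqP; rewrite -(eqn_modDl (zres x k)) subnKC 1?ltnW ?zres_lt//.
rewrite modnn {1}[zres x k]zres_coh modnDml subnKC 1?ltnW ?zres_lt//.
by rewrite expnS modnMl.
Qed.

Lemma zcst_coh (m : nat) k : m = m %[mod p ^ k]. Proof. by []. Qed.

Definition zadd (x y : Zp) := Zp_of (zadd_coh x y).
Definition zmul (x y : Zp) := Zp_of (zmul_coh x y).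
Definition zopp (x : Zp) := Zp_of (zopp_coh x).
Definition zcst (m : nat) := Zp_of (zcst_coh m).

Lemma zaddA : associative zadd.
Proof. by move=> x y z; apply: Zp_ext => k /=; rewrite modnDml modnDmr addnA. Qed.
Lemma zaddC : commutative zadd.
Proof. by move=> x y; apply: Zp_ext => k /=; rewrite addnC. Qed.
Lemma zadd0 : left_id (zcst 0) zadd.
Proof. by move=> x; apply: Zp_ext => k /=; rewrite modnDml zres_mod. Qed.
Lemma zaddN : left_inverse (zcst 0) zopp zadd.
Proof.
move=> x; apply: Zp_ext => k /=.
by rewrite modnDml subnK ?modnn ?mod0n// ltnW// zres_lt.
Qed.
Lemma zmulA : associative zmul.
Proof. by move=> x y z; apply: Zp_ext => k /=; rewrite modnMml modnMmr mulnA. Qed.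
Lemma zmulC : commutative zmul.
Proof. by move=> x y; apply: Zp_ext => k /=; rewrite mulnC. Qed.
Lemma zmul1 : left_id (zcst 1) zmul.
Proof. by move=> x; apply: Zp_ext => k /=; rewrite modnMml mul1n zres_mod. Qed.
Lemma zmulDl : left_distributive zmul zadd.
Proof. by move=> x y z; apply: Zp_ext => k /=; rewrite modnMml modnDm mulnDl. Qed.
Lemma zone_neq0 : zcst 1 != zcst 0.
Proof.
apply/eqP => /(congr1 (fun x => zres x 1)) /=.
by rewrite expn1 mod0n modn_small ?prime_gt1.
Qed.

HB.instance Definition _ := GRing.isZmodule.Build Zp zaddA zaddC zadd0 zaddN.
HB.instance Definition _ :=
  GRing.Zmodule_isComNzRing.Build Zp zmulA zmulC zmul1 zmulDl zone_neq0.

Lemma zres0 k : zres (0%R : Zp) k = 0. Proof. exact: mod0n. Qed.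
Lemma zres1 k : zres (1%R : Zp) k = 1 %% p ^ k. Proof. by []. Qed.
Lemma zresD (x y : Zp) k :
  zres (x + y)%R k = (zres x k + zres y k) %% p ^ k.
Proof. by []. Qed.
Lemma zresM (x y : Zp) k :
  zres (x * y)%R k = (zres x k * zres y k) %% p ^ k.
Proof. by []. Qed.

(* p-adic valuation of x (junk value at 0): all the nonzero residues of x have
   the same p-adic valuation, by [zvalE]. *)
Definition zval (x : Zp) : nat :=
  logn p (zres x (xget 0 [set k | zres x k != 0])).

Lemma zres_neq0 (x : Zp) : (x != 0)%R -> exists k, zres x k != 0.
Proof.
move=> x0; apply: contrapT => nx; case/negP: x0; apply/eqP.
apply: Zp_ext => k; rewrite zres0; apply/eqP/negPn/negP => xk.
by apply: nx; exists k.
Qed.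

Lemma logn_lt (m k : nat) : m != 0 -> m < p ^ k -> logn p m < k.
Proof.
rewrite -lt0n => m0 mk; rewrite ltnNge -pfactor_dvdn//.
by apply/negP => /(dvdn_leq m0); rewrite leqNgt mk.
Qed.

Lemma logn_modX (m k : nat) : m %% p ^ k != 0 -> logn p (m %% p ^ k) = logn p m.
Proof.
move=> mk0; have m0 : 0 < m by case: m mk0 => //; rewrite mod0n.
have lk := logn_lt mk0 (ltn_pmod _ (pX_gt0 _)).
have E i : i <= k -> (i <= logn p (m %% p ^ k)) = (i <= logn p m).
  move=> ik; rewrite -!pfactor_dvdn// ?lt0n//.
  by rewrite /dvdn modn_dvdm// dvdn_exp2l.
apply/eqP; rewrite eqn_leq -E; last exact: ltnW.
rewrite leqnn /= leqNgt; apply/negP => h.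
by have := E _ lk; rewrite h ltnn.
Qed.

Lemma zvalE (x : Zp) k : zres x k != 0 -> logn p (zres x k) = zval x.
Proof.
move=> xk; rewrite /zval; case: xgetP => [j _ /= xj|/(_ k)//].
have aux i l : i <= l -> zres x i != 0 ->
    logn p (zres x i) = logn p (zres x l).
  by move=> il; rewrite -(zres_trunc x il); exact: logn_modX.
by case/orP: (leq_total k j) => h; [|symmetry]; apply: aux.
Qed.

Lemma zval_lt (x : Zp) k : zres x k != 0 -> zval x < k.
Proof. by move=> xk; rewrite -(zvalE xk); exact: logn_lt xk (zres_lt x k). Qed.

Lemma zres_zval (x : Zp) k : (x != 0)%R -> (zres x k != 0) = (zval x < k).
Proof.
move=> /zres_neq0[j xj]; apply/idP/idP; first exact: zval_lt.
move=> vk; apply/negP => /eqP xk0; move: xj.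
have [jk|/ltnW kj] := leqP j k.
  by rewrite -(zres_trunc x jk) xk0 mod0n.
move=> xj; move: vk; rewrite -(zvalE xj) ltnNge -pfactor_dvdn// ?lt0n//.
by rewrite /dvdn zres_trunc// xk0.
Qed.

Lemma zmul_res (x y : Zp) : (x != 0)%R -> (y != 0)%R ->
  zres (x * y)%R (zval x + zval y).+1 != 0 /\
  logn p (zres (x * y)%R (zval x + zval y).+1) = zval x + zval y.
Proof.
move=> x0 y0; set k := (zval x + zval y).+1.
have xk : zres x k != 0 by rewrite zres_zval// ltnS leq_addr.
have yk : zres y k != 0 by rewrite zres_zval// ltnS leq_addl.
have lxy : logn p (zres x k * zres y k) = zval x + zval y.
  by rewrite lognM ?lt0n// !zvalE.
have nz : zres (x * y)%R k != 0.
  rewrite zresM; apply/negP => h.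
  have : k <= logn p (zres x k * zres y k) by rewrite -pfactor_dvdn// muln_gt0 !lt0n xk yk.
  by rewrite lxy ltnn.
by split=> //; rewrite zresM logn_modX -?zresM.
Qed.

Lemma zvalM (x y : Zp) : (x != 0)%R -> (y != 0)%R ->
  zval (x * y)%R = zval x + zval y.
Proof. by move=> x0 y0; have [/zvalE <- ->] := zmul_res x0 y0. Qed.

Lemma zvalD (x y : Zp) : (x + y != 0)%R -> (x != 0)%R -> (y != 0)%R ->
  minn (zval x) (zval y) <= zval (x + y)%R.
Proof.
move=> xy0 x0 y0; rewrite leqNgt -zres_zval// zresD.
have xm : zres x (minn (zval x) (zval y)) == 0.
  by rewrite -[_ == _]negbK zres_zval// -leqNgt geq_minl.
have ym : zres y (minn (zval x) (zval y)) == 0.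
  by rewrite -[_ == _]negbK zres_zval// -leqNgt geq_minr.
by rewrite (eqP xm) (eqP ym) mod0n.
Qed.

Lemma zvalN (x : Zp) : zval (- x)%R = zval x.
Proof.
have [->|x0] := eqVneq x 0%R; first by rewrite oppr0.
have n10 : (-1 != 0 :> Zp)%R by rewrite oppr_eq0 oner_neq0.
have z1 : zval (1%R : Zp) = 0.
  have /esym/eqP := zvalM (oner_neq0 Zp) (oner_neq0 Zp).
  by rewrite mulr1 -[X in _ == X]addn0 eqn_add2l => /eqP.
have zn1 : zval (-1 : Zp)%R = 0.
  have /esym/eqP := zvalM n10 n10.
  by rewrite mulrNN mulr1 z1 addn_eq0 andbb => /eqP.
by rewrite -mulN1r zvalM// zn1.
Qed.

Lemma Zp_integral (x y : Zp) : (x * y = 0)%R -> (x == 0%R) || (y == 0%R).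
Proof.
move=> xy; apply/norP => -[x0 y0].
by have [] := zmul_res x0 y0; rewrite xy zres0.
Qed.

Definition zunit : {pred Zp} := fun x => `[< exists y, y * x = 1 >]%R.
Definition zinv (x : Zp) : Zp :=
  if x \in zunit then xget x [set y | y * x = 1]%R else x.

Lemma zmulVr : {in zunit, left_inverse 1%R zinv *%R}.
Proof.
move=> x xu; rewrite /zinv xu; move: xu => /asboolP[y yx].
by case: xgetP => [z _ //|/(_ y)].
Qed.
Lemma zunitPl (x y : Zp) : (y * x = 1)%R -> x \in zunit.
Proof. by move=> yx; apply/asboolP; exists y. Qed.
Lemma zinv_out : {in [predC zunit], zinv =1 id}.
Proof. by move=> x; rewrite inE /zinv => /negbTE ->. Qed.

HB.instance Definition _ := GRing.ComNzRing_hasMulInverse.Build Zp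
  zmulVr zunitPl zinv_out.
HB.instance Definition _ := GRing.ComUnitRing_isIntegral.Build Zp Zp_integral.

End padic_integers.


Definition Qp (p : nat) (pp : prime p) := {fraction (Zp pp)}.

Section padic_numbers.
Variables (p : nat) (pp : prime p).
Local Notation Zp := (Zp pp).
Local Notation Qp := (Qp pp).
Local Notation "x %:F" := (@FracField.tofrac Zp x).
Local Notation num q := (frac (repr q)).1.
Local Notation den q := (frac (repr q)).2.

HB.instance Definition _ := GRing.Field.on Qp.
HB.instance Definition _ := isPointed.Build Qp 0.

Definition ordp (q : Qp) : int :=
  (zval (num q))%:Z - (zval (den q))%:Z.

Lemma Qp_numden (q : Qp) : q = ((num q))%:F / ((den q))%:F.
Proof.
have d0 : ((den q))%:F != 0 :> Qp by rewrite tofrac_eq0 denom_ratioP.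
apply: (mulIf d0); rewrite divfK//.
rewrite -[X in X * _]reprK; unlock FracField.tofrac; rewrite -[LHS]FracField.pi_mul.
apply/eqmodP => /=; rewrite FracField.equivfE /FracField.mulf /=.
by rewrite !numden_Ratio ?mulf_neq0 ?oner_neq0 ?denom_ratioP// !mulr1 mulrC.
Qed.

Lemma Qp_ind (P : Qp -> Prop) :
  (forall x y : Zp, y != 0 -> P (x%:F / y%:F)) -> forall q, P q.
Proof. by move=> h q; rewrite (Qp_numden q); apply/h/denom_ratioP. Qed.

Lemma ordp_frac (x y : Zp) : x != 0 -> y != 0 ->
  ordp (x%:F / y%:F) = (zval x)%:Z - (zval y)%:Z.
Proof.
move=> x0 y0; rewrite /ordp; set q := (x%:F / y%:F : Qp).
have := Qp_numden q; set n := num _; set d := den _ => qE.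
have d0 : d != 0 by exact: denom_ratioP.
have E : x * d = n * y.
  apply/eqP; rewrite -tofrac_eq !tofracM; apply/eqP.
  have y0' : y%:F != 0 :> Qp by rewrite tofrac_eq0.
  have d0' : d%:F != 0 :> Qp by rewrite tofrac_eq0.
  by apply/eqP; rewrite -eqr_div//; apply/eqP.
have n0 : n != 0.
  by apply: contra_eq_neq E => ->; rewrite mul0r mulf_neq0.
have := zvalM x0 d0; rewrite E zvalM// => EE.
have : (zval n + zval y)%:Z = (zval x + zval d)%:Z by rewrite EE.
by rewrite !PoszD; lia.
Qed.

Lemma ordpN (q : Qp) : ordp (- q) = ordp q.
Proof.
elim/Qp_ind: q => x y y0; have [->|x0] := eqVneq x 0.
  by rewrite tofrac0 mul0r oppr0.
by rewrite -mulNr -tofracN !ordp_frac ?oppr_eq0// zvalN.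
Qed.

Lemma ordpM (q r : Qp) : q != 0 -> r != 0 -> ordp (q * r) = ordp q + ordp r.
Proof.
elim/Qp_ind: q => x y y0; elim/Qp_ind: r => z t t0.
rewrite !mulf_eq0 !negb_or !invr_eq0 !tofrac_eq0 => /andP[x0 _] /andP[z0 _].
rewrite mulf_div -!tofracM !ordp_frac ?mulf_neq0// !zvalM// !PoszD; lia.
Qed.

Lemma ordpD (q r : Qp) (k : int) : q + r != 0 ->
  (q == 0) || (k <= ordp q) -> (r == 0) || (k <= ordp r) -> k <= ordp (q + r).
Proof.
have [->|q0] /= := eqVneq q 0; first by rewrite add0r; case: eqP.
have [->|r0] /= := eqVneq r 0; first by rewrite addr0.
move: q0 r0; elim/Qp_ind: q => x y y0; elim/Qp_ind: r => z t t0.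
rewrite !mulf_eq0 !negb_or !invr_eq0 !tofrac_eq0 => /andP[x0 _] /andP[z0 _].
rewrite addf_div ?tofrac_eq0// -!tofracM -tofracD => s0.
have xt0 : x * t + z * y != 0.
  by apply: contraNneq s0 => ->; rewrite tofrac0 mul0r.
rewrite !ordp_frac ?mulf_neq0// !zvalM//.
have := zvalD xt0 (mulf_neq0 x0 t0) (mulf_neq0 z0 y0).
rewrite !zvalM//.
move: (zval _) (zval x) (zval y) (zval z) (zval t) => s a b c d; rewrite ?PoszD => h1 h2 h3. lia.
Qed.

Lemma zres_nat (m j : nat) : zres (m%:R : Zp) j = (m %% p ^ j)%N.
Proof.
elim: m => [|m IH]; first by rewrite zres0 mod0n.
by rewrite -addn1 natrD zresD IH zres1 modnDm.
Qed.

Lemma zval_pX (k : nat) : p%:R != 0 :> Zp /\ zval (p%:R ^+ k : Zp) = k.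
Proof.
have p1 := prime_gt1 pp.
have pj : zres (p%:R : Zp) 2 = p.
  by rewrite zres_nat modn_small// expnS expn1 ltn_Pmulr// prime_gt0.
have p0 : p%:R != 0 :> Zp.
  by apply/eqP => /(congr1 (fun x => zres x 2)); rewrite pj zres0; lia.
split=> //; elim: k => [|k IH].
  rewrite expr0 -(@zvalE _ _ _ 1) ?zres_nat.
    by rewrite zres1 expn1 modn_small// logn1.
  by rewrite zres1 expn1 modn_small.
rewrite exprS zvalM ?expf_neq0// IH -add1n; congr addn.
by rewrite -(@zvalE _ _ _ 2) pj ?logn_prime ?eqxx// -lt0n ltnW.
Qed.

Definition pabs (R : realType) (q : Qp) : R :=
  if q == 0 then 0 else p%:R ^ (- ordp q).

Section pabs.
Variable R : realType.
Local Notation pabs := (pabs R).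

Lemma pgt1 : 1 < p%:R :> R. Proof. by rewrite ltr1n prime_gt1. Qed.

Lemma pabs_eq0 q : (pabs q == 0) = (q == 0).
Proof.
rewrite /pabs; case: ifP => h; first by rewrite eqxx.
by apply/negbTE; rewrite expfz_neq0// gt_eqF// (lt_trans ltr01 pgt1).
Qed.

Lemma pabs_ge0 q : 0 <= pabs q.
Proof. by rewrite /pabs; case: ifP => // _; rewrite exprz_ge0. Qed.

Lemma pabsN q : pabs (- q) = pabs q.
Proof. by rewrite /pabs oppr_eq0 ordpN. Qed.

Lemma pabsM q r : pabs (q * r) = pabs q * pabs r.
Proof.
rewrite /pabs mulf_eq0; case: eqVneq => [|q0] /=; first by rewrite mul0r.
case: eqVneq => [|r0] /=; first by rewrite mulr0.
by rewrite ordpM// opprD expfzDr// gt_eqF// (lt_trans ltr01 pgt1).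
Qed.

Lemma pabs_leX q (k : int) :
  (pabs q <= p%:R ^ (- k)) = (q == 0) || (k <= ordp q).
Proof.
rewrite /pabs; case: eqVneq => [_|q0] /=; first by rewrite exprz_ge0.
by rewrite ler_eXz2l ?pgt1// lerN2.
Qed.

Lemma pabsD q r : pabs (q + r) <= Num.max (pabs q) (pabs r).
Proof.
have [qr0|qr0] := eqVneq (q + r) 0.
  by rewrite {1}/pabs qr0 eqxx le_max pabs_ge0.
have H s t : s + t != 0 -> pabs t <= pabs s -> pabs (s + t) <= pabs s.
  move=> st0 ts; have [s0|s0] := eqVneq s 0.
    move: ts; rewrite {2}/pabs s0 eqxx => t0.
    have /eqP : pabs t = 0 by apply/le_anti; rewrite t0 pabs_ge0.
    rewrite pabs_eq0 => /eqP t0'.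
    by move: st0; rewrite s0 t0' addr0 eqxx.
  rewrite {2}/pabs (negbTE s0) pabs_leX (negbTE st0) /=.
  apply: ordpD => //; first by rewrite lexx orbT.
  by rewrite -pabs_leX; move: ts; rewrite {2}/pabs (negbTE s0).
case: (lerP (pabs q) (pabs r)) => h; last by apply: H => //; exact: ltW.
by rewrite addrC; apply: H => //; rewrite addrC.
Qed.

Lemma pabs_p : pabs p%:R = p%:R^-1.
Proof.
have [p0 vp] := zval_pX 1.
have -> : (p%:R : Qp) = (p%:R : Zp)%:F / 1%:F.
  by rewrite tofrac1 divr1 rmorph_nat.
have z1 : zval (1 : Zp) = 0%N by have [_] := zval_pX 0; rewrite expr0.
rewrite /pabs ordp_frac ?oner_neq0// -[X in zval X]expr1 vp z1 subr0.
by rewrite tofrac1 divr1 tofrac_eq0 (negbTE p0) exprN1.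
Qed.

End pabs.

(* The topology of |.|_p: see [nbhs_QpE]. *)
Definition nbhs_Qp (q : Qp) : set_system Qp :=
  filter_from setT
    (fun k : int => [set r | (r - q == 0) || (k <= ordp (r - q))]).

Lemma nbhs_Qp_filter q : ProperFilter (nbhs_Qp q).
Proof.
apply: filter_from_proper => [|k _]; last by exists q; rewrite /= subrr eqxx.
apply: filter_from_filter; first by exists 0.
move=> j k _ _; exists (Num.max j k) => // r /= /orP[->//|].
by rewrite ge_max => /andP[-> ->]; rewrite !orbT.
Qed.

Lemma nbhs_Qp_singleton q (A : set Qp) : nbhs_Qp q A -> A q.
Proof. by move=> [k _]; apply; rewrite /= subrr eqxx. Qed.

Lemma nbhs_Qp_nbhs q (A : set Qp) : nbhs_Qp q A -> nbhs_Qp q (nbhs_Qp^~ A).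
Proof.
move=> [k _ kA]; exists k => // r qr; exists k => // s rs; apply: kA => /=.
have -> : s - q = (s - r) + (r - q) by rewrite addrA subrK.
have [->//|sq] := eqVneq ((s - r) + (r - q)) 0.
by rewrite ordpD.
Qed.

HB.instance Definition _ := hasNbhs.Build Qp nbhs_Qp.
HB.instance Definition _ := Nbhs_isNbhsTopological.Build Qp
  nbhs_Qp_filter nbhs_Qp_singleton nbhs_Qp_nbhs.

Lemma nbhs_QpE (R : realType) (q : Qp) (A : set Qp) :
  nbhs q A <-> exists2 e : R, 0 < e & [set r | pabs R (r - q) < e] `<=` A.
Proof.
have p0 : 0 < p%:R :> R by rewrite (lt_trans ltr01 (pgt1 R)).
split=> [[k _ kA]|[e e0 eA]].
  exists (p%:R ^ (- k)); first by rewrite exprz_gt0.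
  by move=> r /= /ltW; rewrite pabs_leX => /kA.
pose k := Num.truncn e^-1.
exists k.+1%:Z => // r /=; rewrite -(pabs_leX R) => h; apply: eA => /=.
apply: (le_lt_trans h); rewrite -invr_expz -exprnP invf_plt ?posrE ?exprn_gt0//.
apply: lt_trans (truncnS_gt e^-1) _; rewrite -/k -natrX ltr_nat.
exact: ltn_expl (prime_gt1 pp).
Qed.

(* {y}_p, the representative of y in Z[1/p] \cap [0, 1[ modulo Z_p; it exists
   and is unique by [pfrac_ex] and [pfrac_uniq]. *)
Definition is_pfrac (R : realType) (y : Qp) (r : R) := exists k m : nat,
  [/\ (m < p ^ k)%N, r = m%:R / p%:R ^+ k &
      pabs R (y - m%:R / p%:R ^+ k) <= 1].

Definition pfrac (R : realType) (y : Qp) : R := xget 0 (is_pfrac y).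

Lemma zres_eq0 (x : Zp) k : (zres x k == 0%N) = (x == 0) || (k <= zval x)%N.
Proof.
have [->|x0] := eqVneq x 0; first by rewrite zres0.
by rewrite leqNgt -zres_zval// negbK.
Qed.

Lemma zres_sub (x y : Zp) k : (zres (x - y)%R k == 0%N) = (zres x k == zres y k).
Proof.
have : zres (x - y + y)%R k = ((zres (x - y)%R k + zres y k) %% p ^ k)%N by [].
rewrite subrK => ->; apply/eqP/eqP => [->|]; first by rewrite add0n zres_mod.
rewrite -{2}(zres_mod y k) -{2}[zres y k]add0n => /eqP.
by rewrite eqn_modDr mod0n zres_mod => /eqP.
Qed.

Lemma pabs_le1 (R : realType) (x y : Zp) : y != 0 ->
  (pabs R (x%:F / y%:F) <= 1) = (zres x (zval y) == 0%N).
Proof.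
move=> y0; rewrite -[1](expr0z p%:R) -[0%R]oppr0 pabs_leX zres_eq0.
rewrite mulf_eq0 invr_eq0 !tofrac_eq0 (negbTE y0) orbF.
by have [//|x0] /= := eqVneq x 0; rewrite ordp_frac// subr_ge0 lez_nat.
Qed.

Lemma fracB (x d : Zp) (m k : nat) : d != 0 ->
  x%:F / d%:F - m%:R / p%:R ^+ k =
  (x * p%:R ^+ k - m%:R * d)%:F / (d * p%:R ^+ k)%:F :> Qp.
Proof.
move=> d0; have [p0 _] := zval_pX 0.
have pE : (p%:R : Qp) = (p%:R : Zp)%:F by rewrite rmorph_nat.
have mE : (m%:R : Qp) = (m%:R : Zp)%:F by rewrite rmorph_nat.
rewrite pE mE -mulNr -tofracXn addf_div ?tofrac_eq0 ?expf_neq0//.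
by rewrite mulNr -!tofracM tofracB.
Qed.

Lemma pfrac_ex (R : realType) (y : Qp) : exists r : R, is_pfrac y r.
Proof.
elim/Qp_ind: y => n d d0; set v := zval d.
suff [m [mv E]] : exists m : nat, (m < p ^ v)%N /\
    zres (n * p%:R ^+ v)%R (v + v)%N = zres (m%:R * d)%R (v + v)%N.
  exists (m%:R / p%:R ^+ v), v, m; split=> //.
  have [p0 vp] := zval_pX v.
  by rewrite fracB// pabs_le1 ?mulf_neq0 ?expf_neq0// zvalM ?expf_neq0// vp zres_sub E.
have D0 : zres d (v + v).+1 != 0%N by rewrite zres_zval// ltnS leq_addr.
have := zvalE D0; rewrite -/v; set D := zres d (v + v).+1 => lD.
have [//|u cu DE] := @pfactor_coprime p D pp; rewrite ?lt0n//.
rewrite lD in DE.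
have u0 : (0 < u)%N by rewrite lt0n; apply: contraNneq D0 => u0; rewrite -/D DE u0.
case: (egcdnP (p ^ v) u0) => a b ab _.
have g1 : gcdn u (p ^ v) = 1%N.
  by apply/eqP; rewrite -/(coprime _ _) coprimeXr// coprime_sym.
rewrite g1 in ab.
set c := zres n (v + v)%N; exists ((c * a) %% p ^ v)%N.
split; first by rewrite ltn_mod pX_gt0.
rewrite zresM -natrX zres_nat modnMmr zresM zres_nat modnMml.
have -> : zres d (v + v)%N = (D %% p ^ (v + v))%N by rewrite /D zres_coh.
rewrite modnMmr DE mulnA expnD -!muln_modl; congr muln.
by rewrite modnMml -mulnA ab mulnDr muln1 mulnA modnMDl.
Qed.

Lemma pfrac_uniq (R : realType) (y : Qp) (r s : R) :
  is_pfrac y r -> is_pfrac y s -> r = s.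
Proof.
move=> [k [m [mk -> ym]]] [j [l [lj -> yl]]].
have p0 : p%:R != 0 :> R by rewrite gt_eqF// (lt_trans ltr01 (pgt1 R)).
have [pz vk] := zval_pX k; have [_ vj] := zval_pX j.
suff E : (m * p ^ j = l * p ^ k)%N.
  by apply/eqP; rewrite eqr_div ?expf_neq0// -!natrX -!natrM E.
have : pabs R (m%:R / p%:R ^+ k - l%:R / p%:R ^+ j) <= 1.
  have -> : m%:R / p%:R ^+ k - l%:R / p%:R ^+ j =
     (y - l%:R / p%:R ^+ j) + - (y - m%:R / p%:R ^+ k) :> Qp by ring.
  by apply: le_trans (pabsD _ _ _) _; rewrite pabsN ge_max ym yl.
have -> : m%:R / p%:R ^+ k = (m%:R : Zp)%:F / (p%:R ^+ k : Zp)%:F :> Qp.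
  by rewrite tofracXn !rmorph_nat.
rewrite fracB ?expf_neq0// pabs_le1 ?mulf_neq0 ?expf_neq0//.
rewrite zvalM ?expf_neq0// vk vj zres_sub -!natrX -!natrM !zres_nat.
rewrite !modn_small; first by move/eqP.
- by rewrite mulnC expnD ltn_pmul2l// pX_gt0.
- by rewrite expnD ltn_pmul2r// pX_gt0.
Qed.

End padic_numbers.

Notation "''Qp[' pp ]_ n" := 'rV[Qp pp]_n
  (at level 2, n at level 2, format "''Qp[' pp ]_ n") : type_scope.

Section Qpn.
Variables (R : realType) (p : nat) (pp : prime p) (n : nat).
Local Notation V := 'Qp[pp]_n.

Definition pnorm (x : V) : R := \big[Num.max/0]_(i < n) pabs R (x ord0 i).

Definition pdot (x y : V) : Qp pp := \sum_(i < n) x ord0 i * y ord0 i.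

Definition cexp (z : R[i]) : R[i] :=
  (expR (complex.Re z))%:C * (cos (complex.Im z) +i* sin (complex.Im z)).

Definition Psi (y : Qp pp) : R[i] := cexp ((2 * pi * pfrac R y) *i).

Definition borelQpn := g_sigma_algebraType (@open V).

(* A translation-invariant Borel measure giving the compact open unit ball
   Z_p^n volume 1 is the normalized Haar measure, by uniqueness. *)
Definition is_haar (mu : {measure set borelQpn -> \bar R}) :=
  (forall (x : V) (A : set borelQpn), measurable A ->
     mu [set x + (y : V) | y in A] = mu A) /\
  mu [set x : V | pnorm x <= 1] = 1%E.

(* Real and imaginary parts are integrated separately; as for [Rintegral], the
   value is junk when they are not integrable. *)
Definition cintegral d (T : measurableType d) (mu : {measure set T -> \bar R})
    (D : set T) (f : T -> R[i]) : R[i] :=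
  (\int[mu]_(x in D) complex.Re (f x)) +i* (\int[mu]_(x in D) complex.Im (f x)).

Definition in_M (lam : R) (phi : V -> R[i]) : Prop :=
  exists (l : int) (C : R), [/\ 0 < C,
    forall x x' : V, pnorm x' <= p%:R ^ l -> phi (x + x') = phi x &
    forall x : V, Normc.normc (phi x) <= C * (1 + pnorm x `^ lam)].

Definition in_M_unif (T lam : R) (phi : V -> R -> R[i]) : Prop :=
  exists (l : int) (C : R), [/\ 0 < C,
    forall t, 0 <= t <= T ->
      forall x x' : V, pnorm x' <= p%:R ^ l -> phi (x + x') t = phi x t &
    forall t, 0 <= t <= T ->
      forall x : V, Normc.normc (phi x t) <= C * (1 + pnorm x `^ lam)].

Definition normM (T lam : R) (phi : V -> R -> R[i]) : R :=
  sup [set sup [set Normc.normc (phi x t / (1 + pnorm x `^ lam)%:C)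
                 | x in [set: V]] | t in [set t : R | 0 <= t <= T]].

(* on M_lam x M_lam, functions of x alone being constant in t *)
Definition normMM (T lam : R) (phi : V -> R[i]) (f : V -> R -> R[i]) : R :=
  normM T lam (fun x _ => phi x) + normM T lam f.

Definition slab (T : R) : set (V * R) := [set z | 0 <= z.2 <= T].

Definition is_weight (gam : R) (w : V -> R) : Prop :=
  [/\ continuous w,
      forall x y : V, pnorm x = pnorm y -> w x = w y,
      forall y : V, 0 <= w y,
      forall y : V, w y = 0 <-> y = 0 &
      exists C0 C1 : R, [/\ 0 < C0, 0 < C1 &
        forall y : V, C0 * pnorm y `^ gam <= w y <= C1 * pnorm y `^ gam]].

Section operators.
Variable mu : {measure set borelQpn -> \bar R}.

Definition Asym (w : V -> R) (xi : V) : R[i] :=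
  cintegral mu setT (fun y : V => (1 - Psi (- pdot y xi)) / (w y)%:C).

Definition Wop (w : V -> R) (phi : V -> R[i]) (x : V) : R[i] :=
  cintegral mu setT (fun y : V => (phi (x - y) - phi x) / (w y)%:C).

(* The exponents are alpha_ 1 < ... < alpha_ N < alpha, the coefficients are
   a 0, ..., a N and b, and w gam is the weight attached to the exponent gam. *)
Variables (N : nat) (alpha_ : nat -> R) (alpha : R) (w : R -> V -> R).
Variables (a : nat -> V -> R -> R) (b : V -> R -> R).

Definition Zker (x : V) (t : R) (y : V) (th : R) : R[i] :=
  cintegral mu setT (fun xi : V =>
    Psi (pdot x xi) * cexp (- (a 0%N y th * t)%:C * Asym (w alpha) xi)).

Definition Rker (x : V) (t : R) (xi : V) (tau : R) : R[i] :=
  (a 0%N x t - a 0%N xi tau)%:C *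
    Wop (w alpha) (fun z => Zker z (t - tau) xi tau) (x - xi) +
  \sum_(1 <= k < N.+1) (a k x t)%:C *
    Wop (w (alpha_ k)) (fun z => Zker z (t - tau) xi tau) (x - xi) -
  (b x t)%:C * Zker (x - xi) (t - tau) xi tau.

(* Shifted index: [Riter m] is R_{m+1}. *)
Fixpoint Riter (m : nat) (x : V) (t : R) (xi : V) (tau : R) : R[i] :=
  if m is m'.+1 then
    cintegral (@lebesgue_measure R) `]tau, t[ (fun th : R =>
      cintegral mu setT (fun eta : V =>
        Rker x t eta th * Riter m' eta th xi tau))
  else Rker x t xi tau.

Definition Phiker (x : V) (t : R) (xi : V) (tau : R) : R[i] :=
  limn (fun M : nat => \sum_(0 <= m < M) Riter m x t xi tau : R[i]^o).

Definition Lambda (x : V) (t : R) (xi : V) (tau : R) : R[i] :=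
  Zker (x - xi) (t - tau) xi tau +
  cintegral (@lebesgue_measure R) `]tau, t[ (fun th : R =>
    cintegral mu setT (fun eta : V =>
      Zker (x - eta) (t - th) eta th * Phiker eta th xi tau)).

Definition Lop (phi : V -> R[i]) (f : V -> R -> R[i]) (x : V) (t : R) : R[i] :=
  if t == 0 then phi x else
    cintegral (@lebesgue_measure R) `]0, t[ (fun tau : R =>
      cintegral mu setT (fun xi : V => Lambda x t xi tau * f xi tau)) +
    cintegral mu setT (fun xi : V => Lambda x t xi 0 * phi xi).

End operators.

Definition Ldom (T lam : R) (phi : V -> R[i]) (f : V -> R -> R[i]) : Prop :=
  [/\ in_M lam phi, in_M_unif T lam f &
      {within slab T, continuous (fun z => f z.1 z.2 : R[i]^o)}].

End Qpn.

(* Main.v *)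
Require Import Defs.
From HB Require Import structures.
From mathcomp Require Import all_boot all_order all_algebra.
From mathcomp Require Import complex.
From mathcomp Require Import all_classical all_reals all_analysis.
From mathcomp Require Import zify ring lra measurable_realfun.

Set Implicit Arguments.
Unset Strict Implicit.
Unset Printing Implicit Defensive.
Import Order.TTheory GRing.Theory Num.Theory numFieldNormedType.Exports.

Local Open Scope classical_set_scope.
Local Open Scope ring_scope.
Local Open Scope complex_scope.

(** The estimate says that [Lambda x t xi tau] is dominated by a kernel that behaves
    like an approximate identity and decays fast enough to preserve growth of order
    [lam]. Write [d] for the dimension and [scale s = s ^ (1 / (alpha - d))] for the
    distance reached by the diffusion in time [s]; the [profile] of exponent [g] and
    scale [rho] is [rho ^ (g - d) * max rho |x| ^ (- g)], whose integral is bounded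
    independently of [rho] when [g > d].

    The symbol of the operator of order [alpha] is bounded above and below by
    multiples of [|xi| ^ (alpha - d)] ([symbol_upper], [symbol_lower]) and is constant
    on every ball that misses the origin ([symbol_shift]). Hence [Z] with a frozen
    coefficient, the Fourier transform of the exponential of the symbol, is at most a
    multiple of the profile of exponent [alpha] ([heat_profile]), and an operator of
    order [gam] turns it into [O (max (scale s) |x| ^ (- gam))] ([Wop_heat]).

    In the kernel [R] the leading term carries the difference of two values of the
    first coefficient. For [|x - xi|] small it is [O ((t - tau) ^ v)], by local
    constancy in space and the Hoelder condition in time; for [|x - xi|] bounded from
    below the kernel has no singularity. The lower order terms have a time singularity
    of order [(alpha_ k - d) / (alpha - d) < 1 - v]. So [R] is at most a
    constant times [(t - tau) ^ (v - 1)] times the majorant [major], the sum of the profiles of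
    exponent [g] at the scales [scale (t - tau)] and [1], where [g] is [alpha_ 1], or
    [alpha] when the lower order terms are absent ([Rker_le]).

    By the ultrametric inequality the product of two majorants at [x - y] and
    [y - xi] is at most a constant times a majorant at [x - xi] times their sum
    ([major_conv]), so the
    space integrals in the iterated kernels reproduce the majorant and only the time
    integrals remain. With a strong exponential weight in time each of these gains a
    factor [1 / 2] ([Riter_le]), the series of iterated kernels is geometric, and
    [Lambda] is bounded by the majorant ([Lambda_le]). As [d < g - lam], integrating
    the majorant against [1 + |y| ^ lam] gives at most a multiple of [1 + |x| ^ lam]
    ([major_weight]), which is the estimate.

    The coefficients and the data are invariant under one small ball of translations,
    and so is the Haar measure; hence the solution is locally constant too
    ([Lop_shift]).

    The integrals are estimated without joint measurability of the kernels. The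
    integral of a nonnegative function is the supremum of the integrals of the simple functions
    below it, which is monotone, and subadditive when one of the summands is
    measurable; so a measurable majorant of [F - G] controls the difference of the
    integrals of [F] and [G] ([cintegral_near]). This is the only property of the
    integral that the estimates of [Lambda] and of the solution rely on. *)

Local Notation nrm := Normc.normc.

(** * The modulus of a complex number *)

Section complex_modulus.
Variable R : realType.
Implicit Types z w : R[i].

Lemma nrm_ge0 z : 0 <= nrm z.
Proof. by case: z => a b /=; exact: sqrtr_ge0. Qed.

Lemma nrmN z : nrm (- z) = nrm z. Proof. exact: normcN. Qed.

Lemma nrmB z w : nrm (z - w) = nrm (w - z).
Proof. by rewrite -nrmN opprB. Qed.

Lemma nrm_real (x : R) : nrm x%:C = `|x|.
Proof. by rewrite /= expr0n/= addr0 sqrtr_sqr. Qed.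

Lemma nrmMr (x : R) z : nrm (x%:C * z) = `|x| * nrm z.
Proof. by rewrite Normc.normcM nrm_real. Qed.

Lemma Re_le_nrm z : `|complex.Re z| <= nrm z.
Proof. by case: z => a b /=; rewrite -sqrtr_sqr ler_wsqrtr// lerDl sqr_ge0. Qed.

Lemma Im_le_nrm z : `|complex.Im z| <= nrm z.
Proof. by case: z => a b /=; rewrite -sqrtr_sqr ler_wsqrtr// lerDr sqr_ge0. Qed.

Lemma nrm_le_ReIm z : nrm z <= `|complex.Re z| + `|complex.Im z|.
Proof.
case: z => a b /=.
have -> : `|a| + `|b| = Num.sqrt ((`|a| + `|b|) ^+ 2).
  by rewrite sqrtr_sqr [RHS]ger0_norm// addr_ge0.
rewrite ler_wsqrtr// sqrrD !real_normK ?num_real//.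
have := mulr_ge0 (normr_ge0 a) (normr_ge0 b); lra.
Qed.

Lemma nrm_ltD z w : nrm w <= nrm z + nrm (w - z).
Proof. by rewrite -{1}(subrK z w) addrC le_normcD. Qed.

Lemma nrmB_le z w u : nrm (z - w) <= nrm (z - u) + nrm (w - u).
Proof.
have -> : z - w = (z - u) + - (w - u) by rewrite opprB addrA subrK.
by apply: le_trans (le_normcD _ _) _; rewrite nrmN.
Qed.

Lemma ReB z w : complex.Re (z - w) = complex.Re z - complex.Re w.
Proof. by case: z w => a b [c e]. Qed.

Lemma ImB z w : complex.Im (z - w) = complex.Im z - complex.Im w.
Proof. by case: z w => a b [c e]. Qed.

End complex_modulus.

(** * Integration without measurability *)

Section lower_integral.
Local Open Scope ereal_scope.
Context d (T : measurableType d) (R : realType).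
Variable mu : {measure set T -> \bar R}.
Import HBNNSimple.

(** The integral of a nonnegative function is by definition the supremum of the
    integrals of the simple functions below it, measurable or not. *)
Lemma lower_integral_le (f : T -> \bar R) (c : \bar R) :
  (forall x, 0 <= f x) ->
  (forall h : {nnsfun T >-> R}, (forall x, (h x)%:E <= f x) ->
     \int[mu]_x (h x)%:E <= c) ->
  \int[mu]_x f x <= c.
Proof.
move=> f0 fc; rewrite ge0_integralTE//; apply/ge_ereal_sup => _ [h /= hf <-].
have := fc h hf; rewrite integral_nnsfun// patch_setT//.
Qed.

Lemma lower_integral_mono (D : set T) (f g : T -> \bar R) :
  (forall x, D x -> 0 <= f x) -> (forall x, D x -> f x <= g x) ->
  \int[mu]_(x in D) f x <= \int[mu]_(x in D) g x.
Proof.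
move=> f0 fg; have g0 x : D x -> 0 <= g x.
  by move=> Dx; apply: le_trans (fg _ Dx); exact: f0.
rewrite !ge0_integralE//; apply: le_ereal_sup => _ [h /= hf <-].
exists h => //= x; apply: le_trans (hf x) _.
by apply: lee_restrict => // y /fg.
Qed.

(** A simple [s <= f + h] satisfies [(s - h)^+ <= f], where [(s - h)^+] is
    measurable; so the lower integral is subadditive as soon as one summand is
    measurable. *)
Lemma lower_integralD_le (D : set T) (f : T -> \bar R) (h : T -> R) :
  measurable D -> (forall x, D x -> 0 <= f x) -> measurable_fun D h ->
  (forall x, D x -> 0 <= h x)%R ->
  \int[mu]_(x in D) (f x + (h x)%:E) <=
  \int[mu]_(x in D) f x + \int[mu]_(x in D) (h x)%:E.
Proof.
move=> mD f0 mh h0; rewrite !(integral_mkcond D).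
pose F : T -> \bar R := f \_ D; pose H : T -> \bar R := (fun x => (h x)%:E) \_ D.
rewrite -/F -/H.
have F0 x : 0 <= F x by apply: erestrict_ge0.
have H0 x : 0 <= H x by apply: erestrict_ge0 => y Dy; rewrite lee_fin h0.
have mH : measurable_fun setT H.
  by apply/(measurable_restrictT _ _).1 => //; exact/measurable_EFinP.
have -> : (fun x => f x + (h x)%:E) \_ D = (fun x => F x + H x).
  by apply/funext => x; rewrite /F /H /patch; case: ifPn => //; rewrite adde0.
apply: lower_integral_le => [x|s sFH]; first by rewrite adde_ge0.
pose k x := maxe ((s x)%:E - H x) 0.
have Hfin x : H x \is a fin_num by rewrite /H /patch; case: ifPn.
have mk : measurable_fun setT k.
  apply: measurable_maxe => //; apply: emeasurable_funB => //.
  exact/measurable_EFinP/measurable_funP.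
have k0 x : 0 <= k x by rewrite /k le_max lexx orbT.
have skH x : (s x)%:E <= k x + H x.
  rewrite -leeBlDr ?Hfin//.
  by rewrite /k le_max lexx.
apply: (@le_trans _ _ (\int[mu]_x (k x + H x))).
  by apply: lower_integral_mono => x _; rewrite ?lee_fin ?fun_ge0.
rewrite ge0_integralD//; apply: leeD2r.
apply: lower_integral_mono => // x _; rewrite /k ge_max F0 andbT.
by rewrite leeBlDr ?Hfin.
Qed.

(** Substitution holds for arbitrary integrands, because composition with an
    invertible measure preserving map permutes the simple functions. *)
Lemma lower_integral_subst_le (tau tau' : T -> T) (f : T -> \bar R) :
  measurable_fun setT tau -> measurable_fun setT tau' -> cancel tau tau' ->
  cancel tau' tau -> (forall A, measurable A -> mu (tau @^-1` A) = mu A) ->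
  (forall x, 0 <= f x) -> \int[mu]_x f (tau x) <= \int[mu]_x f x.
Proof.
move=> mt mt' tK tK' mut f0; apply: lower_integral_le => // s sf.
have ms' : measurable_fun setT (fun x => (s (tau' x))%:E).
  by apply/measurable_EFinP; apply: measurableT_comp => //; exact: measurable_funP.
have -> : \int[mu]_x (s x)%:E = \int[mu]_x (s (tau' x))%:E.
  transitivity (\int[pushforward mu tau]_x (s (tau' x))%:E); last first.
    by apply: eq_measure_integral => A mA _; exact: mut.
  rewrite ge0_integral_pushforward//; last by move=> x _; rewrite lee_fin fun_ge0.
  by apply: eq_integral => x _ /=; rewrite tK.
apply: lower_integral_mono => x _; first by rewrite lee_fin fun_ge0.
by rewrite -{2}(tK' x); exact: sf.
Qed.

End lower_integral.

Section domination.
Context d (T : measurableType d) (R : realType).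
Variable mu : {measure set T -> \bar R}.
Implicit Types (D : set T) (f g h k : T -> R) (F G : T -> R[i]).

(** The form that domination takes throughout: a measurable majorant together with
    a numerical bound for its integral. *)
Definition int_le D h (c : R) :=
  [/\ measurable_fun D h, forall x, D x -> 0 <= h x &
      (\int[mu]_(x in D) (h x)%:E <= c%:E)%E].

Lemma int_leS D h c e : c <= e -> int_le D h c -> int_le D h e.
Proof.
by move=> ce [mh h0 hc]; split=> //; rewrite (le_trans hc)// lee_fin.
Qed.

Lemma int_leD D h k c e : measurable D -> int_le D h c -> int_le D k e ->
  int_le D (fun x => h x + k x) (c + e).
Proof.
move=> mD [mh h0 hc] [mk k0 ke]; split.
- exact: measurable_funD.
- by move=> x Dx; rewrite addr_ge0 ?h0 ?k0.
- under eq_integral do rewrite EFinD.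
  rewrite ge0_integralD//.
  + by rewrite EFinD leeD.
  + exact/measurable_EFinP.
  + exact/measurable_EFinP.
Qed.

Lemma int_leZ D h c (r : R) : measurable D -> 0 <= r -> int_le D h c ->
  int_le D (fun x => r * h x) (r * c).
Proof.
move=> mD r0 [mh h0 hc]; split.
- exact: measurable_funM.
- by move=> x Dx; rewrite mulr_ge0 ?h0.
- under eq_integral do rewrite EFinM.
  rewrite ge0_integralZl//; [|exact/measurable_EFinP].
  by rewrite EFinM lee_wpmul2l// lee_fin.
Qed.

Lemma int_le_ge0 D h c : int_le D h c -> 0 <= c.
Proof.
move=> [mh h0 hc]; rewrite -lee_fin (le_trans _ hc)//.
by apply: integral_ge0 => x Dx; rewrite lee_fin h0.
Qed.

Lemma int_le_mono D h k c : measurable_fun D h -> (forall x, D x -> 0 <= h x <= k x) ->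
  int_le D k c -> int_le D h c.
Proof.
move=> mh hk [mk k0 kc]; split=> //; first by move=> x /hk/andP[].
apply: le_trans kc; apply: lower_integral_mono => x /hk/andP[h0 hkx].
  by rewrite lee_fin.
by rewrite lee_fin.
Qed.

(** The positive parts of [f] and [g] differ by at most [h], which is measurable, so
    their lower integrals differ by at most [c]; the same holds for the negative parts.
    The majorant [k] only serves to make the four lower integrals finite. *)
Lemma Rintegral_near D f g h k c e : measurable D ->
  int_le D h c -> int_le D k e ->
  (forall x, D x -> `|f x - g x| <= h x) -> (forall x, D x -> `|g x| <= k x) ->
  `|\int[mu]_(x in D) f x - \int[mu]_(x in D) g x| <= 2 * c.
Proof.
move=> mD Hh Hk fgh gk.
have [mh h0 hc] := Hh; have [mk k0 ke] := Hk; have [mhk hk0 hke] := int_leD mD Hh Hk.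
have c0 := int_le_ge0 Hh; have e0 := int_le_ge0 Hk.
have fhk x : D x -> `|f x| <= h x + k x.
  move=> Dx; have := fgh x Dx; have := gk x Dx.
  by rewrite -{2}(subrK (g x) (f x)) => A B; apply: le_trans (ler_normD _ _) (lerD B A).
(* the four positive and negative parts have finite lower integrals *)
have fin (u : T -> R) : (forall x, D x -> 0 <= u x <= h x + k x) ->
    (\int[mu]_(x in D) (u x)%:E)%E \is a fin_num.
  move=> u01; rewrite ge0_fin_numE.
    apply: le_lt_trans (ltry (c + e)); apply: le_trans hke.
    by apply: lower_integral_mono => x /u01/andP[u0 u1]; rewrite lee_fin.
  by apply: integral_ge0 => x /u01/andP[u0 _]; rewrite lee_fin.
have split_int (u : T -> R) : (forall x, D x -> `|u x| <= h x + k x) ->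
  \int[mu]_(x in D) u x = \int[mu]_(x in D) (Num.max (u x) 0) -
     \int[mu]_(x in D) (Num.max (- u x) 0).
  move=> uhk; rewrite /Rintegral integralE.
  have -> : (\int[mu]_(x in D) (fun x => (u x)%:E)^\+ x =
      \int[mu]_(x in D) (Num.max (u x) 0)%:E)%E.
    by apply: eq_integral => x _; rewrite funeposE EFin_max.
  have -> : (\int[mu]_(x in D) (fun x => (u x)%:E)^\- x =
      \int[mu]_(x in D) (Num.max (- u x) 0)%:E)%E.
    by apply: eq_integral => x _; rewrite funenegE EFin_max EFinN.
  rewrite fineB//; apply: fin => x Dx; have := uhk _ Dx;
    rewrite ler_norml => /andP[A B];
    by rewrite le_max lexx orbT/= ge_max hk0// andbT; lra.
have cmp (u w : T -> R) : (forall x, D x -> `|u x| <= h x + k x) ->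
    (forall x, D x -> `|w x| <= h x + k x) ->
    (forall x, D x -> `|u x - w x| <= h x) ->
    \int[mu]_(x in D) Num.max (u x) 0 <= \int[mu]_(x in D) Num.max (w x) 0 + c.
  move=> uhk whk uwh.
  have B (q : T -> R) : (forall x, D x -> `|q x| <= h x + k x) ->
      forall x, D x -> 0 <= Num.max (q x) 0 <= h x + k x.
    move=> qhk x Dx; have := qhk _ Dx; rewrite ler_norml => /andP[_ Bq].
    by rewrite le_max lexx orbT/= ge_max Bq hk0.
  rewrite /Rintegral -lee_fin EFinD !fineK ?fin//; try exact: B.
  apply: (@le_trans _ _
      (\int[mu]_(x in D) ((Num.max (w x) 0)%:E + (h x)%:E))%E).
    apply: lower_integral_mono => x Dx; first by case/andP: (B _ uhk _ Dx).
    rewrite -EFinD lee_fin; have := uwh _ Dx; have := h0 _ Dx.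
    rewrite ler_norml => h0x /andP[_ uw]; rewrite ge_max.
    have : w x <= Num.max (w x) 0 by rewrite le_max lexx.
    have : 0 <= Num.max (w x) 0 by rewrite le_max lexx orbT.
    move=> ? ?; apply/andP; split; lra.
  apply: le_trans (lower_integralD_le mu mD _ mh h0) _.
    by move=> x Dx; case/andP: (B _ whk _ Dx).
  by rewrite leeD2l.
have ghk x : D x -> `|g x| <= h x + k x.
  by move=> Dx; rewrite (le_trans (gk _ Dx))// lerDr h0.
rewrite (split_int f)// (split_int g)//.
have C1 := cmp f g fhk ghk fgh.
have C2 : \int[mu]_(x in D) Num.max (g x) 0 <=
    \int[mu]_(x in D) Num.max (f x) 0 + c.
  by apply: cmp => // x Dx; rewrite distrC fgh.
have C3 : \int[mu]_(x in D) Num.max (- f x) 0 <=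
    \int[mu]_(x in D) Num.max (- g x) 0 + c.
  by apply: cmp => x Dx; rewrite ?normrN ?fhk ?ghk// opprK addrC distrC fgh.
have C4 : \int[mu]_(x in D) Num.max (- g x) 0 <=
    \int[mu]_(x in D) Num.max (- f x) 0 + c.
  by apply: cmp => x Dx; rewrite ?normrN ?fhk ?ghk// opprK addrC fgh.
rewrite ler_norml; apply/andP; split; lra.
Qed.

(** Stands in for linearity of the integral, which may fail when [F] and [G] are
    not measurable: the constant is [2] for each of the real and imaginary parts. *)
Lemma cintegral_near D F G h k c e : measurable D ->
  int_le D h c -> int_le D k e ->
  (forall x, D x -> nrm (F x - G x) <= h x) -> (forall x, D x -> nrm (G x) <= k x) ->
  nrm (cintegral mu D F - cintegral mu D G) <= 4 * c.
Proof.
move=> mD Hh Hk FG Gk; apply: le_trans (nrm_le_ReIm _) _.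
rewrite ReB ImB /=.
have A := @Rintegral_near D (fun x => complex.Re (F x)) (fun x => complex.Re (G x)) h k c e mD Hh Hk.
have B := @Rintegral_near D (fun x => complex.Im (F x)) (fun x => complex.Im (G x)) h k c e mD Hh Hk.
have -> : 4 * c = 2 * c + 2 * c by ring.
apply: lerD; [apply: A|apply: B] => x Dx /=; rewrite -?ReB -?ImB.
- exact: le_trans (Re_le_nrm _) (FG _ Dx).
- exact: le_trans (Re_le_nrm _) (Gk _ Dx).
- exact: le_trans (Im_le_nrm _) (FG _ Dx).
- exact: le_trans (Im_le_nrm _) (Gk _ Dx).
Qed.

Lemma cintegral0 D : cintegral mu D (fun=> 0) = 0 :> R[i].
Proof. by rewrite /cintegral /Rintegral !integral0. Qed.

Lemma cintegral_le D F h c : measurable D -> int_le D h c ->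
  (forall x, D x -> nrm (F x) <= h x) -> nrm (cintegral mu D F) <= 4 * c.
Proof.
move=> mD Hh Fh; rewrite -[X in nrm X]subr0 -(cintegral0 D).
apply: (cintegral_near mD Hh Hh) => x Dx; first by rewrite subr0 Fh.
by rewrite Normc.normc0; case: Hh => _ h0 _; exact: h0.
Qed.

Lemma eq_cintegral D F G : (forall x, D x -> F x = G x) ->
  cintegral mu D F = cintegral mu D G.
Proof.
by move=> FG; rewrite /cintegral; congr Complex; apply: eq_Rintegral => x /[!inE] /FG ->.
Qed.

Lemma cintegral_subst (tau tau' : T -> T) F :
  measurable_fun setT tau -> measurable_fun setT tau' -> cancel tau tau' ->
  cancel tau' tau -> (forall A, measurable A -> mu (tau @^-1` A) = mu A) ->
  cintegral mu setT (fun x => F (tau x)) = cintegral mu setT F.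
Proof.
move=> mt mt' tK tK' mut.
have mut' A : measurable A -> mu (tau' @^-1` A) = mu A.
  move=> mA; rewrite -(mut (tau' @^-1` A)).
    by congr (mu _); apply/seteqP; split=> x /=; rewrite tK.
  by rewrite -[_ @^-1` _]setTI; exact: mt'.
have E (f : T -> \bar R) : (forall x, 0 <= f x)%E ->
    (\int[mu]_x f (tau x) = \int[mu]_x f x)%E.
  move=> f0; apply/eqP; rewrite eq_le (lower_integral_subst_le mt mt' tK tK' mut)//=.
  have := lower_integral_subst_le mt' mt tK' tK mut' (fun x => f0 (tau x)).
  rewrite /=; rewrite (_ : (fun x => f (tau (tau' x))) = f)//.
  by apply/funext => x; rewrite tK'.
have E' (f : T -> R) : \int[mu]_x f (tau x) = \int[mu]_x f x.
  rewrite /Rintegral integralE [X in _ = fine X]integralE.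
  congr (fine (_ - _)).
    rewrite -[RHS](E _ (funepos_ge0 _)); apply: eq_integral => x _.
    by rewrite !funeposE.
  rewrite -[RHS](E _ (funeneg_ge0 _)); apply: eq_integral => x _.
  by rewrite !funenegE.
by rewrite /cintegral (E' (fun x => complex.Re (F x))) (E' (fun x => complex.Im (F x))).
Qed.

End domination.

(** * Geometry of the p-adic space *)

Section ultrametric.
Variables (R : realType) (p : nat) (pp : prime p) (n : nat).
Local Notation V := 'Qp[pp]_n.
Local Notation pn := (pnorm R).
Implicit Types x y z : V.

Lemma pR_gt0 : 0 < p%:R :> R. Proof. exact: lt_trans ltr01 (pgt1 pp R). Qed.

Lemma pXR_gt0 (k : int) : 0 < p%:R ^ k :> R.
Proof. by rewrite exprz_gt0// pR_gt0. Qed.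

Lemma pnorm_ge0 x : 0 <= pn x.
Proof. by rewrite /pnorm; elim/big_ind: _ => [|a b a0 b0|i _]; rewrite ?le_max ?a0 ?pabs_ge0. Qed.

Lemma pabs_le_pnorm x i : pabs R (x ord0 i) <= pn x.
Proof. by rewrite /pnorm (bigD1 i)//= le_max lexx. Qed.

Lemma pnorm_le x (c : R) : 0 <= c -> (forall i, pabs R (x ord0 i) <= c) -> pn x <= c.
Proof.
move=> c0 xc; rewrite /pnorm; elim/big_ind: _ => // a b ac bc.
by rewrite ge_max ac bc.
Qed.

Lemma pabs0 : pabs R (0 : Qp pp) = 0. Proof. by rewrite /pabs eqxx. Qed.

Lemma pnorm0 : pn (0 : V) = 0.
Proof.
apply/eqP; rewrite eq_le pnorm_ge0 andbT; apply: pnorm_le => // i.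
by rewrite mxE pabs0.
Qed.

Lemma pnorm_eq0 x : (pn x == 0) = (x == 0).
Proof.
apply/eqP/eqP => [x0|->]; last exact: pnorm0.
apply/rowP => i; rewrite mxE; apply/eqP; rewrite -(pabs_eq0 R) eq_le pabs_ge0 andbT.
by rewrite -x0 pabs_le_pnorm.
Qed.

Lemma pnorm_gt0 x : (0 < pn x) = (x != 0).
Proof. by rewrite lt_def pnorm_ge0 andbT pnorm_eq0. Qed.

Lemma pnormN x : pn (- x) = pn x.
Proof. by apply: eq_bigr => i _; rewrite mxE pabsN. Qed.

Lemma pnormB x y : pn (x - y) = pn (y - x).
Proof. by rewrite -pnormN opprB. Qed.

Lemma pnormD x y : pn (x + y) <= Num.max (pn x) (pn y).
Proof.
apply: pnorm_le => [|i]; first by rewrite le_max pnorm_ge0.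
by rewrite mxE (le_trans (pabsD _ _ _))// ge_max !le_max !pabs_le_pnorm ?orbT.
Qed.

Lemma pnormD_le x y (c : R) : pn x <= c -> pn y <= c -> pn (x + y) <= c.
Proof. by move=> xc yc; rewrite (le_trans (pnormD _ _))// ge_max xc. Qed.

Lemma pnormD_lt x y (c : R) : pn x < c -> pn y < c -> pn (x + y) < c.
Proof. by move=> xc yc; rewrite (le_lt_trans (pnormD _ _))// gt_max xc. Qed.

Lemma pnormD_eq x y : pn y < pn x -> pn (x + y) = pn x.
Proof.
move=> yx; apply/eqP; rewrite eq_le pnormD_le//=; last exact: ltW.
rewrite leNgt; apply/negP => xyx; have := pnormD_lt xyx (_ : pn (- y) < pn x).
by rewrite pnormN addrK ltxx => /(_ yx).
Qed.

Lemma pnormZ (c : Qp pp) x : pn (c *: x) = pabs R c * pn x.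
Proof.
apply/eqP; rewrite eq_le; apply/andP; split.
  apply: pnorm_le => [|i]; first by rewrite mulr_ge0 ?pabs_ge0 ?pnorm_ge0.
  by rewrite mxE pabsM ler_wpM2l ?pabs_ge0 ?pabs_le_pnorm.
rewrite /pnorm; elim/big_ind: _ => [|a b ac bc|i _].
- by rewrite mulr0 pnorm_ge0.
- by case: (leP a b).
- by have := pabs_le_pnorm (c *: x) i; rewrite mxE pabsM.
Qed.

Lemma pnorm_attained x : x != 0 -> exists i, pn x = pabs R (x ord0 i).
Proof.
rewrite -pnorm_gt0 => x0; apply: contrapT => nx.
suff : pn x < pn x by rewrite ltxx.
rewrite {1}/pnorm; elim/big_ind: _ => // [a b ac bc|i _]; first by rewrite gt_max ac.
rewrite lt_neqAle pabs_le_pnorm andbT; apply/eqP => E; apply: nx; exists i.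
by rewrite E.
Qed.

Lemma pnorm_pX x : x != 0 -> exists k : int, pn x = p%:R ^ k.
Proof.
move=> x0; have [i xi] := pnorm_attained x0; exists (- ordp (x ord0 i)).
move: xi; rewrite /pabs; case: eqP => // _ x00.
by move: x0; rewrite -(pnorm_eq0 x) x00 eqxx.
Qed.

Lemma pabs_pX (k : int) : pabs R ((p%:R : Qp pp) ^ k) = p%:R ^ (- k).
Proof.
have P (m : nat) : pabs R ((p%:R : Qp pp) ^+ m) = p%:R ^- m.
  elim: m => [|m IH]; last by rewrite exprS pabsM IH pabs_p exprS invfM.
  rewrite !expr0 invr1; have := pabsM R (1 : Qp pp) 1.
  rewrite mulr1 -{1}[pabs R 1]mulr1 => /mulfI <-//.
  by rewrite pabs_eq0 oner_eq0.
case: k => m; first by rewrite -exprnP P -invr_expz.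
rewrite NegzE opprK -exprnN -exprnP -[RHS]invrK -P.
have pm0 : (p%:R : Qp pp) ^+ m.+1 != 0.
  rewrite -(pabs_eq0 R) P invr_eq0 expf_neq0// gt_eqF// pR_gt0//.
by apply: (mulfI (_ : pabs R ((p%:R : Qp pp) ^+ m.+1) != 0));
  rewrite ?pabs_eq0// -pabsM divff// divff ?pabs_eq0// -(expr0 (p%:R)) P expr0 invr1.
Qed.

Lemma pdot_le x y : pabs R (pdot x y) <= pn x * pn y.
Proof.
rewrite /pdot; elim/big_ind: _ => [|a b ac bc|i _].
- by rewrite pabs0 mulr_ge0 ?pnorm_ge0.
- by rewrite (le_trans (pabsD _ _ _))// ge_max ac.
- by rewrite pabsM ler_pM ?pabs_ge0 ?pabs_le_pnorm.
Qed.

Lemma pdotC x y : pdot x y = pdot y x.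
Proof. by apply: eq_bigr => i _; rewrite mulrC. Qed.

Lemma pdotDl x y z : pdot (x + y) z = pdot x z + pdot y z.
Proof. by rewrite -big_split; apply: eq_bigr => i _; rewrite mxE mulrDl. Qed.

Lemma pdotDr x y z : pdot z (x + y) = pdot z x + pdot z y.
Proof. by rewrite pdotC pdotDl !(pdotC z). Qed.

Lemma pdotNl x y : pdot (- x) y = - pdot x y.
Proof. by rewrite -sumrN; apply: eq_bigr => i _; rewrite mxE mulNr. Qed.

(** A multiple of the basis vector along which [x] attains its norm. By [pdot_le] no
    solution of this equation has smaller norm, and on [z] the character takes the
    value of a primitive [p]-th root of unity. *)
Lemma pdot_dual x : x != 0 ->
  exists z, pdot x z = (p%:R : Qp pp)^-1 /\ pn z = p%:R / pn x.
Proof.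
move=> x0; have [i xi] := pnorm_attained x0.
have xi0 : x ord0 i != 0 by rewrite -(pabs_eq0 R) -xi gt_eqF// pnorm_gt0.
pose c := (p%:R : Qp pp)^-1 / x ord0 i.
exists (c *: delta_mx ord0 i); split.
  rewrite /pdot (bigD1 i)//= big1 ?addr0.
    by rewrite !mxE !eqxx mulr1 /c mulrC divfK.
  by move=> j ji; rewrite !mxE (negbTE ji) andbF !mulr0.
have c_abs : pabs R c = p%:R / pn x.
  have p0 : (p%:R : Qp pp) != 0.
    by rewrite -(pabs_eq0 R) pabs_p invr_eq0 gt_eqF// pR_gt0.
  have -> : c = (p%:R : Qp pp) ^ (-1 : int) / x ord0 i by [].
  apply: (mulIf (_ : pn x != 0)); first by rewrite pnorm_eq0.
  rewrite divfK ?pnorm_eq0//.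
  by rewrite {1}xi -pabsM divfK// pabs_pX opprK.
rewrite pnormZ c_abs -[RHS]mulr1; congr (_ * _).
apply/eqP; rewrite eq_le; apply/andP; split.
  apply: pnorm_le => // j; rewrite mxE; case: (_ && _) => /=.
    by have := pabs_pX 0; rewrite expr0z oppr0 expr0z => ->.
  by rewrite pabs0.
have := pabs_le_pnorm (delta_mx ord0 i : V) i; rewrite mxE !eqxx /=.
by have := pabs_pX 0; rewrite expr0z oppr0 expr0z => ->.
Qed.

End ultrametric.

(** * Borel sets and Haar measure *)

Section borel.
Variables (R : realType) (p : nat) (pp : prime p) (n : nat).
Local Notation V := 'Qp[pp]_n.
Local Notation pn := (pnorm R).
Implicit Types x y z : V.

Lemma nbhs_pnormP x (A : set V) :
  nbhs x A <-> exists2 e : R, 0 < e & forall y, pn y < e -> A (x + y).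
Proof.
split=> [[P Px PA]|[e e0 eA]].
  have /choice[e eP] : forall i, exists e : R, 0 < e /\
      forall r, pabs R (r - x ord0 i) < e -> P ord0 i r.
    move=> i; have [e e0 eP] := (nbhs_QpE R _ _).1 (Px ord0 i).
    by exists e; split => // r re; apply: eP.
  exists (\big[Num.min/1]_i e i).
    by elim/big_ind: _ => // [a b a0 b0|i _]; [rewrite lt_min a0|case: (eP i)].
  move=> y ye; apply: PA => i j; rewrite (ord1 i); have [_] := eP j; apply.
  rewrite mxE addrAC subrr add0r (le_lt_trans (pabs_le_pnorm _ _ _))// (lt_le_trans ye)//.
  by rewrite (bigD1 j)//= ge_min lexx.
exists (fun i j => [set r | pabs R (r - x ord0 j) < e]).
  move=> i j; rewrite (ord1 i); apply/(nbhs_QpE R); exists e => //.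
move=> y xy; rewrite -(subrK x y) addrC; apply: eA.
have [->|yx0] := eqVneq (y - x) 0; first by rewrite pnorm0.
have [i ->] := pnorm_attained R yx0.
by rewrite !mxE; exact: xy.
Qed.

Lemma open_pnorm (A : set V) :
  (forall x, A x -> exists2 e : R, 0 < e & forall y, pn y < e -> A (x + y)) ->
  open A.
Proof. by move=> H; rewrite openE => x /H; exact: (nbhs_pnormP x A).2. Qed.

Lemma measurable_open (A : set V) : open A -> measurable (A : set (borelQpn pp n)).
Proof. exact: sub_sigma_algebra. Qed.

(** A set that is open off the origin is Borel, since the origin is closed. *)
Lemma measurable_open_off0 (A : set V) :
  (forall x, x != 0 -> A x -> exists2 e : R, 0 < e & forall y, pn y < e -> A (x + y)) ->
  measurable (A : set (borelQpn pp n)).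
Proof.
move=> H.
have off0 (B : set V) : (forall x, x != 0 -> B x ->
      exists2 e : R, 0 < e & forall y, pn y < e -> B (x + y)) ->
    measurable ((fun x => B x /\ x != 0) : set (borelQpn pp n)).
  move=> HB; apply: measurable_open; apply: open_pnorm => x [Bx x0].
  have [e e0 eB] := HB x x0 Bx; exists (Num.min e (pn x)).
    by rewrite lt_min e0 pnorm_gt0.
  move=> y; rewrite lt_min => /andP[ye yx]; split; first exact: eB.
  by rewrite -(pnorm_gt0 R) pnormD_eq// pnorm_gt0.
have m0 : measurable ([set 0] : set (borelQpn pp n)).
  rewrite -[X in measurable X]setCK; apply: measurableC.
  have -> : ~` [set 0] = (fun x : V => setT x /\ x != 0).
    by apply/seteqP; split=> x /=; [move=> /eqP|case=> _ /eqP].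
  by apply: off0 => x _ _; exists 1.
have [A0|nA0] := pselect (A 0).
  have -> : A = (fun x => A x /\ x != 0) `|` [set 0].
    apply/seteqP; split=> x /=; last by case=> [[]//|->].
    by move=> Ax; have [->|x0] := eqVneq x 0; [right|left].
  by apply: measurableU => //; exact: off0.
have -> : A = (fun x => A x /\ x != 0); last exact: off0.
apply/seteqP; split=> x /=; last by case.
by move=> Ax; split=> //; apply: contra_notN nA0 => /eqP <-.
Qed.

(** Radial functions, weights, characters and symbols are of this kind, and it makes
    them Borel whatever they do near the origin. *)
Definition locally_constant_off0 (T : Type) (f : V -> T) :=
  forall x, x != 0 -> exists2 e : R, 0 < e & forall y, pn y < e -> f (x + y) = f x.

Lemma measurable_locally_constant d (T : measurableType d) (f : V -> T) :
  locally_constant_off0 f ->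
  measurable_fun [set: borelQpn pp n] (f : borelQpn pp n -> T).
Proof.
move=> Hf _ B _; rewrite setTI; apply: measurable_open_off0 => x x0 /= Bx.
by have [e e0 ef] := Hf x x0; exists e => // y /ef ->.
Qed.

Lemma locally_constant_radial (T : Type) (F : R -> T) :
  locally_constant_off0 (fun x => F (pn x)).
Proof.
move=> x x0; exists (pn x); first by rewrite pnorm_gt0.
by move=> y yx; rewrite pnormD_eq.
Qed.

Lemma locally_constant_comp2 (S T U : Type) (G : S -> T -> U) (f : V -> S) (g : V -> T) :
  locally_constant_off0 f -> locally_constant_off0 g ->
  locally_constant_off0 (fun x => G (f x) (g x)).
Proof.
move=> Hf Hg x x0; have [e e0 ef] := Hf x x0; have [e' e'0 eg] := Hg x x0.
exists (Num.min e e'); first by rewrite lt_min e0.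
by move=> y; rewrite lt_min => /andP[/ef -> /eg ->].
Qed.

Lemma measurable_translation (h : V) :
  measurable_fun [set: borelQpn pp n] ((fun x => x + h) : borelQpn pp n -> borelQpn pp n).
Proof.
apply: (@measurability _ _ (borelQpn pp n) (borelQpn pp n) _ _ (@open V)) => //.
move=> _ [A /= oA <-]; rewrite setTI; apply: measurable_open; apply: open_pnorm => x Axh.
move: oA; rewrite openE => /(_ _ Axh)/(nbhs_pnormP (x + h))[e e0 eA].
by exists e => // y /eA; rewrite addrAC.
Qed.

End borel.

Section haar.
Variables (R : realType) (p : nat) (pp : prime p) (n : nat).
Local Notation V := 'Qp[pp]_n.
Local Notation pn := (pnorm R).
Implicit Types x y z : V.
Variables (mu : {measure set borelQpn pp n -> \bar R}) (muP : is_haar mu).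

Lemma haar_translation (h : V) (A : set V) : measurable (A : set (borelQpn pp n)) ->
  mu ((fun x => x + h) @^-1` A) = mu A.
Proof.
move=> mA; rewrite -(muP.1 (- h) A mA); congr (mu _).
apply/seteqP; split=> [x /= Ax|_ [y Ay <-]] /=; last by rewrite addrC addrA subrr add0r.
by exists (x + h) => //; rewrite addrC addrK.
Qed.

Lemma cintegral_shift (F : V -> R[i]) (h : V) :
  cintegral mu setT (fun x : V => F (x + h)) = cintegral mu setT F.
Proof.
apply: (@cintegral_subst _ (borelQpn pp n) _ mu (fun x : V => x + h) (fun x : V => x - h)).
- exact: (measurable_translation R).
- exact: (measurable_translation R).
- by move=> x; rewrite addrK.
- by move=> x; rewrite subrK.
- exact: haar_translation.
Qed.

Lemma int_le_shift (f : V -> R) (h : V) c :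
  int_le mu setT f c -> int_le mu setT (fun x : V => f (x + h)) c.
Proof.
move=> [mf f0 fc]; have mt := measurable_translation R h.
split; [|by move=> x _; exact: f0|].
  exact: (measurableT_comp mf mt).
apply: le_trans fc.
apply: (@lower_integral_subst_le _ (borelQpn pp n) _ mu (fun x : V => x + h)
  (fun x : V => x - h) (fun x => (f x)%:E)) => //.
- exact: (measurable_translation R).
- by move=> x; rewrite addrK.
- by move=> x; rewrite subrK.
- exact: haar_translation.
- by move=> x; rewrite lee_fin f0.
Qed.

Local Notation "x %:F" := (@FracField.tofrac (Defs.Zp pp) x).

Definition pball (r : R) : set V := [set x | pn x <= r].

Lemma measurable_pball r : measurable (pball r : set (borelQpn pp n)).
Proof.
apply: (@measurable_open_off0 R) => x x0 xr; exists (pn x); first by rewrite pnorm_gt0.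
by move=> y yx; rewrite /pball/= pnormD_eq.
Qed.

Lemma pabs_nat_leVp (m m' : nat) :
  (pabs R ((m%:R : Qp pp) - m'%:R) <= p%:R^-1) = (m %% p == m' %% p)%N.
Proof.
have [p0 vp] := zval_pX pp 1.
have pE : ((p%:R : Qp pp)) = ((p%:R : Defs.Zp pp) ^+ 1)%:F.
  by rewrite expr1 rmorph_nat.
have -> : (pabs R ((m%:R : Qp pp) - m'%:R) <= p%:R^-1) =
    (pabs R (((m%:R : Qp pp) - m'%:R) / (p%:R : Qp pp)) <= 1).
  have pinv : pabs R ((p%:R : Qp pp)^-1) = p%:R.
    by have := pabs_pX R pp (-1); rewrite opprK.
  by rewrite pabsM pinv -ler_pdivlMr ?mul1r// (pR_gt0 R pp).
have -> : (m%:R : Qp pp) - m'%:R = ((m%:R - m'%:R) : Defs.Zp pp)%:F.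
  by rewrite tofracB !rmorph_nat.
rewrite pE pabs_le1 ?expr1//; rewrite expr1 in vp; rewrite vp.
by rewrite zres_sub !zres_nat expn1.
Qed.

(** Up to a p-adic integer, [q / p] is a fraction [m / p ^ k] with [m < p ^ k]; as
    [|q| <= 1], the number [p ^ (k - 1)] divides [m] if [k > 0], and the quotient is the
    digit; if [k = 0] then [m = 0]. *)
Lemma pabs_digit (q : Qp pp) : pabs R q <= 1 ->
  exists d : 'I_p, pabs R (q - (d : nat)%:R) <= p%:R^-1.
Proof.
move=> q1; have p0 := pR_gt0 R pp.
have pQ0 : (p%:R : Qp pp) != 0.
  by rewrite -(pabs_eq0 R) pabs_p invr_eq0 gt_eqF.
have [r [k [m [mk _ qm]]]] := pfrac_ex R (q / p%:R).
have qm' : pabs R (q - p%:R * (m%:R / p%:R ^+ k)) <= p%:R^-1.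
  have -> : q - p%:R * (m%:R / p%:R ^+ k) = p%:R * (q / p%:R - m%:R / p%:R ^+ k).
    by rewrite mulrBr [_ * (q / _)]mulrC divfK.
  by rewrite pabsM pabs_p -[leRHS]mulr1 ler_wpM2l// invr_ge0 ltW.
have pk1 : pabs R ((p%:R * (m%:R / p%:R ^+ k)) : Qp pp) <= 1.
  have -> : p%:R * (m%:R / p%:R ^+ k) =
      q + - (q - p%:R * (m%:R / p%:R ^+ k)) :> Qp pp by rewrite opprB addrC subrK.
  rewrite (le_trans (pabsD _ _ _))// ge_max q1 pabsN (le_trans qm')//.
  by rewrite invf_le1// ltW// (pgt1 pp).
case: k mk qm qm' pk1 => [|k] mk _ qm' pk1.
  have m0 : m = 0%N by move: mk; rewrite expn0; case: m {qm' pk1}.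
  by exists (Ordinal (prime_gt0 pp)); move: qm'; rewrite m0 mul0r mulr0.
have E : (p%:R * (m%:R / p%:R ^+ k.+1) : Qp pp) =
    (m%:R : Defs.Zp pp)%:F / (p%:R ^+ k : Defs.Zp pp)%:F.
  rewrite tofracXn !rmorph_nat exprS invfM mulrCA; congr (_ * _).
  by rewrite mulrA divff// mul1r.
have [pz0 vk] := zval_pX pp k.
have dvd : (p ^ k %| m)%N.
  by move: pk1; rewrite E pabs_le1 ?expf_neq0// vk zres_nat.
have mE := divnK dvd.
have dp : (m %/ p ^ k < p)%N.
  by rewrite ltn_divLR ?expn_gt0 ?prime_gt0// -expnS.
exists (Ordinal dp) => /=; move: qm'; rewrite E.
suff -> : (m%:R : Defs.Zp pp)%:F / (p%:R ^+ k : Defs.Zp pp)%:F =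
    (m %/ p ^ k)%:R :> Qp pp by [].
rewrite -{1}mE natrM tofracM natrX mulfK ?tofrac_eq0 ?expf_neq0//.
by rewrite rmorph_nat.
Qed.

End haar.

Section haar_volume.
Variables (R : realType) (p : nat) (pp : prime p) (n : nat).
Local Notation V := 'Qp[pp]_n.
Local Notation pn := (pnorm R).
Implicit Types x y z : V.
Variables (mu : {measure set borelQpn pp n -> \bar R}) (muP : is_haar mu).
Local Notation pball := (@pball R p pp n).

(** The ball of radius [p^(k+1)] is the disjoint union of the [p^n] translates of
    the ball of radius [p^k] given by the possible leading digits. *)
Lemma haar_ballS (k : int) :
  mu (pball (p%:R ^ (k + 1))) = ((p%:R ^+ n)%:E * mu (pball (p%:R ^ k)))%E.
Proof.
have pR0 := pR_gt0 R pp; have pR0' : p%:R != 0 :> R by rewrite gt_eqF.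
pose q : Qp pp := p%:R ^ (- (k + 1)).
have aq : pabs R q = p%:R ^ (k + 1) by rewrite pabs_pX opprK.
have q0 : q != 0 by rewrite -(pabs_eq0 R) aq gt_eqF// pXR_gt0.
have aqV : pabs R q^-1 = p%:R ^ (- (k + 1)).
  by rewrite /q invr_expz pabs_pX; congr (_ ^ _); rewrite ?opprK.
have pk : p%:R ^ (k + 1) / p%:R = p%:R ^ k :> R.
  by rewrite expfzDr// expr1z mulfK.
pose c (d : {ffun 'I_n -> 'I_p}) : V := \row_i (q * (d i : nat)%:R).
pose F d : set (borelQpn pp n) := (fun x : V => x + c d) @^-1` pball (p%:R ^ k).
have mF d : measurable (F d).
  rewrite /F -[_ @^-1` _]setTI; apply: (measurable_translation R) => //.
  exact: measurable_pball.
have FP d (x : V) : F d x <-> forall i, pabs R (x ord0 i / q + (d i : nat)%:R) <= p%:R^-1.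
  have H i : (pabs R ((x + c d) ord0 i) <= p%:R ^ k) =
      (pabs R (x ord0 i / q + (d i : nat)%:R) <= p%:R^-1).
    rewrite !mxE -[in LHS](divfK q0 (x ord0 i)) mulrC -mulrDr pabsM aq -pk.
    by rewrite ler_pM2l ?pXR_gt0.
  split=> [xF i|xF]; first by rewrite -H; apply: le_trans xF; exact: pabs_le_pnorm.
  by apply: pnorm_le => [|i]; rewrite ?H// ltW// pXR_gt0.
have cover : pball (p%:R ^ (k + 1)) = \bigcup_(d in [set: {ffun 'I_n -> 'I_p}]) F d.
  apply/seteqP; split=> [x xk|x [d _ /FP dx]]; last first.
    apply: pnorm_le => [|i]; first by rewrite ltW// pXR_gt0.
    have -> : x ord0 i = q * (x ord0 i / q + (d i : nat)%:R) - q * (d i : nat)%:R.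
      by rewrite mulrDr addrK mulrC divfK.
    have N (m : nat) : pabs R (m%:R : Qp pp) <= 1.
      have := pabs_leX R (m%:R : Qp pp) 0; rewrite oppr0 expr0z => ->.
      have := pabs_leX R (m%:R : Qp pp) 0; rewrite oppr0 expr0z => <-.
      rewrite (_ : (m%:R : Qp pp) = @FracField.tofrac (Defs.Zp pp) m%:R /
        @FracField.tofrac (Defs.Zp pp) 1); last by rewrite tofrac1 divr1 rmorph_nat.
      rewrite pabs_le1 ?oner_neq0//; have [_] := zval_pX pp 0; rewrite expr0 => ->.
      by rewrite -(zres_mod _ 0) modn1.
    rewrite (le_trans (pabsD _ _ _))// pabsN ge_max !pabsM aq.
    rewrite ger_pMr ?pXR_gt0// ger_pMr ?pXR_gt0// N andbT (le_trans (dx i))//.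
    by rewrite invf_le1// ltW// (pgt1 pp).
  have /choice[d dP] : forall i, exists d : 'I_p,
      pabs R (- (x ord0 i / q) - (d : nat)%:R) <= p%:R^-1.
    move=> i; apply: (@pabs_digit R p pp); rewrite pabsN pabsM aqV.
    rewrite -(@ler_pM2r _ (p%:R ^ (k + 1)))// ?pXR_gt0// -mulrA -expfzDr// addNr.
    by rewrite expr0z mulr1 mul1r (le_trans (pabs_le_pnorm _ _ _)).
  exists (finfun d) => //; apply/FP => i; rewrite ffunE -pabsN opprD.
  exact: dP.
have triv : trivIset setT F.
  apply/trivIsetP => d d' _ _; apply: contra_neqP => /eqP/set0P[x [/FP dx /FP dx']].
  apply/ffunP => i; apply: val_inj.
  have : pabs R (((d i : nat)%:R : Qp pp) - (d' i : nat)%:R) <= p%:R^-1.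
    have -> : ((d i : nat)%:R : Qp pp) - (d' i : nat)%:R =
      (x ord0 i / q + (d i : nat)%:R) - (x ord0 i / q + (d' i : nat)%:R).
      by rewrite opprD addrACA subrr add0r.
    by rewrite (le_trans (pabsD _ _ _))// pabsN ge_max dx dx'.
  by rewrite pabs_nat_leVp !modn_small// => /eqP.
rewrite cover measure_fin_bigcup; [|exact: finite_finset|exact: triv|by move=> d _; exact: mF].
have -> : [set: {ffun 'I_n -> 'I_p}] = [set` enum {ffun 'I_n -> 'I_p}].
  by apply/seteqP; split=> d //= _; rewrite mem_enum.
rewrite -fsbig_seq ?enum_uniq// big_enum /=.
rewrite (eq_bigr (fun=> mu (pball (p%:R ^ k)))); last first.
  by move=> d _; rewrite /F (haar_translation muP)//; exact: measurable_pball.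
rewrite big_const card_ffun !card_ord -natrX.
elim: (p ^ n)%N => [|m IH] /=; first by rewrite mul0e.
by rewrite IH -natr1 EFinD ge0_muleDl ?lee_fin ?mul1e// addeC.
Qed.

Lemma haar_ball (k : int) : mu (pball (p%:R ^ k)) = ((p%:R ^ k) ^+ n)%:E.
Proof.
have p0 : p%:R != 0 :> R by rewrite gt_eqF// (pR_gt0 R pp).
have pX0 m : p%:R ^ m != 0 :> R by rewrite gt_eqF// (pXR_gt0 R pp).
case: k => m; first last.
  rewrite NegzE; elim: m => [|m IH].
    have := haar_ballS (-1); rewrite addNr expr0z muP.2 => /(congr1 (fun u : \bar R => ((p%:R^-1) ^+ n)%:E * u)%E).
    rewrite mule1 muleA -EFinM -exprMn mulVf ?expr1n ?mul1e// => <-//.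
  have := haar_ballS (- (m.+2)%:Z); rewrite (_ : - _ + 1 = - (m.+1)%:Z); last lia.
  rewrite IH => /(congr1 (fun u : \bar R => ((p%:R^-1) ^+ n)%:E * u)%E).
  rewrite muleA -!EFinM -!exprMn mulVf ?expr1n ?mul1e// => <-.
  by congr (_%:E); congr (_ ^+ _); rewrite -exprN1 -expfzDr//; congr (_ ^ _); lia.
elim: m => [|m IH]; first by rewrite expr0z expr1n; exact: muP.2.
have -> : Posz m.+1 = m%:Z + 1 by lia.
rewrite haar_ballS IH -EFinM -exprMn; congr (_%:E); congr (_ ^+ _).
by rewrite addrC expfzDr// expr1z.
Qed.

Lemma pX_between (r : R) : 0 < r -> exists k : int, p%:R ^ k <= r < p%:R ^ (k + 1).
Proof.
move=> r0; have p1 := pgt1 pp R; have p0 := pR_gt0 R pp.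
have lp : 0 < ln (p%:R : R) by rewrite ln_gt0.
exists (Num.floor (ln r / ln p%:R)).
have E (m : int) : p%:R ^ m = expR (m%:~R * ln p%:R) :> R.
  by rewrite -powR_intmul ?ltW// /powR gt_eqF.
have := floor_itv (ln r / ln (p%:R : R)); rewrite !E.
have := lnK r0; move: (ln r) => L <-.
rewrite ler_expR ltr_expR -ler_pdivlMr// -ltr_pdivrMr//.
Qed.

(** The norm only takes the values [p ^ k], so a ball of radius [r] is a ball of
    radius [p ^ k <= r]. *)
Lemma haar_ball_le (r : R) : 0 < r -> (mu (pball r) <= (r ^+ n)%:E)%E.
Proof.
move=> r0; have [k /andP[kr rk]] := pX_between r0.
have -> : pball r = pball (p%:R ^ k).
  apply/seteqP; split=> x /=; last by move=> xk; exact: le_trans kr.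
  rewrite /pball/=; have [->|x0] := eqVneq x 0; first by rewrite pnorm0 => _; rewrite ltW// (pXR_gt0 R pp).
  have [m ->] := pnorm_pX R x0 => mr; have := le_lt_trans mr rk.
  by rewrite ltr_eXz2l ?(pgt1 pp)// ltzD1 ler_eXz2l ?(pgt1 pp).
by rewrite haar_ball lee_fin lerXn2r// nnegrE ltW// (pXR_gt0 R pp).
Qed.

End haar_volume.

(** * Integrals over dyadic layers *)

Section powers.
Variable R : realType.
Implicit Types x y a b : R.

Lemma powD x a b : 0 < x -> x `^ (a + b) = x `^ a * x `^ b.
Proof. by move=> x0; rewrite powRD// (gt_eqF x0) implybT. Qed.

Lemma ler_pow x y a : 0 <= a -> 0 <= x -> x <= y -> x `^ a <= y `^ a.
Proof. by move=> a0 x0 xy; rewrite ge0_ler_powR// nnegrE// (le_trans x0). Qed.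

Lemma ler_powN x y a : 0 <= a -> 0 < x -> x <= y -> y `^ (- a) <= x `^ (- a).
Proof.
move=> a0 x0 xy; rewrite !powRN lef_pV2 ?posrE ?powR_gt0//; last exact: lt_le_trans xy.
by rewrite ler_pow// ltW.
Qed.

Lemma powNK x a : 0 < x -> x `^ (- a) * x `^ a = 1.
Proof. by move=> x0; rewrite -powD// addNr powRr0. Qed.

End powers.

Section layers.
Context d (T : measurableType d) (R : realType).
Variable mu : {measure set T -> \bar R}.

(** Integrals of power-like functions are never computed: a function bounded by
    [c j] on a layer [E j] has integral at most [\sum_j c j * mu (E j)], and for
    dyadic layers this series is geometric. *)
Lemma int_le_layers (D : set T) (h : T -> R) (E : nat -> set T) (c m : nat -> R)
    (A q : R) :
  measurable D -> measurable_fun D h -> (forall x, D x -> 0 <= h x) ->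
  (forall j, measurable (E j)) -> (forall j, mu (E j) <= (m j)%:E)%E ->
  (forall j, 0 <= c j) -> 0 <= A -> 0 < q < 1 -> (forall j, c j * m j <= A * q ^+ j) ->
  (forall x, D x -> exists2 j, E j x & h x <= c j) ->
  int_le mu D h (A / (1 - q)).
Proof.
move=> mD mh h0 mE Em c0 A0 /andP[q0 q1] cm cover; split=> //.
pose f j (x : T) := (c j * \1_(E j) x)%:E.
have f0 j x : (0 <= f j x)%E by rewrite /f lee_fin mulr_ge0.
have mf j : measurable_fun setT (f j).
  by apply/measurable_EFinP; apply: measurable_funM => //; exact: measurable_indic.
apply: (@le_trans _ _ (\int[mu]_(x in setT) (\sum_(j <oo) f j x))%E).
  rewrite integral_mkcond; apply: lower_integral_mono => x _.
    by apply: erestrict_ge0 => y /h0; rewrite lee_fin.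
  rewrite /patch; case: ifPn => [|_]; last exact: nneseries_ge0.
  rewrite inE => /cover[j Ej hj]; apply: (@le_trans _ _ (f j x)).
    by rewrite /f lee_fin indicE mem_set// mulr1.
  rewrite (nneseries_split_cond (P := xpredT) 0 j.+1)// add0n.
  rewrite big_mkord big_ord_recr /= -addeA addeC -addeA leeDl//.
  by apply: adde_ge0; [apply: nneseries_ge0|apply: sume_ge0].
rewrite integral_nneseries//.
apply: lime_le.
  by apply: is_cvg_nneseries => j _ _; apply: integral_ge0.
apply: nearW => N.
apply: (@le_trans _ _ (\sum_(0 <= j < N) (A * q ^+ j)%:E)%E).
  apply: lee_sum => j _; rewrite /f; under eq_integral do rewrite EFinM.
  rewrite ge0_integralZl//; [|by apply/measurable_EFinP|by rewrite lee_fin].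
  rewrite integral_indic// setIT (@le_trans _ _ ((c j)%:E * (m j)%:E)%E)//.
    by rewrite lee_wpmul2l ?lee_fin.
  by rewrite -EFinM lee_fin.
rewrite sumEFin lee_fin.
have q1' : `|q| < 1 by rewrite ger0_norm// ltW.
exact: (geometric_le_lim N A0 q0 q1').
Qed.

End layers.

Section time_integrals.
Variable R : realType.
Implicit Types a b v : R.

Local Notation leb := (@lebesgue_measure R).

(** The sum of the geometric series that [int_le_layers] yields for the singularity
    [u ^ (v - 1)]. *)
Definition time_const v : R := 2 `^ (1 - v) / (1 - 2 `^ (- v)).

Lemma time_const_ge0 v : 0 < v -> 0 <= time_const v.
Proof.
move=> v0; rewrite divr_ge0 ?powR_ge0// subr_ge0 -[leRHS](powRr0 2).
by rewrite ler_powR ?ler1n// oppr_le0 ltW.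
Qed.

Lemma two_powN_lt1 v : 0 < v -> 0 < (2 : R) `^ (- v) < 1.
Proof.
move=> v0; rewrite powR_gt0//= powRN invf_lt1 ?powR_gt0//.
have {1}-> : 1 = (1 : R) `^ v by rewrite powR1.
by rewrite gt0_ltr_powR ?nnegrE// ltr1n.
Qed.

Lemma two_powN_exp v (j : nat) : ((2 : R) `^ (- v)) ^+ j = (2 ^- j) `^ v.
Proof.
rewrite -powR_mulrn ?powR_ge0// -powRrM -powR_invn// -powRrM; congr (_ `^ _); ring.
Qed.

Lemma dyadic_layer (s u : R) : 0 < u <= s ->
  exists j : nat, 2 ^- j.+1 * s < u <= 2 ^- j * s.
Proof.
move=> /andP[u0 us]; have s0 := lt_le_trans u0 us.
have ex : exists j : nat, 2 ^- j.+1 * s < u.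
  exists (Num.truncn (s / u)); rewrite mulrC ltr_pdivrMr ?exprn_gt0//.
  rewrite mulrC -ltr_pdivrMr//; apply: lt_trans (truncnS_gt _) _.
  by rewrite -natrX ltr_nat ltn_expl.
case: (ex_minnP ex) => j ju jmin; exists j; rewrite ju /=.
case: j ju jmin => [|j] ju jmin; first by rewrite expr0 invr1 mul1r.
by rewrite leNgt; apply/negP => /jmin; rewrite ltnn.
Qed.

(** Treats the singularities at both end points at once: [u t] stands for the distance
    from [t] to one of them, and [E j] for the times with [u t <= 2 ^ (- j) * (b - a)]. *)
Lemma int_le_time_aux a b v (u : R -> R) (E : nat -> set R) :
  0 < v -> a < b -> measurable_fun `]a, b[ u ->
  (forall t, t \in `]a, b[ -> 0 < u t <= b - a) ->
  (forall j, measurable (E j)) ->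
  (forall j, leb (E j) <= (2 ^- j * (b - a))%:E)%E ->
  (forall j t, t \in `]a, b[ -> u t <= 2 ^- j * (b - a) -> E j t) -> v <= 1 ->
  int_le leb `]a, b[ (fun t => u t `^ (v - 1)) (time_const v * (b - a) `^ v).
Proof.
move=> v0 ab mu u01 mE lE uE v1; have s0 : 0 < b - a by rewrite subr_gt0.
have -> : time_const v * (b - a) `^ v =
    2 `^ (1 - v) * (b - a) `^ v / (1 - 2 `^ (- v)) by rewrite /time_const; ring.
apply: (@int_le_layers _ _ _ leb `]a, b[ _ E
  (fun j => (2 ^- j.+1 * (b - a)) `^ (v - 1)) (fun j => 2 ^- j * (b - a))) => //.
- exact: (measurableT_comp (measurable_powR _)).
- by move=> t _; exact: powR_ge0.
- by move=> j; exact: powR_ge0.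
- by rewrite mulr_ge0 ?powR_ge0.
- exact: two_powN_lt1.
- move=> j; rewrite two_powN_exp exprS invfM.
  have : 0 < 2 ^- j :> R by rewrite invr_gt0 exprn_gt0.
  move: (2 ^- j) => z z0; have zs : 0 < z * (b - a) by rewrite mulr_gt0.
  have half : (2^-1 : R) `^ (v - 1) = 2 `^ (1 - v).
    by rewrite -powR_inv1// -powRrM mulN1r opprB.
  rewrite -[_ * z * _]mulrA powRM ?invr_ge0// ?(ltW zs)// half -!mulrA ler_wpM2l ?powR_ge0//.
  by rewrite [leLHS]mulrC mulr_powRB1 ?(ltW zs)// powRM ?(ltW z0) ?(ltW s0)// mulrC lexx.
- move=> t tab; have [j /andP[uj ju]] := dyadic_layer (u01 t tab).
  exists j; first exact: uE.
  rewrite -(opprB 1 v); apply: ler_powN; rewrite ?subr_ge0//; last exact: ltW.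
  by rewrite mulr_gt0 ?invr_gt0 ?exprn_gt0.
Qed.

Lemma int_le_time_left a b v : 0 < v <= 1 -> a < b ->
  int_le leb `]a, b[ (fun t => (t - a) `^ (v - 1)) (time_const v * (b - a) `^ v).
Proof.
move=> /andP[v0 v1] ab.
apply: (@int_le_time_aux a b v (fun t => t - a) (fun j => `[a, a + 2 ^- j * (b - a)]%classic)) => //.
- exact: measurable_funB.
- by move=> t /[!in_itv]/= /andP[ta tb]; rewrite subr_gt0 ta lerB// ltW.
- move=> j; rewrite lebesgue_measure_itv /= lte_fin ltrDl mulr_gt0 ?subr_gt0 ?invr_gt0 ?exprn_gt0//.
  by rewrite -EFinD lee_fin addrC addKr.
- by move=> j t /[!in_itv]/= /andP[ta tb] H; rewrite /= in_itv/= (ltW ta)/= -lerBlDl.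
Qed.

Lemma int_le_time_right a b v : 0 < v <= 1 -> a < b ->
  int_le leb `]a, b[ (fun t => (b - t) `^ (v - 1)) (time_const v * (b - a) `^ v).
Proof.
move=> /andP[v0 v1] ab.
apply: (@int_le_time_aux a b v (fun t => b - t) (fun j => `[b - 2 ^- j * (b - a), b]%classic)) => //.
- exact: measurable_funB.
- by move=> t /[!in_itv]/= /andP[ta tb]; rewrite subr_gt0 tb lerB// ltW.
- move=> j; rewrite lebesgue_measure_itv /= lte_fin gtrBl mulr_gt0 ?subr_gt0 ?invr_gt0 ?exprn_gt0//.
  by rewrite -EFinD lee_fin opprB addrC subrK.
- by move=> j t /[!in_itv]/= /andP[ta tb] H; rewrite /= in_itv/= (ltW tb) andbT lerBlDl -lerBlDr.
Qed.

End time_integrals.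

(** * Profiles *)

Section profile.
Variables (R : realType) (p : nat) (pp : prime p) (n : nat).
Local Notation V := 'Qp[pp]_n.
Local Notation pn := (pnorm R).
Implicit Types (x y z : V) (g r rho : R).

(** The profile of a heat kernel: mass of order one on the ball of radius [rho],
    and decay of order [g] outside it. *)
Definition profile g rho r : R := rho `^ (g - n%:R) * Num.max rho r `^ (- g).

Lemma profileE g rho r :
  profile g rho r = rho `^ (g - n%:R) * Num.max rho r `^ (- g).
Proof. by []. Qed.

Lemma profile_ge0 g rho r : 0 <= profile g rho r.
Proof. by rewrite mulr_ge0 ?powR_ge0. Qed.

Lemma max_gt0 rho r : 0 < rho -> 0 < Num.max rho r.
Proof. by move=> r0; rewrite lt_max r0. Qed.

Lemma profile_near g rho r : 0 < rho -> r <= rho -> profile g rho r = rho `^ (- n%:R).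
Proof.
by move=> rho0 rr; rewrite /profile max_l// -powD//; congr (_ `^ _); ring.
Qed.

Lemma profile_far g rho r : rho <= r ->
  profile g rho r = rho `^ (g - n%:R) * r `^ (- g).
Proof. by move=> rr; rewrite /profile max_r. Qed.

Lemma profile_decr g rho r r' : 0 <= g -> 0 < rho -> r <= r' ->
  profile g rho r' <= profile g rho r.
Proof.
move=> g0 rho0 rr; rewrite ler_wpM2l ?powR_ge0// ler_powN ?max_gt0//.
by rewrite ge_max !le_max lexx rr orbT.
Qed.

Lemma profile_le_sup g rho r : 0 <= g -> 0 < rho -> profile g rho r <= rho `^ (- n%:R).
Proof.
move=> g0 rho0; have [rr|/ltW rr] := leP r rho; first by rewrite (profile_near g).
by rewrite -(profile_near g rho0 (lexx _)) profile_decr.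
Qed.

Lemma profile_le_exp g g' rho r : 0 < rho -> g <= g' ->
  profile g' rho r <= profile g rho r.
Proof.
move=> rho0 gg; have m0 := max_gt0 r rho0.
rewrite /profile (_ : g' - _ = (g - n%:R) + (g' - g)); last ring.
rewrite (_ : - g' = - (g' - g) + - g); last ring.
rewrite (powD _ (g' - g) rho0) (powD _ (- g) m0).
rewrite -mulrA ler_wpM2l ?powR_ge0// mulrA ler_piMl ?powR_ge0//.
rewrite powRN mulrC ler_pdivrMl ?powR_gt0// mulr1 ler_pow ?subr_ge0 ?(ltW rho0)//.
by rewrite le_max lexx.
Qed.

(** Serves to replace the scale of a frozen kernel by that of time, and the larger of
    two scales by the scale of the sum of the times. *)
Lemma profile_scale g rho rho' (c : R) r : 0 <= g - n%:R -> 0 < rho -> 1 <= c ->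
  rho <= c * rho' -> rho' <= c * rho -> profile g rho r <= c `^ (g - n%:R + g) * profile g rho' r.
Proof.
move=> gn rho0 c1 rc rc'; have c0 := lt_le_trans ltr01 c1.
have g0 : 0 <= g by rewrite (le_trans gn)// gerBl.
have rho'0 : 0 < rho' by rewrite -(pmulr_rgt0 _ c0) (lt_le_trans rho0).
rewrite /profile (powD _ g c0) mulrACA.
have cn : c `^ (g - n%:R) * rho' `^ (g - n%:R) = (c * rho') `^ (g - n%:R).
  by rewrite powRM ?(ltW c0) ?(ltW rho'0).
rewrite cn; apply: ler_pM; rewrite ?powR_ge0//; first by rewrite ler_pow// ltW.
have m0 := max_gt0 r rho0; have m'0 := max_gt0 r rho'0.
have -> : c `^ g * Num.max rho' r `^ (- g) = (c^-1 * Num.max rho' r) `^ (- g).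
  rewrite powRM ?invr_ge0 ?(ltW c0) ?(ltW m'0)//; congr (_ * _).
  by rewrite -powR_inv1 ?(ltW c0)// -powRrM mulrN mulN1r opprK.
apply: ler_powN => //; first by rewrite mulr_gt0 ?invr_gt0.
rewrite ler_pdivrMl// ge_max; apply/andP; split.
  by rewrite (le_trans rc')// ler_wpM2l ?(ltW c0)// le_max lexx.
have [r0|r0] := leP 0 r; last by rewrite (le_trans (ltW r0))// mulr_ge0 ?(ltW c0) ?(ltW m0).
apply: (@le_trans _ _ (1 * r)); first by rewrite mul1r.
by rewrite ler_pM// le_max lexx orbT.
Qed.

(** If [|x| <= max |x - y| |y|] then one of the two factors below may be
    evaluated at [|x|] and at the larger scale; this replaces the semigroup
    property in all convolution estimates. *)
Lemma profile_mul g rho1 rho2 r r1 r2 : n%:R <= g -> 0 < rho1 -> 0 < rho2 ->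
  r <= Num.max r1 r2 ->
  profile g rho1 r1 * profile g rho2 r2 <=
  profile g (Num.max rho1 rho2) r * (profile g rho1 r1 + profile g rho2 r2).
Proof.
move=> ng; have g0 : 0 <= g by apply: le_trans ng.
wlog le12 : rho1 rho2 r1 r2 / rho1 <= rho2.
  move=> H r10 r20 rr; have /orP[le12|le21] := le_total rho1 rho2; first exact: H.
  rewrite mulrC (maxC rho1) [profile g rho1 _ + _]addrC.
  by apply: (H rho2 rho1 r2 r1 le21 r20 r10); rewrite maxC.
move=> r10 r20 rr; rewrite max_r// mulrDr.
have P := profile_ge0.
have C2 : profile g rho2 r2 <= profile g rho2 r ->
    profile g rho1 r1 * profile g rho2 r2 <=
    profile g rho2 r * profile g rho1 r1 + profile g rho2 r * profile g rho2 r2.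
  move=> h; rewrite (@le_trans _ _ (profile g rho2 r * profile g rho1 r1))//.
    by rewrite mulrC ler_wpM2r.
  by rewrite lerDl mulr_ge0.
have [rle|rgt] := leP r rho2.
  by apply: C2; rewrite [leRHS]profile_near// profile_le_sup.
have [rr2|rr2] := leP r r2; first by apply: C2; exact: profile_decr.
have rr1 : r <= r1 by move: rr; rewrite le_max => /orP[//|]; rewrite leNgt rr2.
rewrite (@le_trans _ _ (profile g rho2 r * profile g rho2 r2))//; last first.
  by rewrite lerDr mulr_ge0.
rewrite ler_wpM2r// (le_trans (profile_decr g0 r10 rr1))//.
rewrite !profile_far ?(ltW rgt)//; last exact: le_trans (ltW rgt).
by rewrite ler_wpM2r ?powR_ge0// ler_pow ?subr_ge0// ltW.
Qed.

(** A weight of order [lam] is absorbed by giving up [lam] in the exponent. *)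
Lemma profile_weight g rho r (lam : R) : 0 < rho -> 0 <= r -> 0 <= lam ->
  profile g rho r * r `^ lam <= rho `^ lam * profile (g - lam) rho r.
Proof.
move=> rho0 r0 l0; have m0 := max_gt0 r rho0.
rewrite /profile [leRHS]mulrA -powD// (_ : lam + _ = g - n%:R); last ring.
rewrite -mulrA ler_wpM2l ?powR_ge0// opprB addrC powD// ler_wpM2l ?powR_ge0//.
by rewrite ler_pow// le_max lexx orbT.
Qed.

Variables (mu : {measure set borelQpn pp n -> \bar R}) (muP : is_haar mu).

(** The sum of the geometric series of ratio [2 ^ (- (g - n))]: passing from one dyadic
    ball to the next multiplies the volume by [2 ^ n] and the profile by [2 ^ (- g)]. *)
Definition profile_const g : R := 2 `^ g / (1 - 2 `^ (- (g - n%:R))).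

Lemma int_le_profile g rho : n%:R < g -> 0 < rho ->
  int_le mu setT (fun x : V => profile g rho (pn x)) (profile_const g).
Proof.
move=> ng rho0; have gn0 : 0 < g - n%:R by rewrite subr_gt0.
have g0 : 0 <= g by apply: le_trans (ltW ng).
have two_g : 1 <= (2 : R) `^ g by rewrite -[leLHS](powRr0 2) ler_powR// ler1n.
pose E j : set (borelQpn pp n) := [set x : V | pn x <= 2 ^+ j * rho].
have two0 j : 0 < 2 ^+ j * rho by rewrite mulr_gt0 ?exprn_gt0.
apply: (@int_le_layers _ _ _ mu setT _ E
  (fun j => 2 `^ g * (rho `^ (- n%:R) * (2 ^- j) `^ g))
  (fun j => (2 ^+ j * rho) ^+ n)) => //.
- exact: measurable_locally_constant (locally_constant_radial (profile g rho)).
- by move=> x _; exact: profile_ge0.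
- by move=> j; exact: (@measurable_pball R).
- by move=> j; exact: (haar_ball_le muP (two0 j)).
- by move=> j; rewrite !mulr_ge0 ?powR_ge0.
- exact: two_powN_lt1.
- move=> j; rewrite two_powN_exp -powR_mulrn; last exact: ltW.
  have z0 : 0 < 2 ^- j :> R by rewrite invr_gt0 exprn_gt0.
  have -> : 2 ^+ j * rho = (2 ^- j)^-1 * rho by rewrite invrK.
  move: (2 ^- j) z0 => z z0.
  rewrite (powRM _ _ (ltW rho0)); last by rewrite invr_ge0 ltW.
  rewrite -(powR_inv1 (ltW z0)) -powRrM mulN1r (powD _ _ z0).
  have /eqP := powNK n%:R rho0.
  move: (rho `^ (- n%:R)) (rho `^ n%:R) (z `^ (- n%:R)) (z `^ g) (2 `^ g).
  move=> C D B A F /eqP CD.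
  rewrite [leLHS](_ : _ = F * (A * B) * (C * D)); last ring.
  by rewrite CD mulr1.
- move=> x _; have ex : exists j : nat, pn x <= 2 ^+ j * rho.
    exists (Num.truncn (pn x / rho)).+1.
    rewrite -ler_pdivrMr// ltW// (lt_trans (truncnS_gt _))//.
    by rewrite -natrX ltr_nat ltn_expl.
  case: (ex_minnP ex) => j jx jmin; exists j => //.
  case: j jx jmin => [|j] jx jmin.
    rewrite expr0 invr1 powR1 mulr1 (le_trans (profile_le_sup _ g0 rho0))//.
    by rewrite ler_peMl ?powR_ge0.
  have jx' : 2 ^+ j * rho <= pn x.
    by rewrite leNgt; apply/negP => /ltW/jmin; rewrite ltnn.
  rewrite (le_trans (profile_decr g0 rho0 jx'))// profile_far; last first.
    by rewrite ler_peMl ?(ltW rho0)// exprn_ege1// ler1n.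
  rewrite powRM ?exprn_ge0 ?(ltW rho0)// mulrCA -powD// (_ : _ + - g = - n%:R); last ring.
  rewrite exprS invfM powRM ?invr_ge0 ?exprn_ge0//.
  rewrite [leLHS]mulrC [leRHS]mulrCA ler_wpM2l ?powR_ge0//.
  rewrite mulrA -powRM ?invr_ge0// divff// powR1 mul1r.
  by rewrite -[2 ^- j]powR_inv1 ?exprn_ge0// -powRrM mulN1r lexx.
Qed.

Lemma int_le_profile_shift g rho x : n%:R < g -> 0 < rho ->
  int_le mu setT (fun y : V => profile g rho (pn (x - y))) (profile_const g).
Proof.
move=> ng rho0.
rewrite (_ : (fun y : V => _) = (fun y : V => profile g rho (pn (y + - x)))).
  exact: (int_le_shift muP (- x) (int_le_profile ng rho0)).
by apply/funext => y; rewrite pnormB.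
Qed.

Lemma profile_const_ge0 g : n%:R < g -> 0 <= profile_const g.
Proof. by move=> ng; exact: int_le_ge0 (int_le_profile ng ltr01). Qed.

End profile.

(** * Characters *)

Section complex_exponential.
Variable R : realType.
Implicit Types (z w : R[i]) (b t : R).

Lemma sin_le_norm b : `|sin b| <= `|b|.
Proof.
wlog b0 : b / 0 <= b.
  move=> H; have [/H//|/ltW b0] := leP 0 b.
  by rewrite -normrN -sinN -(normrN b); apply: H; rewrite oppr_ge0.
have csin : {within `[0, b], continuous (@sin R)}.
  by apply: continuous_subspaceT => x; exact: continuous_sin.
have [c _] := MVT_segment b0 (fun x _ => is_derive_sin x) csin.
rewrite sin0 !subr0 => ->; rewrite normrM ler_piMl//; exact: cos_max.
Qed.

Lemma cos_le_norm b : `|cos b - 1| <= `|b|.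
Proof.
wlog b0 : b / 0 <= b.
  move=> H; have [/H//|/ltW b0] := leP 0 b.
  by rewrite -cosN -(normrN b); apply: H; rewrite oppr_ge0.
have ccos : {within `[0, b], continuous (@cos R)}.
  by apply: continuous_subspaceT => x; exact: continuous_cos.
have [c _] := MVT_segment b0 (fun x _ => is_derive_cos x) ccos.
by rewrite cos0 !subr0 => ->; rewrite normrM normrN ler_piMl// sin_max.
Qed.

Lemma nrm_cexp z : nrm (cexp z) = expR (complex.Re z).
Proof.
rewrite /cexp nrmMr ger0_norm ?expR_ge0//= cos2Dsin2 sqrtr1 mulr1//.
Qed.

(** For [z = a + i b], split [cexp z - 1] as [e^a (e^(i b) - 1) + (e^a - 1)]. *)
Lemma nrm_cexpB1 z : complex.Re z <= 0 -> nrm (cexp z - 1) <= 3 * nrm z.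
Proof.
case: z => a b; rewrite [complex.Re _]/= => a0; set z := a +i* b.
have -> : cexp z - 1 = (expR a)%:C * ((cos b - 1) +i* sin b) + (expR a - 1)%:C.
  by rewrite /cexp /=; apply/eqP; rewrite eq_complex /=; apply/andP; split; apply/eqP; ring.
have ea1 : expR a <= 1 by rewrite -expR0 ler_expR.
apply: le_trans (le_normcD _ _) _.
have A : `|a| <= nrm z := Re_le_nrm z.
have B : `|b| <= nrm z := Im_le_nrm z.
rewrite nrmMr nrm_real ger0_norm ?expR_ge0//.
have H0 : nrm ((cos b - 1) +i* sin b) <= 2 * `|b|.
  apply: le_trans (nrm_le_ReIm _) _ => /=.
  have := sin_le_norm b; have := cos_le_norm b; lra.
have H1 : expR a * nrm ((cos b - 1) +i* sin b) <= 2 * `|b|.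
  by apply: le_trans H0; rewrite ler_piMl// nrm_ge0.
have H2 : `|expR a - 1| <= `|a|.
  rewrite (ler0_norm a0) ler0_norm ?subr_le0//.
  have := expR_ge1Dx a; lra.
lra.
Qed.

End complex_exponential.

Section character.
Variables (R : realType) (p : nat) (pp : prime p).
Implicit Types x y : Qp pp.
Local Notation Psi := (Psi R).

Lemma pfracP y : is_pfrac y (pfrac R y).
Proof. by rewrite /pfrac; case: xgetP => [r ->//|/= H]; have [r /H] := pfrac_ex R y. Qed.

Lemma pfrac_int y : pabs R y <= 1 -> pfrac R y = 0.
Proof.
move=> y1; apply: (pfrac_uniq (pfracP y)); exists 0%N, 0%N; split.
- by rewrite expn0.
- by rewrite mul0r.
- by rewrite mul0r subr0.
Qed.

(** The sum of the two representatives is a fraction whose denominator is a power of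
    [p], and it is less than [2]; so at most one unit has to be removed. *)
Lemma pfracD x y :
  pfrac R (x + y) = pfrac R x + pfrac R y \/ pfrac R (x + y) = pfrac R x + pfrac R y - 1.
Proof.
have pQ0 : (p%:R : Qp pp) != 0 by rewrite -(pabs_eq0 R) pabs_p invr_eq0 gt_eqF ?(pR_gt0 R pp).
have pR0 : p%:R != 0 :> R by rewrite gt_eqF ?(pR_gt0 R pp).
have [k [m [mk -> xm]]] := pfracP x; have [l [q [ql -> yq]]] := pfracP y.
pose M := (m * p ^ l + q * p ^ k)%N.
have ME (F : fieldType) : p%:R != 0 :> F ->
    (M%:R / p%:R ^+ (k + l) = m%:R / p%:R ^+ k + q%:R / p%:R ^+ l :> F).
  move=> p0; rewrite /M natrD !natrM !natrX exprD.
  by field; rewrite !expf_neq0.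
have close : pabs R (x + y - M%:R / p%:R ^+ (k + l)) <= 1.
  rewrite (ME _ pQ0) opprD addrACA (le_trans (pabsD _ _ _))// ge_max xm//.
have M2 : (M < 2 * p ^ (k + l))%N.
  have h1 : (m * p ^ l < p ^ k * p ^ l)%N by rewrite ltn_pmul2r// expn_gt0 prime_gt0.
  have h2 : (q * p ^ k < p ^ k * p ^ l)%N.
    by rewrite [ltnRHS]mulnC ltn_pmul2r// expn_gt0 prime_gt0.
  by rewrite expnD /M mul2n -addnn; lia.
have [Mlt|Mge] := ltnP M (p ^ (k + l)).
  left; apply: (pfrac_uniq (pfracP _)); exists (k + l)%N, M; split=> //.
  by rewrite (ME _ pR0).
right; apply: (pfrac_uniq (pfracP _)); exists (k + l)%N, (M - p ^ (k + l))%N; split.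
- by rewrite ltn_subLR// addnn -mul2n.
- by rewrite natrB// natrX mulrBl (ME _ pR0) divff// expf_neq0.
- rewrite natrB// natrX mulrBl divff ?expf_neq0// opprB addrCA addrC.
  have one1 : pabs R (1 : Qp pp) <= 1.
    by have := pabs_pX R pp 0; rewrite oppr0 !expr0z => ->.
  by rewrite (le_trans (pabsD _ _ _))// ge_max close.
Qed.

Lemma PsiE y : Psi y = cos (2 * pi * pfrac R y) +i* sin (2 * pi * pfrac R y).
Proof. by rewrite /Defs.Psi /cexp /= expR0 mul1r. Qed.

Lemma nrm_Psi y : nrm (Psi y) = 1.
Proof. by rewrite /Defs.Psi nrm_cexp expR0. Qed.

Lemma PsiD x y : Psi (x + y) = Psi x * Psi y.
Proof.
have E : Psi x * Psi y = cos (2 * pi * (pfrac R x + pfrac R y)) +i*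
    sin (2 * pi * (pfrac R x + pfrac R y)).
  rewrite !PsiE [2 * pi * (_ + _)]mulrDr cosD sinD.
  move: (2 * pi * pfrac R x) (2 * pi * pfrac R y) => s t.
  move: (cos s) (sin s) (cos t) (sin t) => a b c e.
  by apply/eqP; rewrite eq_complex /=; apply/andP; split; apply/eqP; ring.
rewrite E PsiE; have [->//|->] := pfracD x y.
set r := pfrac R x + pfrac R y.
have -> : 2 * pi * r = 2 * pi * (r - 1) + pi *+ 2 by rewrite -mulr_natl; ring.
by rewrite cosD2pi sinD2pi.
Qed.

Lemma Psi_int y : pabs R y <= 1 -> Psi y = 1.
Proof. by move=> y1; rewrite PsiE pfrac_int// mulr0 cos0 sin0. Qed.

(** A primitive [p]-th root of unity. *)
Definition zeta_p : R[i] := Psi ((p%:R : Qp pp)^-1).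

Lemma nrm_zeta_p : nrm zeta_p = 1. Proof. exact: nrm_Psi. Qed.

Lemma Re_zeta_p : complex.Re zeta_p < 1.
Proof.
have p0 := pR_gt0 R pp.
have -> : complex.Re zeta_p = cos (2 * pi / p%:R).
  rewrite /zeta_p PsiE /=; congr (cos (_ * _)).
  apply: (pfrac_uniq (pfracP _)); exists 1%N, 1%N; split.
  - by rewrite expn1 prime_gt1.
  - by rewrite expr1 mul1r.
  - by rewrite expr1 mul1r subrr pabs0.
rewrite -[ltRHS]cos0 ltr_cos.
- by rewrite divr_gt0// mulr_gt0// pi_gt0.
- by rewrite in_itv/= lexx pi_ge0.
- rewrite in_itv/= divr_ge0 ?mulr_ge0 ?pi_ge0 ?(ltW p0)//= ler_pdivrMr// mulrC.
  by rewrite ler_wpM2l ?pi_ge0// ler_nat prime_gt1.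
Qed.

Lemma zeta_p_neq1 : zeta_p != 1.
Proof. by apply/eqP => z1; have := Re_zeta_p; rewrite z1 ltxx. Qed.

End character.

#[local] Opaque Psi pdot pnorm powR pabs zeta_p.

Lemma Re_divr (R : realType) (z : R[i]) (r : R) :
  complex.Re (z / r%:C) = complex.Re z / r.
Proof. by rewrite -fmorphV mulrC; case: z => a b /=; rewrite mul0r subr0 mulrC. Qed.

Section linearity.
Variables (R : realType) (p : nat) (pp : prime p) (n : nat).
Local Notation V := 'Qp[pp]_n.
Variables (mu : {measure set borelQpn pp n -> \bar R}).
Implicit Types F G : V -> R[i].

(** The integrands of the symbol and of the heat kernel, for which the cancellations
    below require exact linearity of the integral. *)
Definition lc_integrable F := locally_constant_off0 R F /\
  exists k c, int_le mu setT k c /\ forall x, nrm (F x) <= k x.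

Lemma lc_integrable_part (g : R[i] -> R) F : (forall z, `|g z| <= nrm z) ->
  lc_integrable F -> mu.-integrable setT (EFin \o (fun x : borelQpn pp n => g (F x))).
Proof.
move=> gz [lF [k [c [[mk k0 kc] Fk]]]].
have mF : measurable_fun [set: borelQpn pp n] (fun x : borelQpn pp n => g (F x)).
  apply: (@measurable_locally_constant R) => x /lF[e e0 eF].
  by exists e => // y /eF ->.
apply/integrableP; split; first exact/measurable_EFinP.
apply: (@le_lt_trans _ _ c%:E); last exact: ltry.
apply: le_trans kc; apply: lower_integral_mono => x _ //=.
by rewrite lee_fin (le_trans (gz _)).
Qed.

Lemma lc_integrableZ (z : R[i]) F : lc_integrable F -> lc_integrable (fun x => z * F x).
Proof.
move=> [lF [k [c [Hk Fk]]]]; split; first by move=> x /lF[e e0 eF]; exists e => // y /eF ->.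
exists (fun x => nrm z * k x), (nrm z * c); split.
  by apply: int_leZ => //; exact: nrm_ge0.
by move=> x; rewrite Normc.normcM ler_wpM2l ?nrm_ge0.
Qed.

Lemma lc_integrableB F G : lc_integrable F -> lc_integrable G ->
  lc_integrable (fun x => F x - G x).
Proof.
move=> [lF [k [c [Hk Fk]]]] [lG [k' [c' [Hk' Gk]]]]; split.
  exact: (locally_constant_comp2 (fun a b => a - b) lF lG).
exists (fun x => k x + k' x), (c + c'); split; first exact: int_leD.
by move=> x; rewrite (le_trans (le_normcD _ _))// nrmN lerD.
Qed.

Lemma cintegralB F G : lc_integrable F -> lc_integrable G ->
  cintegral mu setT (fun x => F x - G x) = cintegral mu setT F - cintegral mu setT G.
Proof.
move=> iF iG; rewrite /cintegral.
have -> : (\int[mu]_x complex.Re (F x - G x))%R =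
    \int[mu]_x complex.Re (F x) - \int[mu]_x complex.Re (G x).
  rewrite -(RintegralB measurableT (lc_integrable_part (@Re_le_nrm R) iF)
    (lc_integrable_part (@Re_le_nrm R) iG)).
  by apply: eq_Rintegral => x _; rewrite ReB.
have -> : (\int[mu]_x complex.Im (F x - G x))%R =
    \int[mu]_x complex.Im (F x) - \int[mu]_x complex.Im (G x).
  rewrite -(RintegralB measurableT (lc_integrable_part (@Im_le_nrm R) iF)
    (lc_integrable_part (@Im_le_nrm R) iG)).
  by apply: eq_Rintegral => x _; rewrite ImB.
by [].
Qed.

Lemma cintegralZ (z : R[i]) F : lc_integrable F ->
  cintegral mu setT (fun x => z * F x) = z * cintegral mu setT F.
Proof.
move=> iF; case: z => a b; rewrite /cintegral.
have iRe := lc_integrable_part (@Re_le_nrm R) iF.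
have iIm := lc_integrable_part (@Im_le_nrm R) iF.
have scaled (r : R) (f : borelQpn pp n -> R) : mu.-integrable setT (EFin \o f) ->
    mu.-integrable setT (EFin \o (fun x => r * f x)).
  by move=> /(integrableZl measurableT r); apply: eq_integrable => // x _ /=; rewrite EFinM.
have -> : (\int[mu]_x complex.Re ((a +i* b) * F x))%R =
    a * (\int[mu]_x complex.Re (F x)) - b * (\int[mu]_x complex.Im (F x)).
  rewrite -!RintegralZl// -RintegralB//; try exact: scaled.
  by apply: eq_Rintegral => x _; case: (F x).
have -> : (\int[mu]_x complex.Im ((a +i* b) * F x))%R =
    a * (\int[mu]_x complex.Im (F x)) + b * (\int[mu]_x complex.Re (F x)).
  rewrite -!RintegralZl// -RintegralD//; try exact: scaled.
  by apply: eq_Rintegral => x _; case: (F x).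
by apply/eqP; rewrite eq_complex /= !eqxx.
Qed.

Hypothesis muP : is_haar mu.

(** Orthogonality of characters: by invariance of the measure the integral is equal
    to [z] times itself. *)
Lemma cintegral_character (z : R[i]) (h : V) F : lc_integrable F -> z != 1 ->
  (forall x, F (x + h) = z * F x) -> cintegral mu setT F = 0.
Proof.
move=> iF z1 Fz; have := cintegral_shift muP F h.
under eq_cintegral do rewrite Fz.
rewrite cintegralZ// => /eqP; rewrite -subr_eq0 -{2}[cintegral _ _ _]mul1r -mulrBl.
by rewrite mulf_eq0 subr_eq0 (negbTE z1) /= => /eqP.
Qed.

End linearity.

(** * The symbol of the operator *)

Section symbol.
Variables (R : realType) (p : nat) (pp : prime p) (n : nat).
Local Notation V := 'Qp[pp]_n.
Local Notation pn := (pnorm R).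
Local Notation Psi := (@Psi R p pp).
Implicit Types x y xi : V.
Variables (mu : {measure set borelQpn pp n -> \bar R}) (muP : is_haar mu).

Lemma Psi_pdot_int x y : pn x * pn y <= 1 -> Psi (pdot x y) = 1.
Proof. by move=> h; apply: Psi_int; exact: le_trans (pdot_le _ _ _) h. Qed.

Lemma Psi_pdotD x y y' : pn x * pn y' <= 1 -> Psi (pdot x (y + y')) = Psi (pdot x y).
Proof. by move=> h; rewrite pdotDr PsiD (Psi_pdot_int h) mulr1. Qed.

Lemma PsiN_pdot_int x y : pn x * pn y <= 1 -> Psi (- pdot x y) = 1.
Proof. by move=> h; rewrite -pdotNl; apply: Psi_pdot_int; rewrite pnormN. Qed.

Lemma PsiN_pdotDl x x' y : Psi (- pdot (x + x') y) = Psi (- pdot x y) * Psi (- pdot x' y).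
Proof. by rewrite (pdotDl x x' y) opprD PsiD. Qed.

Lemma PsiN_pdotC x y : Psi (- pdot x y) = Psi (pdot (- y) x).
Proof. by rewrite pdotC pdotNl. Qed.

Lemma PsiD_pdot x x' y : Psi (pdot (x + x') y) = Psi (pdot x y) * Psi (pdot x' y).
Proof. by rewrite (pdotDl x x' y) PsiD. Qed.

Lemma locally_constant_Psi x : locally_constant_off0 R (fun y => Psi (pdot x y)).
Proof.
move=> y y0; exists ((1 + pn x)^-1).
  by rewrite invr_gt0 ltr_pwDl// pnorm_ge0.
move=> y' y'e; apply: Psi_pdotD; have x1 : 0 < 1 + pn x by rewrite ltr_pwDl// pnorm_ge0.
rewrite (@le_trans _ _ (pn x * (1 + pn x)^-1))//.
  by rewrite ler_wpM2l ?pnorm_ge0// ltW.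
by rewrite ler_pdivrMr// mul1r lerDr.
Qed.

(** The values of the norm are powers of [p]. *)
Lemma pnorm_lt_p x y : pn x < pn y -> p%:R * pn x <= pn y.
Proof.
have p0 := pR_gt0 R pp; have p1 := pgt1 pp R.
have [->|x0] := eqVneq x 0; first by rewrite pnorm0 mulr0 pnorm_ge0.
move=> xy; have y0 : y != 0 by rewrite -(pnorm_gt0 R) (le_lt_trans _ xy)// pnorm_ge0.
have [k xk] := pnorm_pX R x0; have [m ym] := pnorm_pX R y0.
move: xy; rewrite xk ym ltr_eXz2l// => km.
rewrite (_ : p%:R * p%:R ^ k = p%:R ^ (1 + k)) ?expfzDr ?expr1z// ?gt_eqF//.
by rewrite -[X in X * _]expr1z -expfzDr ?gt_eqF// ler_eXz2l//; lia.
Qed.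

(** The character [Psi (x . y)] cannot be distinguished, under the integral sign,
    from [Psi ((x + x') . y)] with [|x'| < |x|]. The integrand vanishes where
    [|x'| |y| <= 1]; elsewhere the translation by a vector [y0] of norm [p / |x|]
    with [x . y0 = 1 / p] multiplies it by a nontrivial root of unity. *)
Lemma cintegral_increment x x' (g : V -> R[i]) : pn x' < pn x ->
  (forall y y', pn y' < pn y -> g (y + y') = g y) ->
  lc_integrable mu (fun y => Psi (pdot x y) * (1 - Psi (pdot x' y)) * g y) ->
  cintegral mu setT (fun y => Psi (pdot x y) * (1 - Psi (pdot x' y)) * g y) = 0.
Proof.
move=> x'x gconst Hi; have x0 : x != 0.
  by rewrite -(pnorm_gt0 R); apply: le_lt_trans x'x; exact: pnorm_ge0.
have px : 0 < pn x by rewrite pnorm_gt0.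
have [y0 [xy0 py0]] := pdot_dual R x0.
have x'y0 : pn x' * pn y0 <= 1.
  by rewrite py0 mulrA (ler_pdivrMr _ _ px) mul1r mulrC; exact: pnorm_lt_p.
apply: (cintegral_character muP (z := zeta_p R pp) (h := y0)) => //.
  exact: zeta_p_neq1.
move=> y; have e2 : Psi (pdot x (y + y0)) = zeta_p R pp * Psi (pdot x y).
  by rewrite (pdotDr y y0 x) PsiD xy0 mulrC.
have e3 : Psi (pdot x' (y + y0)) = Psi (pdot x' y) by exact: Psi_pdotD.
rewrite e2 e3; have [x'y|x'y] := leP (pn x' * pn y) 1.
  rewrite (Psi_pdot_int x'y) subrr; move: (g _) (g _) (Psi _) (zeta_p _ _) => a b c d.
  by rewrite !mulr0 !mul0r mulr0.
have yy0 : pn y0 < pn y.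
  rewrite ltNge; apply/negP => h; move: x'y; rewrite ltNge => /negP; apply.
  exact: le_trans (ler_wpM2l (pnorm_ge0 R x') h) x'y0.
rewrite (gconst y y0 yy0); move: (g _) (Psi _) (Psi _) (zeta_p _ _) => a b c d.
by rewrite !mulrA.
Qed.

Variables (alpha : R) (w : V -> R) (wP : is_weight alpha w) (na : n%:R < alpha).

Lemma alpha_ge0 : 0 <= alpha. Proof. exact: le_trans (ltW na). Qed.

Lemma weight_radial x y : pn x = pn y -> w x = w y.
Proof. by case: wP => _ H _ _ _; exact: H. Qed.

Lemma weight_ge0 x : 0 <= w x. Proof. by case: wP => _ _ H _ _; exact: H. Qed.

Lemma locally_constant_weight : locally_constant_off0 R w.
Proof.
move=> x x0; exists (pn x); first by rewrite pnorm_gt0.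
by move=> y yx; apply: weight_radial; rewrite pnormD_eq.
Qed.

Lemma weight_lower : exists2 C0 : R, 0 < C0 &
  forall y, y != 0 -> (w y)^-1 <= C0^-1 * pn y `^ (- alpha).
Proof.
case: wP => _ _ _ _ [C0 [C1 [C00 C10 H]]]; exists C0 => // y y0.
have py : 0 < pn y by rewrite pnorm_gt0.
rewrite powRN -invfM lef_pV2 ?posrE ?mulr_gt0 ?powR_gt0//; first by case/andP: (H y).
by apply: lt_le_trans (proj1 (andP (H y))); rewrite mulr_gt0 ?powR_gt0.
Qed.

Lemma int_le_ext (h k : V -> R) c : h =1 k -> int_le mu setT h c -> int_le mu setT k c.
Proof. by move=> /funext ->. Qed.

(** A majorant of [1 / w], up to a constant, outside a ball. *)
Definition tail (rho : R) y : R := if rho <= pn y then pn y `^ (- alpha) else 0.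

Lemma int_le_tail rho : 0 < rho ->
  int_le mu setT (tail rho) (rho `^ (n%:R - alpha) * profile_const n alpha).
Proof.
move=> rho0; have H := int_leZ measurableT (powR_ge0 rho (n%:R - alpha))
  (int_le_profile muP na rho0).
apply: int_le_mono H.
  exact: (measurable_locally_constant (locally_constant_radial
    (fun r => if rho <= r then r `^ (- alpha) else 0))).
move=> y _; rewrite /tail; case: ifPn => ry; rewrite ?lexx ?powR_ge0 ?mulr_ge0 ?powR_ge0 ?profile_ge0//=.
rewrite profile_far// mulrA -powD// (_ : n%:R - alpha + (alpha - n%:R) = 0); last ring.
by rewrite powRr0 mul1r.
Qed.

Lemma int_ball_le (r : R) : 0 < r ->
  int_le mu setT (fun y : V => if pn y <= r then 1 else 0) (r `^ n%:R).
Proof.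
move=> r0; split.
- exact: (measurable_locally_constant (locally_constant_radial
    (fun s => if s <= r then 1 else 0 : R))).
- by move=> x _; case: ifP.
- rewrite (_ : (fun y : borelQpn pp n => _) = (fun y => (\1_(pball r : set (borelQpn pp n)) y)%:E)).
    rewrite integral_indic//; last exact: measurable_pball.
    by rewrite setIT (powR_mulrn _ (ltW r0)) (haar_ball_le muP r0).
  apply/funext => y; rewrite indicE /pball; congr (_%:E).
  case: ifPn => h; first by rewrite mem_set.
  by rewrite memNset//=; exact/negP.
Qed.

Definition symbol_integrand xi y : R[i] := (1 - Psi (- pdot y xi)) / (w y)%:C.

Lemma nrm_1BPsi z : nrm (1 - Psi z) <= 2.
Proof.
by rewrite (le_trans (le_normcD _ _))// nrmN nrm_Psi Normc.normc1.
Qed.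

(** For [|y| |xi| < 1] the character is [1] and the integrand vanishes. *)
Lemma symbol_integrand_le : exists2 C : R, 0 <= C & forall xi, xi != 0 -> forall y,
  nrm (symbol_integrand xi y) <= C * tail (pn xi)^-1 y.
Proof.
have [C0 C00 Hw] := weight_lower; exists (2 * C0^-1).
  by rewrite mulr_ge0 ?invr_ge0 ?ltW.
move=> xi xi0 y; rewrite /symbol_integrand /tail; case: ifPn => [h|]; last first.
  rewrite -ltNge => h.
  rewrite -pdotNl Psi_pdot_int ?subrr ?mul0r ?Normc.normc0 ?mulr0//.
  by rewrite pnormN -ler_pdivlMr ?pnorm_gt0// mul1r ltW.
have y0 : y != 0.
  by rewrite -(pnorm_gt0 R); apply: lt_le_trans h; rewrite invr_gt0 pnorm_gt0.
rewrite Normc.normcM Normc.normcV nrm_real ger0_norm ?weight_ge0// -mulrA.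
by apply: ler_pM; rewrite ?nrm_ge0 ?invr_ge0 ?weight_ge0 ?nrm_1BPsi ?Hw.
Qed.

Lemma symbol_integrand_integrable xi : lc_integrable mu (symbol_integrand xi).
Proof.
split.
  apply: (locally_constant_comp2 (fun a b => (1 - a) / b%:C)) => [|]; last first.
    exact: locally_constant_weight.
  have H := locally_constant_Psi (- xi).
  have E y : Psi (- pdot y xi) = Psi (pdot (- xi) y) by rewrite pdotNl pdotC.
  move=> y /H[e e0 eP]; exists e; [exact: e0|move=> y' y'e].
  by rewrite (E (y + y')) (E y); exact: eP.
have [->|xi0] := eqVneq xi 0.
  exists (fun=> 0), 0; split.
    split=> //; rewrite integral0//.
  move=> y; rewrite /symbol_integrand -pdotNl Psi_pdot_int ?subrr ?mul0r ?Normc.normc0//.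
  by rewrite pnorm0 mulr0.
have [C C0 HC] := symbol_integrand_le.
exists (fun y => C * tail (pn xi)^-1 y).
exists (C * ((pn xi)^-1 `^ (n%:R - alpha) * profile_const n alpha)); split; last exact: HC.
by apply: int_leZ => //; apply: int_le_tail; rewrite invr_gt0 pnorm_gt0.
Qed.

Local Notation A := (Asym mu w).

(** The integral of [|y| ^ (- alpha)] over [|y| >= 1 / |xi|] is of order
    [|xi| ^ (alpha - n)]. *)
Lemma symbol_upper : exists2 C : R, 0 <= C & forall xi, nrm (A xi) <= C * pn xi `^ (alpha - n%:R).
Proof.
have [C C0 HC] := symbol_integrand_le.
exists (4 * (C * profile_const n alpha)).
  by rewrite mulr_ge0// mulr_ge0// (profile_const_ge0 muP na).
move=> xi; have [->|xi0] := eqVneq xi 0.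
  rewrite /Asym (@eq_cintegral _ _ _ mu setT _ (fun=> 0)).
    by rewrite cintegral0 Normc.normc0 mulr_ge0 ?powR_ge0// mulr_ge0// mulr_ge0//
      (profile_const_ge0 muP na).
  move=> y _; rewrite -pdotNl Psi_pdot_int ?subrr ?mul0r//.
  by rewrite pnorm0 mulr0.
have px : 0 < pn xi by rewrite pnorm_gt0.
have HI := int_leZ measurableT C0 (int_le_tail (_ : 0 < (pn xi)^-1)).
have := cintegral_le measurableT (HI _) (fun y _ => HC xi xi0 y).
rewrite invr_gt0 => /(_ px) /le_trans; apply.
rewrite -(powR_inv1 (ltW px)) -powRrM mulN1r opprB.
by rewrite [leLHS](_ : _ = 4 * (C * profile_const n alpha) * pn xi `^ (alpha - n%:R)) //; ring.
Qed.

(** The difference of the two integrands is an increment of characters divided by the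
    radial function [w], and its integral vanishes by [cintegral_increment]. *)
Lemma symbol_shift xi eta : pn eta < pn xi -> A (xi + eta) = A xi.
Proof.
move=> ex; have AE z : A z = cintegral mu setT (symbol_integrand z) by [].
apply/eqP; rewrite -subr_eq0 !AE.
rewrite -(cintegralB (symbol_integrand_integrable _) (symbol_integrand_integrable _)).
have GE y : symbol_integrand (xi + eta) y - symbol_integrand xi y =
    Psi (pdot (- xi) y) * (1 - Psi (pdot (- eta) y)) * (w y)%:C^-1.
  rewrite /symbol_integrand !PsiN_pdotC opprD PsiD_pdot -mulrBl; congr (_ / _).
  by move: (Psi _) (Psi _) => a b; ring.
have Hi := lc_integrableB (symbol_integrand_integrable (xi + eta))
  (symbol_integrand_integrable xi).
have FE : (fun y => symbol_integrand (xi + eta) y - symbol_integrand xi y) =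
    (fun y => Psi (pdot (- xi) y) * (1 - Psi (pdot (- eta) y)) * (w y)%:C^-1).
  by apply/funext.
rewrite FE in Hi; rewrite FE; apply/eqP.
apply: (@cintegral_increment (- xi) (- eta) (fun y => (w y)%:C^-1) _ _ Hi).
  by rewrite !pnormN.
by move=> y y' yy'; rewrite (weight_radial (x := y + y') (y := y))// pnormD_eq.
Qed.

(** The real part of the integrand is nonnegative everywhere. Choose [y0] of norm
    [p / |xi|] with [- (xi . y0) = 1 / p]: on the ball of radius [1 / |xi|] around
    [y0], of volume [|xi| ^ (- n)], the character equals [zeta_p], so that the integrand
    is at least a positive multiple of [|xi| ^ alpha]. *)
Lemma symbol_lower : exists2 c : R, 0 < c &
  forall xi, c * pn xi `^ (alpha - n%:R) <= complex.Re (A xi).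
Proof.
case: (wP) => _ _ _ _ [C0 [C1 [C00 C10 Cw]]].
have p0 := pR_gt0 R pp; have rz := Re_zeta_p R pp.
pose m : R := (1 - complex.Re (zeta_p R pp)) / (C1 * p%:R `^ alpha).
have m0 : 0 < m by rewrite divr_gt0 ?subr_gt0// mulr_gt0// powR_gt0.
exists m => // xi; have Fge0 y : 0 <= complex.Re (symbol_integrand xi y).
  have h : complex.Re (Psi (- pdot y xi)) <= 1.
    by rewrite -(nrm_Psi R (- pdot y xi)) (le_trans (ler_norm _))// Re_le_nrm.
  by rewrite /symbol_integrand Re_divr ReB divr_ge0 ?weight_ge0// subr_ge0.
have intF := lc_integrable_part (@Re_le_nrm R) (symbol_integrand_integrable xi).
have [xi0|xi0] := eqVneq xi 0.
  move: Fge0; rewrite xi0 => Fge0.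
  have an0 : alpha - n%:R != 0 by rewrite gt_eqF// subr_gt0.
  have Fge0' : 0 <= complex.Re (A 0) by apply: Rintegral_ge0 => y _; exact: Fge0.
  by move: Fge0'; move: (complex.Re _) => r r0; rewrite pnorm0 (powR0 an0) mulr0.
have px : 0 < pn xi by rewrite pnorm_gt0.
have nxi0 : - xi != 0 by rewrite oppr_eq0.
have [y0 [dy0 py0]] := pdot_dual R nxi0; rewrite pnormN in py0.
have [k xk] := pnorm_pX R xi0.
pose S : set (borelQpn pp n) := (fun y : V => y + - y0) @^-1` (@pball R p pp n (p%:R ^ (- k))).
have mS : measurable (S : set (borelQpn pp n)).
  rewrite /S -[_ @^-1` _]setTI; apply: (measurable_translation R) => //.
  exact: measurable_pball.
have muS : mu S = ((pn xi)^-1 `^ n%:R)%:E.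
  rewrite /S (haar_translation muP) ?(haar_ball muP); last exact: measurable_pball.
  by rewrite powR_mulrn ?invr_ge0 ?pnorm_ge0// xk -invr_expz.
pose M := (1 - complex.Re (zeta_p R pp)) / (C1 * (p%:R / pn xi) `^ alpha).
have M0 : 0 < M by rewrite divr_gt0 ?subr_gt0// mulr_gt0// powR_gt0// divr_gt0.
have D0 : 0 < C1 * (p%:R / pn xi) `^ alpha by rewrite mulr_gt0// powR_gt0// divr_gt0.
have z1 : 0 < 1 - complex.Re (zeta_p R pp) by rewrite subr_gt0.
have small : p%:R ^ (- k) <= p%:R / pn xi.
  by rewrite xk -invr_expz ler_peMl ?invr_ge0 ?exprz_ge0 ?(ltW p0) ?(ltW (pgt1 pp R)).
have FM y : S y -> M <= complex.Re (symbol_integrand xi y).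
  rewrite /S /pball /= => Sy.
  have yE : y = y0 + (y - y0) by rewrite addrC subrK.
  have Psiy : Psi (- pdot y xi) = zeta_p R pp.
    rewrite yE (PsiN_pdotDl y0 (y - y0) xi) (PsiN_pdot_int (x := y - y0)); last first.
      rewrite (le_trans (ler_wpM2r _ Sy))// ?pnorm_ge0// xk -expfzDr ?gt_eqF//.
      by rewrite addNr expr0z.
    by rewrite mulr1 (pdotC y0 xi) -(pdotNl xi y0) dy0.
  have yle : pn y <= p%:R / pn xi.
    rewrite yE; apply: pnormD_le; first by rewrite py0.
    exact: le_trans Sy small.
  have y_neq0 : y != 0.
    apply: contraTneq rz => y00; rewrite -Psiy y00.
    rewrite PsiN_pdot_int; first by rewrite ltxx.
    by rewrite pnorm0 mul0r.
  have wy : 0 < w y.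
    rewrite lt_def weight_ge0 andbT; apply: contra_neq y_neq0 => wy0.
    by case: wP => _ _ _ H _; exact: (H y).1.
  have wb : w y <= C1 * (p%:R / pn xi) `^ alpha.
    apply: le_trans (proj2 (andP (Cw y))) _; apply: ler_wpM2l; first exact: ltW.
    by apply: ler_pow; [exact: alpha_ge0|exact: pnorm_ge0|exact: yle].
  rewrite /symbol_integrand Psiy Re_divr ReB /M; apply: ler_wpM2l; first exact: ltW.
  by rewrite lef_pV2; [exact: wb|exact: D0|exact: wy].
have AE : complex.Re (A xi) = \int[mu]_x complex.Re (symbol_integrand xi x) by [].
rewrite AE /Rintegral -lee_fin fineK; last exact: integrable_fin_num intF.
apply: (@le_trans _ _ (\int[mu]_x (M * \1_S x)%:E)%E).
  under eq_integral do rewrite EFinM.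
  rewrite ge0_integralZl//; last 2 first.
  - by apply/measurable_EFinP; exact: measurable_indic.
  - by rewrite lee_fin ltW.
  rewrite integral_indic// setIT muS -EFinM lee_fin /m /M.
  rewrite [(p%:R / _) `^ _]powRM ?invr_ge0 ?(ltW px) ?(ltW p0)//.
  rewrite -(powR_inv1 (ltW px)) -!powRrM !mulN1r !invfM -[(_ `^ (- alpha))^-1]powRN opprK.
  rewrite (powD alpha (- n%:R) px).
  by rewrite [leRHS](_ : _ = (1 - complex.Re (zeta_p R pp)) * (C1^-1 * (p%:R `^ alpha)^-1) *
    (pn xi `^ alpha * pn xi `^ (- n%:R))) //; ring.
apply: lower_integral_mono => y _.
  by rewrite lee_fin mulr_ge0// ltW.
rewrite lee_fin indicE; have [Sy|nSy] := pselect (S y).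
  by rewrite mem_set// mulr1; exact: FM.
by rewrite memNset// mulr0; exact: Fge0.
Qed.

End symbol.

#[local] Opaque cexp.

(** * The heat kernel *)

Section exp_decay.
Variable R : realType.

(** The exponential beats every power; [k ^ k] comes from [(y/k)^k <= e^y]. *)
Lemma powR_le_expR (k y : R) : 0 < k -> 0 <= y -> y `^ k <= k `^ k * expR y.
Proof.
move=> k0 y0; have yk0 : 0 <= y / k by rewrite divr_ge0// ltW.
have -> : y `^ k = k `^ k * (y / k) `^ k.
  by rewrite -powRM ?(ltW k0)// mulrC divfK// gt_eqF.
apply: ler_wpM2l; first exact: powR_ge0.
have -> : expR y = (expR (y / k)) `^ k by rewrite -expRM divfK// gt_eqF.
apply: ler_pow => //; first exact: ltW.
by have := expR_ge1Dx (y / k); lra.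
Qed.

(** Stretched exponential decay in the scale-invariant variable [u], as a power. *)
Lemma exp_decay (N kappa c : R) : 0 < N -> 0 < kappa -> 0 < c ->
  exists2 C : R, 0 <= C & forall u, 0 <= u ->
    expR (- (c * u `^ kappa)) <= C * Num.max 1 u `^ (- N).
Proof.
move=> N0 k0 c0; pose m := N / kappa; have m0 : 0 < m by rewrite divr_gt0.
exists (1 + m `^ m * c `^ (- m)); first by rewrite addr_ge0// mulr_ge0 ?powR_ge0.
move=> u u0; have E0 := expR_gt0 (c * u `^ kappa).
have cu0 : 0 <= c * u `^ kappa by rewrite mulr_ge0 ?powR_ge0// ltW.
have [u1|u1] := leP u 1.
  rewrite powR1 mulr1 -[leLHS]addr0 lerD ?mulr_ge0 ?powR_ge0//.
  by rewrite -expR0 ler_expR oppr_le0.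
have upos : 0 < u by exact: lt_trans u1.
rewrite expRN (powRN u) mulrDl mul1r -[leLHS]add0r lerD ?invr_ge0 ?powR_ge0//.
rewrite ler_pdivlMr ?powR_gt0// mulrC ler_pdivrMr//.
have := powR_le_expR m0 cu0.
rewrite powRM ?powR_ge0 ?(ltW c0)// -powRrM (_ : kappa * m = N); last first.
  by rewrite /m mulrCA divff ?mulr1// gt_eqF.
move=> H; rewrite -(@ler_pM2l _ (c `^ m)) ?powR_gt0//.
rewrite (le_trans H)// [leRHS](_ : _ = m `^ m * expR (c * u `^ kappa) *
  (c `^ (- m) * c `^ m)); last by ring.
by rewrite powNK// mulr1.
Qed.

End exp_decay.

Section heat.
Variables (R : realType) (p : nat) (pp : prime p) (n : nat).
Local Notation V := 'Qp[pp]_n.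
Local Notation pn := (pnorm R).
Local Notation Psi := (@Psi R p pp).
Local Notation d := (n%:R : R).
Implicit Types (x y xi : V) (c : R).
Variables (mu : {measure set borelQpn pp n -> \bar R}) (muP : is_haar mu).
Variables (alpha : R) (w : V -> R) (wP : is_weight alpha w) (na : d < alpha).
Local Notation A := (Asym mu w).
Local Notation kappa := (alpha - d).

Lemma kappa_gt0 : 0 < kappa. Proof. by rewrite subr_gt0. Qed.

Definition heat_symbol c xi : R[i] := cexp (- c%:C * A xi).

(** The kernel [Z] at time [t] for the constant coefficient [a0], with [c = a0 * t]. *)
Definition heat c x : R[i] :=
  cintegral mu setT (fun xi : V => Psi (pdot x xi) * heat_symbol c xi).

(** The spatial scale of diffusion at time [c]. *)
Definition scale c : R := c `^ (kappa^-1).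

Lemma scaleE c : scale c = c `^ (kappa^-1). Proof. by []. Qed.

Lemma scale_gt0 c : 0 < c -> 0 < scale c. Proof. exact: powR_gt0. Qed.

Lemma scale_kappa c : 0 < c -> scale c `^ kappa = c.
Proof.
move=> c0; rewrite /scale -powRrM mulVf ?powRr1 ?ltW// gt_eqF//; exact: kappa_gt0.
Qed.

Lemma Re_NcA c xi : complex.Re (- c%:C * A xi) = - (c * complex.Re (A xi)).
Proof. by case: (A xi) => a b /=; ring. Qed.

Lemma heat_symbol_shift c xi eta : pn eta < pn xi ->
  heat_symbol c (xi + eta) = heat_symbol c xi.
Proof. by move=> h; rewrite /heat_symbol (symbol_shift muP wP na h). Qed.

(** By [symbol_lower] the symbol decays exponentially in [(scale c * |xi|) ^ kappa],
    hence faster than every power of [scale c * |xi|]. *)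
Lemma heat_symbol_decay (N : R) : 0 < N -> exists2 C : R, 0 <= C &
  forall c, 0 < c -> forall xi, nrm (heat_symbol c xi) <=
    C * ((scale c)^-1 `^ d * profile n N (scale c)^-1 (pn xi)).
Proof.
move=> N0; have [c0 c00 Hlow] := symbol_lower muP wP na.
have [C C0 HC] := exp_decay N0 kappa_gt0 c00; exists C => // c cpos xi.
have s0 := scale_gt0 cpos; have px0 := pnorm_ge0 R xi.
have s'0 : 0 < (scale c)^-1 by rewrite invr_gt0.
rewrite /heat_symbol nrm_cexp Re_NcA.
have E1 : expR (- (c * complex.Re (A xi))) <= expR (- (c0 * (scale c * pn xi) `^ kappa)).
  rewrite ler_expR lerN2 powRM ?(ltW s0)// scale_kappa// mulrCA.
  by apply: ler_wpM2l; [exact: ltW|exact: Hlow].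
apply: le_trans E1 _; have sx0 : 0 <= scale c * pn xi by rewrite mulr_ge0// ltW.
apply: le_trans (HC _ sx0) _; apply: ler_wpM2l => //.
rewrite /profile mulrA -powD// (_ : d + (N - d) = N); last by ring.
have m0 := max_gt0 (pn xi) s'0.
have -> : Num.max 1 (scale c * pn xi) = scale c * Num.max (scale c)^-1 (pn xi).
  by rewrite maxr_pMr ?(ltW s0)// divff// gt_eqF.
rewrite powRM ?(ltW s0) ?(ltW m0)//.
have -> : scale c `^ (- N) = (scale c)^-1 `^ N; last exact: lexx.
by rewrite -(powR_inv1 (ltW s0)) -powRrM mulN1r.
Qed.

Lemma locally_constant_heat_symbol c : locally_constant_off0 R (heat_symbol c).
Proof.
move=> xi xi0; exists (pn xi); first by rewrite pnorm_gt0.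
by move=> y; exact: heat_symbol_shift.
Qed.

Lemma heat_integrable c (f : V -> R[i]) : 0 < c -> locally_constant_off0 R f ->
  (forall xi, nrm (f xi) <= 2) -> lc_integrable mu (fun xi => f xi * heat_symbol c xi).
Proof.
move=> c0 fl f2; split.
  exact: (locally_constant_comp2 (fun a b => a * b) fl (locally_constant_heat_symbol c)).
have d0 : 0 <= d by [].
have N0 : 0 < d + 1 by rewrite ltr_wpDl.
have [C C0 HC] := heat_symbol_decay N0.
have s0 : 0 < (scale c)^-1 by rewrite invr_gt0 scale_gt0.
have nN : d < d + 1 by rewrite ltrDl.
exists (fun xi => 2 * (C * ((scale c)^-1 `^ d * profile n (d + 1) (scale c)^-1 (pn xi)))).
exists (2 * (C * ((scale c)^-1 `^ d * profile_const n (d + 1)))); split.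
  do 3 (apply: int_leZ; [exact: measurableT| by rewrite ?powR_ge0|]).
  exact: int_le_profile.
move=> xi; rewrite Normc.normcM; apply: ler_pM; [exact: nrm_ge0|exact: nrm_ge0|exact: f2|].
exact: HC.
Qed.

Lemma heat_integrand_integrable c x : 0 < c ->
  lc_integrable mu (fun xi => Psi (pdot x xi) * heat_symbol c xi).
Proof.
move=> c0; apply: heat_integrable => //; first exact: locally_constant_Psi.
by move=> xi; rewrite nrm_Psi ler1n.
Qed.

(** The cancellation of [symbol_shift] again, now with the symbol in place of
    [1 / w]: the heat kernel is constant on the balls that miss the origin. *)
Lemma heat_shift c x y : 0 < c -> pn y < pn x -> heat c (x + y) = heat c x.
Proof.
move=> c0 yx; apply/eqP; rewrite eq_sym -subr_eq0 /heat.
rewrite -(cintegralB (heat_integrand_integrable x c0) (heat_integrand_integrable (x + y) c0)).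
have E : (fun xi => Psi (pdot x xi) * heat_symbol c xi - Psi (pdot (x + y) xi) * heat_symbol c xi)
    = (fun xi => Psi (pdot x xi) * (1 - Psi (pdot y xi)) * heat_symbol c xi).
  apply/funext => xi; rewrite PsiD_pdot.
  by move: (Psi _) (Psi _) (heat_symbol _ _) => a b e; ring.
have Hi := lc_integrableB (heat_integrand_integrable x c0) (heat_integrand_integrable (x + y) c0).
rewrite E in Hi; rewrite E; apply/eqP.
by apply: (@cintegral_increment R p pp n mu muP x y (heat_symbol c) yx _ Hi) => u u'; exact: heat_symbol_shift.
Qed.

(** Continuity of order [gam] at scale [rho]: increments of [Psi] are at most
    [2 (|xi| |y|)^gam], and the symbol has finite moments. *)
Lemma heat_increment (gam : R) : 0 <= gam -> exists2 C : R, 0 <= C &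
  forall c, 0 < c -> forall x y,
    nrm (heat c (x - y) - heat c x) <= C * (scale c `^ (- d - gam) * pn y `^ gam).
Proof.
move=> g0; pose N : R := d + gam + 1.
have N0 : 0 < N by rewrite ltr_wpDl// addr_ge0.
have nN : d < N - gam by rewrite /N; lra.
have [C C0 HC] := heat_symbol_decay N0.
exists (4 * (2 * (C * profile_const n (N - gam)))).
  by do 3 (apply: mulr_ge0 => //); exact: (profile_const_ge0 muP nN).
move=> c c0 x y; have s0 := scale_gt0 c0.
have s'0 : 0 < (scale c)^-1 by rewrite invr_gt0.
pose B : R := 2 * (C * ((scale c)^-1 `^ d * (pn y `^ gam * (scale c)^-1 `^ gam))).
have B0 : 0 <= B by do 4 (rewrite mulr_ge0 ?powR_ge0//).
have Hint := int_leZ measurableT B0 (int_le_profile muP nN s'0).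
have [_ [k [e [Hk Gk]]]] := heat_integrand_integrable x c0.
have near : nrm (heat c (x - y) - heat c x) <= 4 * (B * profile_const n (N - gam)).
  apply: (cintegral_near measurableT Hint Hk) => [xi _|xi _]; last exact: Gk.
  rewrite -mulrBl Normc.normcM PsiD_pdot -{2}[Psi (pdot x xi)]mulr1 -mulrBr Normc.normcM.
  rewrite nrm_Psi mul1r.
  have P : nrm (Psi (pdot (- y) xi) - 1) <= 2 * (pn y * pn xi) `^ gam.
    have [h|h] := leP (pn y * pn xi) 1.
      rewrite Psi_pdot_int ?pnormN// subrr Normc.normc0; apply: mulr_ge0 => //.
      exact: powR_ge0.
    rewrite nrmB; apply: le_trans (nrm_1BPsi _ _) _.
    rewrite ler_peMr// -[leLHS](powRr0 (pn y * pn xi)) ler_powR//; exact: ltW.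
  apply: le_trans (ler_pM (nrm_ge0 _) (nrm_ge0 _) P (HC c c0 xi)) _.
  have W := @profile_weight R n N _ _ gam s'0 (pnorm_ge0 R xi) g0.
  rewrite (powRM _ (pnorm_ge0 R y) (pnorm_ge0 R xi)) /B.
  move: W (powR_ge0 (pn y) gam) (powR_ge0 (scale c)^-1 d).
  move: (profile n N _ _) (profile n (N - gam) _ _) (pn xi `^ gam) (pn y `^ gam).
  move: (_ `^ d) (_ `^ gam) => a b P1 P2 u v W v0 a0.
  rewrite [leLHS](_ : _ = 2 * (C * (a * v)) * (P1 * u)); last by ring.
  rewrite [leRHS](_ : _ = 2 * (C * (a * v)) * (b * P2)); last by ring.
  by apply: ler_wpM2l W; do 3 (apply: mulr_ge0 => //).
apply: le_trans near _; rewrite /B.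
have -> : scale c `^ (- d - gam) = (scale c)^-1 `^ d * (scale c)^-1 `^ gam.
  by rewrite -powD// -(powR_inv1 (ltW s0)) -powRrM mulN1r opprD.
rewrite [leRHS](_ : _ = 4 * (2 * (C * ((scale c)^-1 `^ d * (pn y `^ gam *
  (scale c)^-1 `^ gam))) * profile_const n (N - gam))) ?lexx//; ring.
Qed.

Lemma heat_sup : exists2 C : R, 0 <= C &
  forall c, 0 < c -> forall x, nrm (heat c x) <= C * scale c `^ (- d).
Proof.
have N0 : 0 < d + 1 by rewrite ltr_wpDl.
have nN : d < d + 1 by rewrite ltrDl.
have [C C0 HC] := heat_symbol_decay N0.
exists (4 * (C * profile_const n (d + 1))).
  by do 2 (apply: mulr_ge0 => //); exact: (profile_const_ge0 muP nN).
move=> c c0 x; have s0 := scale_gt0 c0.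
have s'0 : 0 < (scale c)^-1 by rewrite invr_gt0.
have B0 : 0 <= C * (scale c)^-1 `^ d by rewrite mulr_ge0 ?powR_ge0.
have Hint := int_leZ measurableT B0 (int_le_profile muP nN s'0).
have near := @cintegral_le _ (borelQpn pp n) R mu setT
  (fun xi : V => Psi (pdot x xi) * heat_symbol c xi) _ _ measurableT Hint.
apply: le_trans (near _) _ => [xi _|].
  by rewrite Normc.normcM nrm_Psi mul1r -mulrA; exact: HC.
have -> : scale c `^ (- d) = (scale c)^-1 `^ d.
  by rewrite -(powR_inv1 (ltW s0)) -powRrM mulN1r.
rewrite [leRHS](_ : _ = 4 * (C * (scale c)^-1 `^ d * profile_const n (d + 1))) ?lexx//; ring.
Qed.

(** Off the diagonal: translating the integration variable by [xi0] with
    [x . xi0 = 1 / p] multiplies the character by a root of unity and changes the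
    symbol only in the ball of radius [|xi0|], where it is [1 + O(c |xi0|^kappa)]. *)
Lemma heat_tail : exists2 C : R, 0 <= C &
  forall c, 0 < c -> forall x, x != 0 -> nrm (heat c x) <= C * (c * pn x `^ (- alpha)).
Proof.
have [C C0 HC] := symbol_upper muP wP na.
have [c0 c00 Hlow] := symbol_lower muP wP na.
have p0 := pR_gt0 R pp; pose z := zeta_p R pp.
have nz0 : 0 < nrm (1 - z).
  rewrite lt_def nrm_ge0 andbT; apply/eqP => /Normc.eq0_normc/eqP.
  by rewrite subr_eq0 eq_sym; apply/negP; exact: zeta_p_neq1.
exists (24 * C * p%:R `^ alpha / nrm (1 - z)).
  by rewrite mulr_ge0 ?invr_ge0 ?(ltW nz0)// mulr_ge0 ?powR_ge0// mulr_ge0.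
move=> c cpos x x0; have px : 0 < pn x by rewrite pnorm_gt0.
have [xi0 [dxi0 pxi0]] := pdot_dual R x0.
have r0 : 0 < p%:R / pn x by rewrite divr_gt0.
pose r := p%:R / pn x; rewrite -/r in pxi0 r0.
pose F xi := Psi (pdot x xi) * heat_symbol c xi.
have iF : lc_integrable mu F by exact: heat_integrand_integrable.
have Fshift xi : F (xi + xi0) = z * Psi (pdot x xi) * heat_symbol c (xi + xi0).
  by rewrite /F (pdotDr xi xi0 x) PsiD dxi0 [Psi _ * Psi _]mulrC.
have [_ [k [e [Hk Gk]]]] := lc_integrableZ z iF.
pose B : R := 6 * (c * (C * r `^ kappa)).
have B0 : 0 <= B by rewrite mulr_ge0// mulr_ge0 ?(ltW cpos)// mulr_ge0 ?powR_ge0.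
have Hint := int_leZ measurableT B0 (int_ball_le muP r0).
have g1 xi : pn xi <= r -> nrm (heat_symbol c xi - 1) <= 3 * (c * (C * r `^ kappa)).
  move=> xir; apply: le_trans (nrm_cexpB1 _) _.
    rewrite Re_NcA oppr_le0 mulr_ge0 ?(ltW cpos)//; apply: le_trans (Hlow xi).
    by rewrite mulr_ge0 ?powR_ge0// ltW.
  apply: ler_wpM2l => //; rewrite Normc.normcM nrmN nrm_real ger0_norm ?(ltW cpos)//.
  apply: ler_wpM2l; first exact: ltW.
  apply: le_trans (HC xi) _; apply: ler_wpM2l => //.
  by apply: ler_pow; [exact: ltW kappa_gt0|exact: pnorm_ge0|].
have near : nrm (cintegral mu setT (fun xi : V => F (xi + xi0)) -
    cintegral mu setT (fun xi : V => z * F xi)) <= 4 * (B * r `^ d).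
  apply: (cintegral_near measurableT Hint Hk) => [xi _|xi _]; last exact: Gk.
  have -> : F (xi + xi0) - z * F xi =
      z * Psi (pdot x xi) * (heat_symbol c (xi + xi0) - heat_symbol c xi).
    by rewrite Fshift /F mulrA -mulrBr.
  have zP : nrm (z * Psi (pdot x xi)) = 1.
    by rewrite Normc.normcM nrm_Psi /z nrm_zeta_p mulr1.
  rewrite Normc.normcM zP mul1r; have [xir|xir] := leP (pn xi) r; last first.
    by rewrite heat_symbol_shift ?pxi0// subrr Normc.normc0 mulr0.
  have xi0r : pn (xi + xi0) <= r by apply: pnormD_le => //; rewrite pxi0.
  apply: le_trans (nrmB_le _ _ 1) _; rewrite mulr1.
  by apply: le_trans (lerD (g1 _ xi0r) (g1 _ xir)) _; rewrite /B; lra.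
rewrite cintegral_shift// cintegralZ// in near.
have E : cintegral mu setT F - z * cintegral mu setT F = (1 - z) * heat c x.
  by rewrite -/(heat c x) mulrBl mul1r.
rewrite E Normc.normcM in near.
rewrite -(@ler_pM2l _ (nrm (1 - z)))//; apply: le_trans near _.
have rE : r `^ kappa * r `^ d = p%:R `^ alpha * pn x `^ (- alpha).
  rewrite -powD// subrK /r powRM ?(ltW p0) ?invr_ge0 ?(ltW px)//.
  by rewrite -(powR_inv1 (ltW px)) -powRrM mulN1r.
rewrite [leLHS](_ : _ = 24 * C * c * (r `^ kappa * r `^ d)); last by rewrite /B; ring.
rewrite rE [leRHS](_ : _ = 24 * C * c * (p%:R `^ alpha * pn x `^ (- alpha)) *
  (nrm (1 - z) / nrm (1 - z))); last by ring.
by rewrite divff ?mulr1// gt_eqF.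
Qed.

End heat.

#[local] Opaque cintegral heat.

(** * Operators applied to the heat kernel *)

Local Fact far_algebra (R : realType) (C1 i a b e h : R) :
  C1 * (i * a) * e <= C1 * (i * a) * h ->
  (C1 * a + C1 * b) * (i * e) <= i * C1 * h * a + i * C1 * b * e.
Proof. by lra. Qed.

Section heat_bounds.
Variables (R : realType) (p : nat) (pp : prime p) (n : nat).
Local Notation V := 'Qp[pp]_n.
Local Notation pn := (pnorm R).
Local Notation d := (n%:R : R).
Implicit Types (x y xi : V) (c : R).
Variables (mu : {measure set borelQpn pp n -> \bar R}) (muP : is_haar mu).
Variables (alpha : R) (w : V -> R) (wP : is_weight alpha w) (na : d < alpha).
Local Notation heat := (heat mu w).
Local Notation scale := (scale n alpha).
Local Notation profile := (profile n).

(** The two bounds match at [|x| = scale c]: with [rho = scale c] the tail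
    [c * |x| ^ (- alpha)] is [rho ^ (alpha - n) * |x| ^ (- alpha)]. *)
Lemma heat_profile : exists2 C : R, 0 <= C &
  forall c, 0 < c -> forall x, nrm (heat c x) <= C * profile alpha (scale c) (pn x).
Proof.
have [C1 C10 H1] := heat_sup muP wP na; have [C2 C20 H2] := heat_tail muP wP na.
exists (C1 + C2) => [|c c0 x]; first exact: addr_ge0.
have s0 := scale_gt0 n alpha c0; rewrite mulrDl.
have P0 := profile_ge0 n alpha (scale c) (pn x).
have [xs|sx] := leP (pn x) (scale c).
  rewrite profile_near// -[leLHS]addr0; apply: lerD; first exact: H1.
  by rewrite mulr_ge0 ?powR_ge0.
have x0 : x != 0 by rewrite -(pnorm_gt0 R); exact: lt_trans sx.
rewrite profile_far ?(ltW sx)// scale_kappa// -[leLHS]add0r; apply: lerD; last exact: H2.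
by rewrite mulr_ge0// mulr_ge0 ?powR_ge0// ltW.
Qed.

Variables (gam : R) (w' : V -> R) (wP' : is_weight gam w') (ng : d < gam).

Let g0 : 0 <= gam := le_trans (ler0n R n) (ltW ng).

Lemma nrm_div_weight (u : R[i]) y : nrm (u / (w' y)%:C) = nrm u * (w' y)^-1.
Proof.
by rewrite Normc.normcM Normc.normcV nrm_real ger0_norm// (weight_ge0 wP').
Qed.

(** Near the diagonal the increment of the kernel is [O(rho^(-n) min(1, |y|/rho)^gam)],
    whose quotient by [|y|^gam] is a profile of exponent [gam]. *)
Lemma Wop_heat_near : exists2 C : R, 0 <= C & forall c, 0 < c -> forall x,
  nrm (Wop mu w' (heat c) x) <= C * scale c `^ (- gam).
Proof.
have [C1 C10 H1] := heat_sup muP wP na; have [C2 C20 H2] := heat_increment muP wP na g0.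
have [C0 C00 Hw] := weight_lower wP'.
pose K : R := (2 * C1 + C2) * C0^-1.
have K0 : 0 <= K by rewrite mulr_ge0 ?invr_ge0 ?(ltW C00)// addr_ge0// mulr_ge0.
exists (4 * (K * profile_const n gam)).
  by rewrite mulr_ge0// mulr_ge0// (profile_const_ge0 muP ng).
move=> c c0 x; have s0 := scale_gt0 n alpha c0.
have B0 : 0 <= K * scale c `^ (- gam) by rewrite mulr_ge0 ?powR_ge0.
have Hint := int_leZ measurableT B0 (int_le_profile muP ng s0).
have near := @cintegral_le _ (borelQpn pp n) R mu setT
  (fun y : V => (heat c (x - y) - heat c x) / (w' y)%:C) _ _ measurableT Hint.
apply: le_trans (near _) _ => [y _|]; last first.
  rewrite [leLHS](_ : _ = 4 * (K * profile_const n gam) * scale c `^ (- gam)) ?lexx//.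
  by move: (scale c `^ _) (profile_const _ _) => a b; ring.
rewrite nrm_div_weight; have [->|y0] := eqVneq y 0.
  by rewrite subr0 subrr Normc.normc0 mul0r mulr_ge0 ?profile_ge0.
have py : 0 < pn y by rewrite pnorm_gt0.
have P : scale c `^ (- gam) * profile gam (scale c) (pn y) =
    scale c `^ (- d) * Num.max (scale c) (pn y) `^ (- gam).
  by rewrite !profileE mulrA -powD//; congr (_ `^ _ * _); ring.
have D1 z : nrm (heat c z - heat c x) <= 2 * C1 * scale c `^ (- d).
  apply: le_trans (le_normcD _ _) _; rewrite nrmN.
  apply: le_trans (lerD (H1 c c0 z) (H1 c c0 x)) _.
  by move: (_ `^ - d) => e; lra.
have w0 : 0 <= (w' y)^-1 by rewrite invr_ge0 (weight_ge0 wP').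
have sd0 := powR_ge0 (scale c) (- d).
apply: (@le_trans _ _ ((2 * C1 + C2) * scale c `^ (- d) *
    Num.max (scale c) (pn y) `^ (- gam) * pn y `^ gam * (C0^-1 * pn y `^ (- gam)))).
  apply: ler_pM; [exact: nrm_ge0|exact: w0| |exact: Hw].
  have m0 := max_gt0 (pn y) s0.
  have [ys|sy] := leP (pn y) (scale c).
    apply: le_trans (H2 c c0 x y) _.
    have -> : scale c `^ (- d - gam) = scale c `^ (- d) * scale c `^ (- gam) by exact: powD.
    have := powR_ge0 (pn y) gam; have := powR_ge0 (scale c) (- gam).
    move: (_ `^ gam) (_ `^ - gam) (_ `^ - d) sd0 => u v e e0 v0 u0.
    rewrite [leRHS](_ : _ = C2 * (e * v * u) + 2 * C1 * (e * v * u)); last by ring.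
    by rewrite lerDl !mulr_ge0.
  apply: le_trans (D1 _) _.
  rewrite -[leRHS]mulrA (powNK gam py) mulr1.
  by rewrite ler_wpM2r// lerDl.
rewrite -[X in _ <= X]mulrA P /K.
have := powNK gam py; move: (_ `^ - gam) (_ `^ - gam) (_ `^ gam) (_ `^ - d) => b a e h E.
rewrite [leLHS](_ : _ = (2 * C1 + C2) * C0^-1 * (h * b) * (a * e)); last by ring.
by rewrite E mulr1 lexx.
Qed.

(** As the heat kernel is constant on the balls that miss the origin, only the jumps
    of size at least [|x|] contribute. *)
Lemma Wop_heat_far : exists2 C : R, 0 <= C & forall c, 0 < c -> forall x, x != 0 ->
  nrm (Wop mu w' (heat c) x) <= C * pn x `^ (- gam).
Proof.
have [C1 C10 H1] := heat_profile.
have [C0 C00 Hw] := weight_lower wP'.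
have Ka := profile_const_ge0 muP na; have Kg := profile_const_ge0 muP ng.
pose K := C0^-1 * C1; have K0 : 0 <= K by rewrite mulr_ge0 ?invr_ge0 ?(ltW C00).
exists (4 * (K * (profile_const n alpha + profile_const n gam))).
  by rewrite mulr_ge0// mulr_ge0// addr_ge0.
move=> c c0 x x0; have s0 := scale_gt0 n alpha c0.
have px : 0 < pn x by rewrite pnorm_gt0.
pose P := profile alpha (scale c).
have P0 r : 0 <= P r by exact: profile_ge0.
have Bx : 0 <= K * pn x `^ (- gam) by rewrite mulr_ge0 ?powR_ge0.
have Bt : 0 <= K * P (pn x) by rewrite mulr_ge0.
have I1 := int_leZ measurableT Bx (int_le_profile_shift muP x na s0).
have I2 := int_leZ measurableT Bt (int_le_tail muP ng px).
have Hint := int_leD measurableT I1 I2.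
have near := @cintegral_le _ (borelQpn pp n) R mu setT
  (fun y : V => (heat c (x - y) - heat c x) / (w' y)%:C) _ _ measurableT Hint.
apply: le_trans (near _) _ => [y _|]; last first.
  have Px : P (pn x) * pn x `^ (d - gam) <= pn x `^ (- gam).
    have -> : pn x `^ (- gam) = pn x `^ (- d) * pn x `^ (d - gam).
      by rewrite -powD//; congr (_ `^ _); ring.
    apply: ler_wpM2r; first exact: powR_ge0.
    have m0 := max_gt0 (pn x) s0.
    apply: (@le_trans _ _ (Num.max (scale c) (pn x) `^ (- d))); last first.
      by apply: ler_powN => //; rewrite le_max lexx orbT.
    have -> : Num.max (scale c) (pn x) `^ (- d) =
        Num.max (scale c) (pn x) `^ (alpha - d) * Num.max (scale c) (pn x) `^ (- alpha).
      by rewrite -powD//; congr (_ `^ _); ring.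
    apply: ler_wpM2r; first exact: powR_ge0.
    apply: ler_pow; [by rewrite subr_ge0 ltW|exact: ltW|by rewrite le_max lexx].
  have : K * profile_const n gam * (P (pn x) * pn x `^ (d - gam)) <=
      K * profile_const n gam * pn x `^ (- gam).
    by apply: ler_wpM2l Px; rewrite mulr_ge0.
  move: (_ `^ (d - gam)) (_ `^ - gam) (P _) (profile_const _ _) (profile_const _ _).
  by move=> a b e h j; lra.
rewrite nrm_div_weight; have [yx|xy] := ltP (pn y) (pn x).
  have -> : heat c (x - y) = heat c x by apply: (heat_shift muP wP na c0); rewrite pnormN.
  rewrite subrr Normc.normc0 mul0r; apply: addr_ge0.
    by apply: mulr_ge0; [exact: Bx|exact: profile_ge0].
  apply: mulr_ge0; first exact: Bt.
  by rewrite /tail; case: ifP => _; [exact: powR_ge0|exact: lexx].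
have y0 : y != 0 by rewrite -(pnorm_gt0 R); exact: lt_le_trans xy.
have T : tail gam (pn x) y = pn y `^ (- gam) by rewrite /tail xy.
have wy : (w' y)^-1 <= C0^-1 * pn y `^ (- gam) by exact: Hw.
have w0 : 0 <= (w' y)^-1 by rewrite invr_ge0 (weight_ge0 wP').
have D1 z : nrm (heat c z - heat c x) <= C1 * P (pn z) + C1 * P (pn x).
  apply: le_trans (le_normcD _ _) _; rewrite nrmN.
  by apply: lerD; exact: H1.
apply: le_trans (ler_pM (nrm_ge0 _) w0 (D1 _) wy) _; rewrite T -/P /K.
have yx : pn y `^ (- gam) <= pn x `^ (- gam) by exact: ler_powN.
move: (x - y) => z; have Q0 : 0 <= C1 * (C0^-1 * P (pn z)).
  apply: mulr_ge0; first exact: C10.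
  by apply: mulr_ge0; [rewrite invr_ge0; exact: ltW|exact: P0].
have := ler_wpM2l Q0 yx.
exact: far_algebra.
Qed.

Lemma Wop_heat : exists2 C : R, 0 <= C & forall c, 0 < c -> forall x,
  nrm (Wop mu w' (heat c) x) <= C * Num.max (scale c) (pn x) `^ (- gam).
Proof.
have [C1 C10 H1] := Wop_heat_near; have [C2 C20 H2] := Wop_heat_far.
exists (C1 + C2) => [|c c0 x]; first exact: addr_ge0.
have s0 := scale_gt0 n alpha c0; rewrite mulrDl.
have [xs|sx] := leP (pn x) (scale c).
  rewrite -[leLHS]addr0; apply: lerD; first exact: H1.
  by rewrite mulr_ge0 ?powR_ge0.
have x0 : x != 0 by rewrite -(pnorm_gt0 R); exact: lt_trans sx.
rewrite -[leLHS]add0r; apply: lerD; last exact: H2.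
by rewrite mulr_ge0 ?powR_ge0.
Qed.

End heat_bounds.

(** * The majorant of the parametrix *)

Lemma powR_max_le (R : realType) (a b lam : R) :
  Num.max a b `^ lam <= a `^ lam + b `^ lam.
Proof. by case: (leP a b) => _; rewrite ?lerDr ?lerDl powR_ge0. Qed.

Section majorant.
Variables (R : realType) (p : nat) (pp : prime p) (n : nat).
Local Notation V := 'Qp[pp]_n.
Local Notation pn := (pnorm R).
Local Notation d := (n%:R : R).
Implicit Types (x y xi : V) (s r g : R).
Variables (mu : {measure set borelQpn pp n -> \bar R}) (muP : is_haar mu).
Variables (alpha T : R) (na : d < alpha).
Local Notation kappa := (alpha - d).
Local Notation scale := (scale n alpha).
Local Notation profile := (profile n).

(** The profile of scale one accounts for the leading term of the remainder at points
    whose distance is bounded from below, where the difference of the coefficients is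
    not small. *)
Definition major g s r : R := profile g (scale s) r + profile g 1 r.

Lemma major_ge0 g s r : 0 <= major g s r.
Proof. by rewrite addr_ge0 ?profile_ge0. Qed.

Let k0 : 0 < kappa. Proof. by rewrite subr_gt0. Qed.

Lemma ler_scale s s' : 0 <= s -> s <= s' -> scale s <= scale s'.
Proof. by move=> s0 ss; apply: ler_pow => //; rewrite invr_ge0 ltW. Qed.

Lemma int_le_major_shift g s x : d < g -> 0 < s ->
  int_le mu setT (fun y : V => major g s (pn (x - y))) (2 * profile_const n g).
Proof.
move=> ng s0; rewrite mulr_natl mulr2n; apply: int_leD => //.
  by apply: int_le_profile_shift => //; exact: scale_gt0.
by apply: int_le_profile_shift.
Qed.

Lemma int_le_major_shift' g s x : d < g -> 0 < s ->
  int_le mu setT (fun y : V => major g s (pn (y - x))) (2 * profile_const n g).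
Proof.
move=> ng s0; have := int_le_major_shift x ng s0.
by apply: int_le_ext => y; rewrite pnormB.
Qed.

Local Fact conv_algebra (C Ms P1 Q1 P2 Q2 m11 m12 m21 m22 : R) :
  0 <= C -> 0 <= P1 -> 0 <= Q1 -> 0 <= P2 -> 0 <= Q2 ->
  m11 <= C * Ms -> m12 <= C * Ms -> m21 <= C * Ms -> m22 <= C * Ms ->
  P1 * P2 <= m11 * (P1 + P2) -> P1 * Q2 <= m12 * (P1 + Q2) ->
  Q1 * P2 <= m21 * (Q1 + P2) -> Q1 * Q2 <= m22 * (Q1 + Q2) ->
  (P1 + Q1) * (P2 + Q2) <= 2 * C * Ms * (P1 + Q1 + (P2 + Q2)).
Proof.
move=> C0 P10 Q10 P20 Q20 h11 h12 h21 h22 a b c e.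
have A (u w m : R) : 0 <= u -> 0 <= w -> m <= C * Ms -> m * (u + w) <= C * Ms * (u + w).
  by move=> u0 w0 h; apply: ler_wpM2r => //; exact: addr_ge0.
have := A _ _ _ P10 P20 h11; have := A _ _ _ P10 Q20 h12.
have := A _ _ _ Q10 P20 h21; have := A _ _ _ Q10 Q20 h22.
lra.
Qed.

(** Each of the four products of profiles is treated by [profile_mul], and the larger
    of the two scales that it produces is comparable to [scale (s1 + s2)] or to [1]. *)
Lemma major_conv g : d <= g -> exists2 C : R, 0 <= C &
  forall s1 s2 r r1 r2, 0 < s1 -> 0 < s2 -> s1 + s2 <= T -> r <= Num.max r1 r2 ->
    major g s1 r1 * major g s2 r2 <=
    C * major g (s1 + s2) r * (major g s1 r1 + major g s2 r2).
Proof.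
move=> ng; have gd0 : 0 <= g - d by rewrite subr_ge0.
have ki : 0 <= kappa^-1 by rewrite invr_ge0 ltW.
pose c1 : R := 2 `^ kappa^-1; pose c2 : R := Num.max 1 (scale T).
pose C1 := c1 `^ (g - d + g); pose C2 := c2 `^ (g - d + g).
have C10 : 0 <= C1 by exact: powR_ge0.
have C20 : 0 <= C2 by exact: powR_ge0.
have c11 : 1 <= c1 by rewrite -[leLHS](powRr0 2) ler_powR// ler1n.
have c21 : 1 <= c2 by rewrite le_max lexx.
pose C := C1 + C2 + 1; have C0 : 0 <= C by rewrite !addr_ge0.
exists (2 * C) => [|s1 s2 r r1 r2 s10 s20 sT rr]; first by rewrite mulr_ge0.
have S1 := scale_gt0 n alpha s10; have S2 := scale_gt0 n alpha s20.
have s0 : 0 < s1 + s2 by rewrite addr_gt0.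
have S0 := scale_gt0 n alpha s0; have P := @profile_ge0 R n g.
have M0 := major_ge0 g (s1 + s2) r.
(* the larger of two times is comparable to their sum *)
have half m : 0 < m -> m <= s1 + s2 -> s1 + s2 <= 2 * m ->
    profile g (scale m) r <= C * major g (s1 + s2) r.
  move=> m0 ms sm; have Sm := scale_gt0 n alpha m0.
  apply: (@le_trans _ _ (C1 * profile g (scale (s1 + s2)) r)).
    apply: profile_scale => //.
      apply: le_trans (ler_scale (ltW m0) ms) _.
      by rewrite ler_peMl ?powR_ge0.
    apply: le_trans (ler_scale (ltW s0) sm) _.
    by rewrite !scaleE powRM ?(ltW m0).
  apply: ler_pM => //; first by rewrite /C; lra.
  by rewrite lerDl.
have one m : 0 < m -> m <= s1 + s2 -> profile g (Num.max (scale m) 1) r <= C * major g (s1 + s2) r.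
  move=> m0 ms; have Sm := scale_gt0 n alpha m0.
  have [h|h] := leP (scale m) 1.
    apply: (@le_trans _ _ (1 * profile g 1 r)); first by rewrite mul1r.
    apply: ler_pM => //; first by rewrite /C; lra.
    by rewrite lerDr.
  apply: (@le_trans _ _ (C2 * profile g 1 r)).
    apply: profile_scale => //.
      rewrite mulr1 le_max; apply/orP; right; apply: ler_scale; first exact: ltW.
      exact: le_trans sT.
    by rewrite mulr_ege1// ltW.
  apply: ler_pM => //; first by rewrite /C; lra.
  by rewrite lerDr.
have h11 : profile g (Num.max (scale s1) (scale s2)) r <= C * major g (s1 + s2) r.
  have /orP[h|h] := le_total s1 s2.
    by rewrite max_r ?(ler_scale (ltW s10))//; apply: half; lra.
  by rewrite max_l ?(ler_scale (ltW s20))//; apply: half; lra.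
have h12 : profile g (Num.max (scale s1) 1) r <= C * major g (s1 + s2) r.
  by apply: one => //; lra.
have h21 : profile g (Num.max 1 (scale s2)) r <= C * major g (s1 + s2) r.
  by rewrite maxC; apply: one => //; lra.
have h22 : profile g (Num.max 1 1) r <= C * major g (s1 + s2) r.
  rewrite maxxx; apply: (@le_trans _ _ (1 * profile g 1 r)); first by rewrite mul1r.
  apply: ler_pM => //; first by rewrite /C; lra.
  by rewrite lerDr.
apply: (conv_algebra C0 (P _ _) (P _ _) (P _ _) (P _ _) h11 h12 h21 h22);
  exact: profile_mul.
Qed.

Local Fact weight_algebra (P Q P' Q' xl yl rl sT : R) :
  (P + Q) * yl <= (P + Q) * (xl + rl) -> P * rl <= sT * P' -> Q * rl <= Q' ->
  (P + Q) * (1 + yl) <= (1 + xl) * (P + Q) + (sT * P' + Q').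
Proof. by lra. Qed.

(** Since [|y| <= max |x| |x - y|], the weight at [y] is at most the weight at [x] plus
    [|x - y| ^ lam], and the latter is absorbed by the profiles as long as their
    exponent stays above the dimension. *)
Lemma major_weight g (lam : R) : 0 <= lam -> d < g - lam -> exists2 C : R, 0 <= C &
  forall s x, 0 < s <= T ->
    int_le mu setT (fun y : V => major g s (pn (x - y)) * (1 + pn y `^ lam))
      (C * (1 + pn x `^ lam)).
Proof.
move=> l0 ngl; have ng : d < g by rewrite (lt_le_trans ngl)// gerBl.
have K0 := profile_const_ge0 muP ng; have K0' := profile_const_ge0 muP ngl.
pose C := 2 * profile_const n g + (scale T `^ lam + 1) * profile_const n (g - lam).
have C0 : 0 <= C by rewrite addr_ge0// mulr_ge0// addr_ge0// powR_ge0.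
exists C => // s x /andP[s0 sT]; have S0 := scale_gt0 n alpha s0.
have x1 : 0 <= 1 + pn x `^ lam by rewrite addr_ge0// powR_ge0.
have I1 := int_leZ measurableT x1 (int_le_major_shift x ng s0).
have I2 := int_leZ measurableT (powR_ge0 (scale T) lam) (int_le_profile_shift muP x ngl S0).
have I3 := int_le_profile_shift muP x ngl ltr01.
have I := int_leD measurableT I1 (int_leD measurableT I2 I3).
have Cx : (1 + pn x `^ lam) * (2 * profile_const n g) +
    (scale T `^ lam * profile_const n (g - lam) + profile_const n (g - lam)) <=
    C * (1 + pn x `^ lam).
  have : 0 <= (scale T `^ lam + 1) * profile_const n (g - lam) * pn x `^ lam.
    by rewrite mulr_ge0 ?powR_ge0// mulr_ge0// addr_ge0// powR_ge0.
  rewrite /C; move: (pn x `^ lam) (scale T `^ lam) (profile_const _ _) (profile_const _ _).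
  by move=> a b e h; lra.
apply: (int_leS Cx); apply: int_le_mono I.
  apply: (@measurable_funM _ (borelQpn pp n) R setT
    (fun y : V => major g s (pn (x - y))) (fun y : V => 1 + pn y `^ lam)).
    by case: (int_le_major_shift x ng s0).
  exact: (measurable_locally_constant (locally_constant_radial (fun r => 1 + r `^ lam))).
move=> y _; rewrite mulr_ge0 ?major_ge0 ?addr_ge0 ?powR_ge0//=.
have yx : pn y <= Num.max (pn x) (pn (x - y)).
  have {1}-> : y = x + (y - x) by rewrite addrC subrK.
  by apply: le_trans (pnormD _ _ _) _; rewrite (pnormB _ y x).
have yl : pn y `^ lam <= pn x `^ lam + pn (x - y) `^ lam.
  apply: le_trans (ler_pow l0 (pnorm_ge0 R y) yx) _.
  exact: powR_max_le.
move: (pnorm_ge0 R (x - y)) yl; move: (pn (x - y)) => r r0 yl.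
have W1 : profile g (scale s) r * r `^ lam <= scale T `^ lam * profile (g - lam) (scale s) r.
  apply: le_trans (profile_weight n g S0 r0 l0) _.
  apply: ler_wpM2r; first exact: profile_ge0.
  by apply: ler_pow => //; [exact: ltW|exact: ler_scale (ltW s0) sT].
have W2 := profile_weight n g ltr01 r0 l0; rewrite powR1 mul1r in W2.
exact: weight_algebra (ler_wpM2l (major_ge0 g s r) yl) W1 W2.
Qed.

End majorant.

Section time_kernel.
Variable R : realType.
Implicit Types (s t tau th Lam v : R).
Local Notation leb := (@lebesgue_measure R).

(** The weight [exp (- Lam u)] weakens the singularity [u ^ (v - 1)] to
    [Lam ^ (- v / 2) * u ^ (v / 2 - 1)], so that for large [Lam] the convolution gains a
    factor as small as desired. One of [t - th] and [th - tau] is at least half of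
    [t - tau], and there the corresponding factor is not singular. *)
Lemma time_convolution v (T q : R) : 0 < v <= 1 -> 0 < T -> 0 < q ->
  exists2 Lam : R, 0 <= Lam & forall tau t, tau < t -> t - tau <= T ->
    int_le leb `]tau, t[ (fun th => (t - th) `^ (v - 1) * expR (- (Lam * (t - th))) *
      (th - tau) `^ (v - 1)) (q * (t - tau) `^ (v - 1)).
Proof.
move=> /andP[v0 v1] T0 q0; pose h := v / 2.
have h0 : 0 < h by rewrite divr_gt0.
have h1 : h <= 1 by rewrite /h; lra.
pose K := 2^-1 `^ (v - 1) * (2 * (time_const h * T `^ h)).
have K0 : 0 <= K by rewrite mulr_ge0 ?powR_ge0// mulr_ge0// mulr_ge0 ?powR_ge0 ?time_const_ge0.
pose L := K / q + 1; have L0 : 0 < L by rewrite ltr_wpDl// divr_ge0// ltW.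
pose Lam := L `^ h^-1; have Lam0 : 0 < Lam by exact: powR_gt0.
have LamL : Lam `^ (- h) * K <= q.
  rewrite powRN /Lam -powRrM mulVf ?gt_eqF// powRr1 ?(ltW L0)//.
  rewrite mulrC ler_pdivrMr// /L mulrDr mulr1 mulrC divfK ?gt_eqF// lerDl; exact: ltW.
exists Lam => [|tau t taut tT]; first exact: ltW.
have s0 : 0 < t - tau by rewrite subr_gt0.
have h01 : 0 < h <= 1 by rewrite h0.
pose D := (2^-1 * (t - tau)) `^ (v - 1) * Lam `^ (- h).
have D0 : 0 <= D by rewrite mulr_ge0 ?powR_ge0.
have I := int_leD _ (int_le_time_right h01 taut) (int_le_time_left h01 taut).
have {}I := int_leZ _ D0 (I (measurable_itv _)).
have {}I := I (measurable_itv _).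
have Dq : D * (time_const h * (t - tau) `^ h + time_const h * (t - tau) `^ h) <=
    q * (t - tau) `^ (v - 1).
  rewrite /D powRM ?(ltW s0)//.
  have Ts : (t - tau) `^ h <= T `^ h by apply: ler_pow => //; exact: ltW.
  have := ler_wpM2r (powR_ge0 (t - tau) (v - 1)) LamL; rewrite /K.
  have tc := time_const_ge0 h0.
  have Z : 0 <= 2^-1 `^ (v - 1) * (t - tau) `^ (v - 1) * Lam `^ (- h) * (2 * time_const h).
    apply: mulr_ge0; last exact: mulr_ge0.
    by apply: mulr_ge0; [apply: mulr_ge0|]; exact: powR_ge0.
  have := ler_wpM2l Z Ts.
  move: (_ `^ h) (_ `^ h) (_ `^ - h) (time_const h) (_ `^ (v - 1)) (_ `^ (v - 1)).
  by move=> a b c e u w; lra.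
apply: (int_leS Dq); apply: int_le_mono I.
  apply: measurable_funM; [apply: measurable_funM|].
  - by apply: (measurableT_comp (measurable_powR _)); exact: measurable_funB.
  - apply: (measurableT_comp (@measurable_expR _)); apply: measurable_funN.
    by apply: measurable_funM => //; exact: measurable_funB.
  - by apply: (measurableT_comp (measurable_powR _)); exact: measurable_funB.
move=> th /=; rewrite in_itv/= => /andP[tauth tht].
rewrite !mulr_ge0 ?powR_ge0 ?expR_ge0//=.
have u0 : 0 < t - th by rewrite subr_gt0.
have w0 : 0 < th - tau by rewrite subr_gt0.
have E u : 0 < u -> u `^ (v - 1) * expR (- (Lam * u)) <= Lam `^ (- h) * u `^ (h - 1).
  move=> up; have Lu : 0 < Lam * u by rewrite mulr_gt0.
  have B : expR (- (Lam * u)) <= (Lam * u) `^ (- h).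
    rewrite expRN powRN lef_pV2 ?posrE ?expR_gt0 ?powR_gt0//.
    have [le1|gt1] := leP (Lam * u) 1.
      apply: (@le_trans _ _ 1); last by rewrite -expR0 ler_expR ltW.
      have -> : 1 = (1 : R) `^ h by rewrite powR1.
      by apply: ler_pow => //; exact: ltW.
    apply: (@le_trans _ _ (Lam * u)); last by have := expR_ge1Dx (Lam * u); lra.
    by apply: ler1_powR => //; exact: ltW.
  apply: le_trans (ler_wpM2l (powR_ge0 _ _) B) _.
  rewrite powRM ?(ltW Lam0) ?(ltW up)// mulrCA -powD//.
  by rewrite (_ : v - 1 + - h = h - 1) ?lexx// /h; field.
have v10 : 0 <= 1 - v by rewrite subr_ge0.
have mono a b : 0 < a -> a <= b -> b `^ (v - 1) <= a `^ (v - 1).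
  by move=> a0 ab; rewrite -(opprB 1 v); apply: ler_powN.
have half0 : 0 < 2^-1 * (t - tau) by rewrite mulr_gt0.
have Q := @powR_ge0 R; rewrite [leRHS]mulrDr.
have [le|gt] := leP (t - th) (th - tau).
  apply: (@le_trans _ _ (D * (t - th) `^ (h - 1))); last by rewrite lerDl mulr_ge0.
  have m : (th - tau) `^ (v - 1) <= (2^-1 * (t - tau)) `^ (v - 1) by apply: mono => //; lra.
  rewrite mulrC /D -mulrA; apply: ler_pM => //; last exact: E.
  by rewrite mulr_ge0 ?powR_ge0 ?expR_ge0.
apply: (@le_trans _ _ (D * (th - tau) `^ (h - 1))); last by rewrite lerDr mulr_ge0.
have m : (t - th) `^ (v - 1) <= (2^-1 * (t - tau)) `^ (v - 1) by apply: mono => //; lra.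
have ex : expR (- (Lam * (t - th))) <= expR (- (Lam * (th - tau))).
  by rewrite ler_expR lerN2; apply: ler_wpM2l; exact: ltW.
rewrite /D -!mulrA; apply: ler_pM => //; first by rewrite mulr_ge0 ?powR_ge0 ?expR_ge0.
rewrite mulrC; apply: le_trans (E _ w0); apply: ler_wpM2l => //.
Qed.

End time_kernel.

Lemma Zker_heat (R : realType) (p : nat) (pp : prime p) (n : nat)
    (mu : {measure set borelQpn pp n -> \bar R}) (alpha : R) (w : R -> 'Qp[pp]_n -> R)
    (a : nat -> 'Qp[pp]_n -> R -> R) (x : 'Qp[pp]_n) (s : R) (xi : 'Qp[pp]_n) (tau : R) :
  Zker mu alpha w a x s xi tau = heat mu (w alpha) (a 0%N xi tau * s) x.
Proof. by []. Qed.

(** * The parametrix and the remainder *)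

Section frozen_kernel.
#[local] Opaque Zker Wop.
Variables (R : realType) (p : nat) (pp : prime p) (n : nat).
Local Notation V := 'Qp[pp]_n.
Local Notation pn := (pnorm R).
Local Notation d := (n%:R : R).
Implicit Types (x y z xi h : V) (s t tau th r : R).
Variables (mu : {measure set borelQpn pp n -> \bar R}) (muP : is_haar mu).
Variables (alpha T m M : R) (w : R -> V -> R) (a : nat -> V -> R -> R).
Hypotheses (na : d < alpha) (wP : is_weight alpha (w alpha)).
Hypotheses (m_gt0 : 0 < m) (a0_bounds : forall x t, 0 <= t <= T -> m <= a 0%N x t <= M).
Local Notation kappa := (alpha - d).
Local Notation scale := (scale n alpha).
Local Notation profile := (profile n).
Local Notation Z := (Zker mu alpha w a).

Let k0 : 0 < kappa. Proof. by rewrite subr_gt0. Qed.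

(** The scale of the frozen kernel is comparable to that of time, uniformly in the
    point where the coefficient is frozen. *)
Lemma frozen_scale : exists2 c : R, 1 <= c & forall xi tau s, 0 <= tau <= T -> 0 < s ->
  [/\ 0 < a 0%N xi tau * s, scale (a 0%N xi tau * s) <= c * scale s &
      scale s <= c * scale (a 0%N xi tau * s)].
Proof.
have ki : 0 <= kappa^-1 by rewrite invr_ge0 ltW.
exists (Num.max 1 (Num.max (scale M) (scale m^-1))); first by rewrite le_max lexx.
move=> xi tau s tauT s0; have /andP[ma aM] := a0_bounds xi tauT.
have a0 : 0 < a 0%N xi tau by exact: lt_le_trans ma.
have as0 : 0 < a 0%N xi tau * s by rewrite mulr_gt0.
have S0 := scale_gt0 n alpha s0; have Sa0 := scale_gt0 n alpha as0.
split=> //.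
  rewrite {1}scaleE powRM ?(ltW a0) ?(ltW s0)//; apply: ler_wpM2r; first exact: ltW.
  by rewrite !le_max (ler_pow ki (ltW a0) aM) orbT.
apply: (@le_trans _ _ (scale m^-1 * scale (a 0%N xi tau * s))); last first.
  by apply: ler_wpM2r; [exact: ltW|rewrite !le_max lexx !orbT].
rewrite !scaleE -powRM ?invr_ge0 ?(ltW m_gt0) ?(ltW as0)//.
apply: ler_pow => //; first exact: ltW.
by rewrite mulrA mulrC ler_peMr ?(ltW s0)// mulrC ler_pdivlMr// mul1r.
Qed.

Lemma Zker_le : exists2 C : R, 0 <= C & forall xi tau s z, 0 <= tau <= T -> 0 < s ->
  nrm (Z z s xi tau) <= C * profile alpha (scale s) (pn z).
Proof.
have [c c1 cP] := frozen_scale; have [C C0 CP] := heat_profile muP wP na.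
exists (C * c `^ (alpha - d + alpha)); first by rewrite mulr_ge0 ?powR_ge0.
move=> xi tau s z tauT s0; have [as0 h1 h2] := cP xi tau s tauT s0.
rewrite Zker_heat; apply: le_trans (CP _ as0 z) _; rewrite -mulrA; apply: ler_wpM2l => //.
by apply: profile_scale => //; [exact: ltW k0|exact: scale_gt0].
Qed.

Lemma Wop_Zker_le gam : d < gam -> is_weight gam (w gam) ->
  exists2 C : R, 0 <= C & forall xi tau s z, 0 <= tau <= T -> 0 < s ->
    nrm (Wop mu (w gam) (fun z => Z z s xi tau) z) <=
      C * Num.max (scale s) (pn z) `^ (- gam).
Proof.
move=> ng wPg; have g0 : 0 <= gam by exact: le_trans (ltW ng).
have [c c1 cP] := frozen_scale; have [C C0 CP] := Wop_heat muP wP na wPg ng.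
have c0 : 0 < c by exact: lt_le_trans c1.
exists (C * c `^ gam); first by rewrite mulr_ge0 ?powR_ge0.
move=> xi tau s z tauT s0; have [as0 h1 h2] := cP xi tau s tauT s0.
have -> : (fun z => Z z s xi tau) = heat mu (w alpha) (a 0%N xi tau * s).
  by apply/funext => z'; rewrite Zker_heat.
apply: le_trans (CP _ as0 z) _; rewrite -mulrA; apply: ler_wpM2l => //.
have Sa0 := scale_gt0 n alpha as0; have S0 := scale_gt0 n alpha s0.
have := pnorm_ge0 R z; move: (pn z) => r r0.
have m0 := max_gt0 r Sa0; have m0' := max_gt0 r S0.
have -> : c `^ gam * Num.max (scale s) r `^ (- gam) =
    (c^-1 * Num.max (scale s) r) `^ (- gam).
  rewrite powRM ?invr_ge0 ?(ltW c0) ?(ltW m0')//; congr (_ * _).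
  by rewrite -(powR_inv1 (ltW c0)) -powRrM mulrN mulN1r opprK.
apply: ler_powN => //; first by rewrite mulr_gt0 ?invr_gt0.
rewrite ler_pdivrMl// ge_max; apply/andP; split.
  by apply: le_trans h2 _; apply: ler_wpM2l; [exact: ltW|rewrite le_max lexx].
apply: (@le_trans _ _ (1 * r)); first by rewrite mul1r.
by apply: ler_pM => //; rewrite le_max lexx orbT.
Qed.

(** A kernel [max (rho, r) ^ (- gam)] is a profile with a singular factor in time. *)
Lemma max_pow_le_profile g gam s r : g <= gam -> 0 < s ->
  Num.max (scale s) r `^ (- gam) <= s `^ (- ((gam - d) / kappa)) * profile g (scale s) r.
Proof.
move=> ggam s0; have S0 := scale_gt0 n alpha s0; have m0 := max_gt0 r S0.
have -> : s `^ (- ((gam - d) / kappa)) = scale s `^ (- (gam - d)).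
  by rewrite !scaleE -powRrM mulrN mulrC.
rewrite !profileE mulrA -powD// (_ : - (gam - d) + (g - d) = - (gam - g)); last by ring.
have -> : Num.max (scale s) r `^ (- gam) =
    Num.max (scale s) r `^ (- (gam - g)) * Num.max (scale s) r `^ (- g).
  by rewrite -powD//; congr (_ `^ _); ring.
apply: ler_wpM2r; first exact: powR_ge0.
by apply: ler_powN => //; [rewrite subr_ge0|rewrite le_max lexx].
Qed.

End frozen_kernel.

Section remainder.
#[local] Opaque Zker Wop.
Variables (R : realType) (p : nat) (pp : prime p) (n : nat).
Local Notation V := 'Qp[pp]_n.
Local Notation pn := (pnorm R).
Local Notation d := (n%:R : R).
Implicit Types (x y z xi h : V) (s t tau th r : R).
Variables (mu : {measure set borelQpn pp n -> \bar R}) (muP : is_haar mu).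
Variables (N : nat) (alpha_ : nat -> R) (alpha T v m M H g : R) (l : int).
Variables (w : R -> V -> R) (a : nat -> V -> R -> R) (b : V -> R -> R).
Hypotheses (na : d < alpha) (wP : is_weight alpha (w alpha)).
Hypotheses (na_k : forall k, (1 <= k <= N)%N -> d < alpha_ k).
Hypotheses (wP_k : forall k, (1 <= k <= N)%N -> is_weight (alpha_ k) (w (alpha_ k))).
Hypotheses (T_gt0 : 0 < T) (v_lt1 : v < 1).
Hypotheses (m_gt0 : 0 < m) (a0_bounds : forall x t, 0 <= t <= T -> m <= a 0%N x t <= M).
Hypothesis a_bound : forall k x t, (1 <= k <= N)%N -> 0 <= t <= T -> `|a k x t| <= M.
Hypothesis b_bound : forall x t, 0 <= t <= T -> `|b x t| <= M.
Hypothesis a0_lc : forall x h t, 0 <= t <= T -> pn h <= p%:R ^ l -> a 0%N (x + h) t = a 0%N x t.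
Hypothesis a0_hoelder : forall x t s, 0 <= t <= T -> 0 <= s <= T ->
  `|a 0%N x t - a 0%N x s| <= H * `|t - s| `^ v.
Hypothesis g_alpha : g <= alpha.
Hypothesis g_k : forall k, (1 <= k <= N)%N ->
  (g <= alpha_ k /\ alpha_ k - d <= (alpha - d) * (1 - v)) \/
  (forall x t, 0 <= t <= T -> a k x t = 0).
Local Notation kappa := (alpha - d).
Local Notation scale := (scale n alpha).
Local Notation profile := (profile n).
Local Notation major := (major n alpha g).
Local Notation Z := (Zker mu alpha w a).

Let k0 : 0 < kappa. Proof. by rewrite subr_gt0. Qed.
Let M0 : 0 <= M.
Proof.
have /andP[h1 h2] := a0_bounds 0 (introT andP (conj (lexx 0) (ltW T_gt0))).
exact: le_trans (ltW m_gt0) (le_trans h1 h2).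
Qed.

Lemma pow_time s e : 0 < s <= T -> - e <= 1 - v -> s `^ e <= T `^ (e + (1 - v)) * s `^ (v - 1).
Proof.
move=> /andP[s0 sT] ev; have {1}-> : e = e + (1 - v) + (v - 1) by ring.
rewrite (powD _ (v - 1) s0); apply: ler_wpM2r; first exact: powR_ge0.
by apply: ler_pow => //; [lra|exact: ltW].
Qed.

(** The time singularity is integrable. The exponent [v - 1] is what the Hoelder
    condition leaves of the nonintegrable singularity [(t - tau) ^ (- 1)]. *)
Definition kernel_le (K : V -> R -> V -> R -> R[i]) := exists2 C : R, 0 <= C &
  forall x t xi tau, 0 <= tau -> tau < t -> t <= T ->
    nrm (K x t xi tau) <= C * ((t - tau) `^ (v - 1) * major (t - tau) (pn (x - xi))).

Lemma kernel_leD K L : kernel_le K -> kernel_le L ->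
  kernel_le (fun x t xi tau => K x t xi tau + L x t xi tau).
Proof.
move=> [C C0 HK] [D D0 HL]; exists (C + D) => [|x t xi tau h1 h2 h3]; first exact: addr_ge0.
apply: le_trans (le_normcD _ _) _; rewrite mulrDl.
by apply: lerD; [exact: HK|exact: HL].
Qed.

Lemma kernel_leN K : kernel_le K -> kernel_le (fun x t xi tau => - K x t xi tau).
Proof. by move=> [C C0 HK]; exists C => // x t xi tau h1 h2 h3; rewrite nrmN; exact: HK. Qed.

Lemma kernel_le_sum (K : nat -> V -> R -> V -> R -> R[i]) :
  (forall k, (1 <= k <= N)%N -> kernel_le (K k)) ->
  kernel_le (fun x t xi tau => \sum_(1 <= k < N.+1) K k x t xi tau).
Proof.
move=> HK; suff: forall j, (j <= N)%N ->
    kernel_le (fun x t xi tau => \sum_(1 <= k < j.+1) K k x t xi tau) by apply.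
elim=> [_|j IH jN].
  exists 0 => // x t xi tau _ _ _; rewrite big_nil Normc.normc0 mul0r//.
have [C C0 HC] := kernel_leD (IH (ltnW jN)) (HK j.+1 jN).
by exists C => // x t xi tau h1 h2 h3; rewrite big_nat_recr//=; exact: HC.
Qed.

Lemma profile_le_major s r : profile g (scale s) r <= major s r.
Proof. by rewrite lerDl profile_ge0. Qed.

Lemma profile1_le_major s r : profile g 1 r <= major s r.
Proof. by rewrite lerDr profile_ge0. Qed.

Lemma zeroth_term_le : kernel_le (fun x t xi tau => (b x t)%:C * Z (x - xi) (t - tau) xi tau).
Proof.
have [C C0 HC] := Zker_le muP na wP m_gt0 a0_bounds.
exists (M * (C * T `^ (1 - v))); first by rewrite !mulr_ge0 ?powR_ge0.
move=> x t xi tau tau0 taut tT.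
have tT' : 0 <= t <= T by rewrite tT andbT (le_trans tau0)// ltW.
have tauT : 0 <= tau <= T by rewrite tau0 (le_trans (ltW taut)).
have s0 : 0 < t - tau by rewrite subr_gt0.
have sT : 0 < t - tau <= T by rewrite s0; lra.
rewrite nrmMr -mulrA; apply: ler_pM => //; [exact: nrm_ge0|exact: b_bound|].
apply: le_trans (HC xi tau _ (x - xi) tauT s0) _.
move: (x - xi) => z; rewrite -mulrA; apply: ler_wpM2l => //.
have := pow_time sT (_ : - 0 <= 1 - v); rewrite oppr0 powRr0 add0r subr_ge0.
move=> /(_ (ltW v_lt1)) one; rewrite mulrA -[leLHS]mul1r.
apply: ler_pM => //; first exact: profile_ge0.
apply: le_trans (profile_le_major _ _).
by apply: profile_le_exp => //; exact: scale_gt0.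
Qed.

(** The time singularity has order [(alpha_ k - d) / kappa], at most [1 - v]. *)
Lemma lower_term_le k : (1 <= k <= N)%N -> kernel_le (fun x t xi tau =>
  (a k x t)%:C * Wop mu (w (alpha_ k)) (fun z => Z z (t - tau) xi tau) (x - xi)).
Proof.
move=> kN; have [[gk ak]|ak0] := g_k kN; last first.
  exists 0 => // x t xi tau tau0 taut tT; rewrite ak0 ?mul0r ?Normc.normc0//.
  by rewrite tT andbT (le_trans tau0)// ltW.
have [C C0 HC] := Wop_Zker_le muP na wP m_gt0 a0_bounds (na_k kN) (wP_k kN).
pose e : R := - ((alpha_ k - d) / kappa).
have ev : - e <= 1 - v by rewrite opprK ler_pdivrMr// mulrC.
exists (M * (C * T `^ (e + (1 - v)))); first by rewrite !mulr_ge0 ?powR_ge0.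
move=> x t xi tau tau0 taut tT.
have tT' : 0 <= t <= T by rewrite tT andbT (le_trans tau0)// ltW.
have tauT : 0 <= tau <= T by rewrite tau0 (le_trans (ltW taut)).
have s0 : 0 < t - tau by rewrite subr_gt0.
have sT : 0 < t - tau <= T by rewrite s0; lra.
rewrite nrmMr -mulrA; apply: ler_pM => //; [exact: nrm_ge0|exact: a_bound|].
apply: le_trans (HC xi tau _ (x - xi) tauT s0) _.
move: (x - xi) => z; rewrite -mulrA; apply: ler_wpM2l => //.
apply: le_trans (max_pow_le_profile n alpha (pn z) gk s0) _; rewrite mulrA.
apply: ler_pM; [exact: powR_ge0|exact: profile_ge0| |exact: profile_le_major].
exact: pow_time.
Qed.

(** If [|x - xi| <= p ^ l], then [a0 (x, t)] is [a0 (xi, t)] by local constancy, and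
    the coefficients differ by [O ((t - tau) ^ v)]; otherwise the kernel is bounded by
    [|x - xi| ^ (- alpha)], without singularity. *)
Lemma leading_term_le : kernel_le (fun x t xi tau =>
  (a 0%N x t - a 0%N xi tau)%:C *
    Wop mu (w alpha) (fun z => Z z (t - tau) xi tau) (x - xi)).
Proof.
have [C C0 HC] := Wop_Zker_le muP na wP m_gt0 a0_bounds na wP.
have al0 : 0 <= alpha by exact: le_trans (ltW na).
pose q : R := Num.min 1 (p%:R ^ l).
have q0 : 0 < q by rewrite lt_min ltr01 (pXR_gt0 R pp).
have H0 : 0 <= `|H| by [].
exists (`|H| * C + 2 * M * C * (q `^ (- alpha) * T `^ (1 - v))).
  by rewrite addr_ge0// ?mulr_ge0 ?powR_ge0.
move=> x t xi tau tau0 taut tT.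
have tT' : 0 <= t <= T by rewrite tT andbT (le_trans tau0)// ltW.
have tauT : 0 <= tau <= T by rewrite tau0 (le_trans (ltW taut)).
have s0 : 0 < t - tau by rewrite subr_gt0.
have sT : 0 < t - tau <= T by rewrite s0; lra.
have S0 := scale_gt0 n alpha s0.
rewrite nrmMr; have HCz := HC xi tau (t - tau) (x - xi) tauT s0.
have hold : pn (x - xi) <= p%:R ^ l ->
    `|a 0%N x t - a 0%N xi tau| <= `|H| * (t - tau) `^ v.
  move=> xl; have -> : a 0%N x t = a 0%N xi t.
    by rewrite -(a0_lc xi tT' xl) addrC subrK.
  apply: le_trans (a0_hoelder xi tT' tauT) _; rewrite (gtr0_norm s0).
  by apply: ler_wpM2r; [exact: powR_ge0|exact: ler_norm].
have far : `|a 0%N x t - a 0%N xi tau| <= 2 * M.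
  have /andP[h1 h2] := a0_bounds x tT'; have /andP[h3 h4] := a0_bounds xi tauT.
  have M0' := M0; have m0 := ltW m_gt0; rewrite ler_norml.
  move: (a 0%N x t) (a 0%N xi tau) h1 h2 h3 h4 => u u' h1 h2 h3 h4.
  by apply/andP; split; lra.
move: HCz hold; move: (nrm_ge0 (Wop mu (w alpha) (fun z => Z z (t - tau) xi tau) (x - xi))).
move: (nrm _) => W; move: (x - xi) => z W0 HCz hold.
have mj := major_ge0 n alpha g (t - tau) (pn z).
have sv := powR_ge0 (t - tau) (v - 1); rewrite mulrDl.
have [zl|zl] := leP (pn z) (p%:R ^ l).
  rewrite -[leLHS]addr0; apply: lerD; last first.
    by apply: mulr_ge0; [rewrite !mulr_ge0 ?powR_ge0|exact: mulr_ge0].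
  apply: (@le_trans _ _ (`|H| * (t - tau) `^ v * (C * ((t - tau) `^ (- 1) * profile g (scale (t - tau)) (pn z))))).
    apply: ler_pM => //; first exact: hold.
    apply: le_trans HCz _; apply: ler_wpM2l => //.
    have := max_pow_le_profile n alpha (pn z) g_alpha s0.
    by rewrite divff// gt_eqF.
  rewrite -[leLHS]mulrA -[leRHS]mulrA; apply: ler_wpM2l => //.
  rewrite mulrCA; apply: ler_wpM2l => //; rewrite mulrA -powD//.
  by apply: ler_wpM2l => //; exact: profile_le_major.
rewrite -[leLHS]add0r; apply: lerD.
  by apply: mulr_ge0; exact: mulr_ge0.
apply: (@le_trans _ _ (2 * M * (C * (q `^ (- alpha) * profile g 1 (pn z))))).
  apply: ler_pM => //; apply: le_trans HCz _; apply: ler_wpM2l => //.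
  have z0 : 0 < pn z by apply: lt_trans zl; exact: pXR_gt0.
  have z1 : q * Num.max 1 (pn z) <= pn z.
    have [h|h] := leP (pn z) 1.
      by rewrite mulr1 /q ge_min (ltW zl) orbT.
    by rewrite ler_piMl ?(ltW z0)// /q ge_min lexx.
  have m1 : 0 < Num.max 1 (pn z) by rewrite lt_max ltr01.
  apply: (@le_trans _ _ ((q * Num.max 1 (pn z)) `^ (- alpha))).
    apply: ler_powN => //; first exact: mulr_gt0.
    by apply: le_trans z1 _; rewrite le_max lexx orbT.
  rewrite powRM ?(ltW q0) ?(ltW m1)//; apply: ler_wpM2l; first exact: powR_ge0.
  rewrite !profileE powR1 mul1r !powRN lef_pV2 ?posrE ?powR_gt0//.
  by apply: ler_powR => //; rewrite le_max lexx.
rewrite -!mulrA; do 4 (apply: ler_wpM2l; first by rewrite ?powR_ge0).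
rewrite mulrA -[leLHS]mul1r; apply: ler_pM => //; first exact: profile_ge0; last exact: profile1_le_major.
have := pow_time sT (_ : - 0 <= 1 - v); rewrite oppr0 powRr0 add0r subr_ge0.
by apply; exact: ltW.
Qed.

Lemma Rker_le : kernel_le (Rker mu N alpha_ alpha w a b).
Proof.
apply: kernel_leD; last exact: kernel_leN zeroth_term_le.
apply: kernel_leD; first exact: leading_term_le.
by apply: kernel_le_sum => k kN; exact: lower_term_le.
Qed.

End remainder.

(** * Iterated kernels *)

Section limits.
#[local] Opaque Zker Wop Rker.
Variable R : realType.

(** The bound also covers divergent sequences, whose limit is [0] by convention. *)
Lemma nrm_lim_le (F : nat -> R[i]^o) (b : R) : 0 <= b ->
  (forall k, nrm (F k) <= b) -> nrm (limn F : R[i]) <= b.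
Proof.
move=> b0 Fb; have [cF|/dvgP ->] := pselect (cvgn F); last by rewrite Normc.normc0.
apply/ler_addgt0Pr => e e0.
have /cvgrPdist_lt/(_ e%:C) : F k @[k --> \oo] --> (limn F : R[i]^o) by [].
rewrite ltcR => /(_ e0)[k _ /(_ k (leqnn k))] /= lk.
have {}lk : nrm (limn F - F k) < e by rewrite -ltcR.
apply: le_trans (nrm_ltD (F k) _) _; apply: lerD => //.
exact: ltW.
Qed.

End limits.

Section iteration.
#[local] Opaque Zker Wop Rker.
Variables (R : realType) (p : nat) (pp : prime p) (n : nat).
Local Notation V := 'Qp[pp]_n.
Local Notation pn := (pnorm R).
Local Notation d := (n%:R : R).
Local Notation leb := (@lebesgue_measure R).
Implicit Types (x y z xi : V) (s t tau th r : R).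
Variables (mu : {measure set borelQpn pp n -> \bar R}) (muP : is_haar mu).
Variables (N : nat) (alpha_ : nat -> R) (alpha T v g : R).
Variables (w : R -> V -> R) (a : nat -> V -> R -> R) (b : V -> R -> R).
Hypotheses (na : d < alpha) (T_gt0 : 0 < T) (v_gt0 : 0 < v) (v_lt1 : v < 1) (ng : d < g).
Local Notation major := (major n alpha g).
Local Notation Z := (Zker mu alpha w a).
Local Notation Rk := (Rker mu N alpha_ alpha w a b).
Local Notation Rit := (Riter mu N alpha_ alpha w a b).

(** Space-time composition of two dominated kernels is dominated by the same
    majorant; only the time factors have to be convolved. *)
Lemma compose_le : exists2 D : R, 0 <= D &
  forall (K L : V -> R -> R[i]) (k l : R -> R) c x t xi tau,
    tau < t -> t - tau <= T ->
    (forall th, 0 <= k th) -> (forall th, 0 <= l th) ->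
    (forall th y, tau < th < t -> nrm (K y th) <= k th * major (t - th) (pn (x - y))) ->
    (forall th y, tau < th < t -> nrm (L y th) <= l th * major (th - tau) (pn (y - xi))) ->
    int_le leb `]tau, t[ (fun th => k th * l th) c ->
    nrm (cintegral leb `]tau, t[ (fun th => cintegral mu setT (fun y : V => K y th * L y th)))
      <= D * c * major (t - tau) (pn (x - xi)).
Proof.
have [Cc Cc0 HC] := major_conv T na (ltW ng).
have Kg0 := profile_const_ge0 muP ng.
pose D0 : R := 4 * (Cc * (2 * profile_const n g + 2 * profile_const n g)).
have D00 : 0 <= D0 by rewrite mulr_ge0// mulr_ge0// addr_ge0// mulr_ge0.
exists (4 * D0) => [|K L k l c x t xi tau taut tT k0 l0 HK HL Hc]; first exact: mulr_ge0.
have M0 : 0 <= D0 * major (t - tau) (pn (x - xi)) by rewrite mulr_ge0 ?major_ge0.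
have Hint := int_leZ _ M0 Hc; have {}Hint := Hint (measurable_itv _).
have near := @cintegral_le _ _ R leb `]tau, t[%classic
  (fun th => cintegral mu setT (fun y : V => K y th * L y th)) _ _ _ Hint.
have {}near := near (measurable_itv _).
apply: le_trans (near _) _ => [th|]; last first.
  move: (major _ _) => q; rewrite [leLHS](_ : _ = 4 * D0 * c * q) ?lexx//; ring.
rewrite /= in_itv/= => thI; have /andP[tauth tht] := thI.
have s10 : 0 < t - th by rewrite subr_gt0.
have s20 : 0 < th - tau by rewrite subr_gt0.
have ss : t - th + (th - tau) = t - tau by ring.
pose q := k th * l th * (Cc * major (t - tau) (pn (x - xi))).
have q0 : 0 <= q.
  apply: mulr_ge0; first by apply: mulr_ge0; [exact: k0|exact: l0].
  by apply: mulr_ge0; [exact: Cc0|exact: major_ge0].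
have I := int_leZ measurableT q0 (int_leD measurableT
  (int_le_major_shift muP alpha x ng s10) (int_le_major_shift' muP alpha xi ng s20)).
have := @cintegral_le _ (borelQpn pp n) R mu setT (fun y : V => K y th * L y th) _ _ measurableT I.
move=> /(_ _)/le_trans; apply=> [y _|]; last first.
  rewrite /q /D0; move: (major _ _) (profile_const _ _) (k th) (l th) => u e k' l'.
  rewrite [leLHS](_ : _ = 4 * (Cc * (2 * e + 2 * e)) * u * (k' * l')) ?lexx//; ring.
rewrite Normc.normcM.
apply: le_trans (ler_pM (nrm_ge0 _) (nrm_ge0 _) (HK th y thI) (HL th y thI)) _.
have max_le : pn (x - xi) <= Num.max (pn (x - y)) (pn (y - xi)).
  by rewrite -{1}(subrKA y x (- xi)); exact: pnormD.
have := HC _ _ _ _ _ s10 s20 _ max_le; rewrite ss => /(_ tT).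
rewrite /q; move: (major (t - th) (pn (x - y))) (major (th - tau) (pn (y - xi))).
move: (major (t - tau) (pn (x - xi))) => E A B h.
have := ler_wpM2l (mulr_ge0 (k0 th) (l0 th)) h; move: (k th) (l th) => k' l'.
rewrite [X in X <= _ -> _](_ : _ = k' * A * (l' * B)); last by ring.
by move=> /le_trans; apply; rewrite !mulrA lexx.
Qed.

Hypothesis RP : kernel_le alpha T v g Rk.

(** By [compose_le] each composition with the remainder costs a constant [D * B] and
    one convolution in time, which [time_convolution] reduces to a
    factor [1 / (2 * (D * B + 1))] at the price of the weight [exp (Lam * (t - tau))]. *)
Lemma Riter_le : exists B Lam : R, [/\ 0 <= B, 0 <= Lam &
  forall m x t xi tau, 0 <= tau -> tau < t -> t <= T ->
    nrm (Rit m x t xi tau) <= B * 2^-1 ^+ m * ((t - tau) `^ (v - 1) *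
      (expR (Lam * (t - tau)) * major (t - tau) (pn (x - xi))))].
Proof.
have [B B0 HB] := RP; have [D D0 HD] := compose_le.
pose q : R := (2 * (D * B + 1))^-1.
have DB0 : 0 <= D * B by exact: mulr_ge0.
have q0 : 0 < q by rewrite invr_gt0 mulr_gt0// ltr_wpDl.
have v01 : 0 < v <= 1 by rewrite v_gt0 ltW.
have [Lam Lam0 HLam] := time_convolution v01 T_gt0 q0.
exists B, Lam; split => //; elim=> [|m IH] x t xi tau tau0 taut tT.
  rewrite expr0 mulr1; apply: le_trans (HB _ _ _ _ tau0 taut tT) _.
  apply: ler_wpM2l => //; apply: ler_wpM2l; first exact: powR_ge0.
  rewrite ler_peMl ?major_ge0// -expR0 ler_expR mulr_ge0// subr_ge0; exact: ltW.
have sT : t - tau <= T by lra.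
pose e := B * 2^-1 ^+ m; have e0 : 0 <= e by rewrite mulr_ge0// exprn_ge0.
pose k th := B * (t - th) `^ (v - 1).
pose l th := e * ((th - tau) `^ (v - 1) * expR (Lam * (th - tau))).
have k0 th : 0 <= k th by rewrite mulr_ge0 ?powR_ge0.
have l0 th : 0 <= l th by rewrite mulr_ge0// mulr_ge0 ?powR_ge0 ?expR_ge0.
have I : int_le leb `]tau, t[ (fun th => k th * l th)
    (B * e * expR (Lam * (t - tau)) * (q * (t - tau) `^ (v - 1))).
  have c0 : 0 <= B * e * expR (Lam * (t - tau)) by rewrite !mulr_ge0 ?expR_ge0.
  have := int_leZ _ c0 (HLam tau t taut sT); move=> /(_ (measurable_itv _)).
  rewrite (_ : (fun th => k th * l th) = (fun th => B * e * expR (Lam * (t - tau)) *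
    ((t - th) `^ (v - 1) * expR (- (Lam * (t - th))) * (th - tau) `^ (v - 1))))//.
  apply/funext => th; rewrite /k /l.
  have -> : Lam * (th - tau) = Lam * (t - tau) + - (Lam * (t - th)) by ring.
  by rewrite expRD; ring.
have HK th y : tau < th < t -> nrm (Rk x t y th) <= k th * major (t - th) (pn (x - y)).
  move=> /andP[h1 h2]; rewrite -mulrA; apply: HB => //.
  by apply: ltW; exact: le_lt_trans h1.
have HL th y : tau < th < t -> nrm (Rit m y th xi tau) <= l th * major (th - tau) (pn (y - xi)).
  move=> /andP[h1 h2]; rewrite /l /e -!mulrA mulrA.
  by apply: IH => //; exact: le_trans (ltW h2) tT.
have := HD (Rk x t) (fun y th => Rit m y th xi tau) k l _ x t xi tau taut sT k0 l0 HK HL I.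
move=> /le_trans; apply.
have Dq : D * B * q <= 2^-1.
  by rewrite /q invfM mulrCA ler_piMr// ler_pdivrMr ?mul1r ?lerDl// ltr_wpDl.
have X0 : 0 <= e * ((t - tau) `^ (v - 1) *
    (expR (Lam * (t - tau)) * major (t - tau) (pn (x - xi)))).
  by rewrite mulr_ge0// mulr_ge0 ?powR_ge0// mulr_ge0 ?expR_ge0 ?major_ge0.
have := ler_wpM2r X0 Dq; rewrite exprS /e.
move: (major _ _) (expR _) (_ `^ (v - 1)) (2^-1 ^+ m) => u e' s f.
rewrite [leLHS](_ : _ = D * (B * (B * f) * e' * (q * s)) * u); last by ring.
by rewrite [X in _ <= X -> _](_ : _ = B * (2^-1 * f) * (s * (e' * u))); last by ring.
Qed.

Lemma Phiker_le : exists2 C : R, 0 <= C &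
  forall x t xi tau, 0 <= tau -> tau < t -> t <= T ->
    nrm (Phiker mu N alpha_ alpha w a b x t xi tau) <=
      C * (t - tau) `^ (v - 1) * major (t - tau) (pn (x - xi)).
Proof.
have [B [Lam [B0 Lam0 HB]]] := Riter_le.
exists (2 * B * expR (Lam * T)); first by rewrite !mulr_ge0 ?expR_ge0.
move=> x t xi tau tau0 taut tT.
have P0 := powR_ge0 (t - tau) (v - 1); have M0 := major_ge0 n alpha g (t - tau) (pn (x - xi)).
have E0 := expR_ge0 (Lam * T).
apply: nrm_lim_le => [|k]; first by rewrite !mulr_ge0.
pose X := B * ((t - tau) `^ (v - 1) * (expR (Lam * T) * major (t - tau) (pn (x - xi)))).
have X0 : 0 <= X by rewrite mulr_ge0// mulr_ge0// mulr_ge0.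
have step m : nrm (Rit m x t xi tau) <= 2^-1 ^+ m * X.
  apply: le_trans (HB m _ _ _ _ tau0 taut tT) _; rewrite /X (mulrC B) -mulrA.
  apply: ler_wpM2l; first exact: exprn_ge0.
  apply: ler_wpM2l => //; apply: ler_wpM2l => //; apply: ler_wpM2r => //.
  by rewrite ler_expR; apply: ler_wpM2l => //; lra.
have sum_le j : nrm (\sum_(0 <= m < j) Rit m x t xi tau : R[i]) <= 2 * (1 - 2^-1 ^+ j) * X.
  elim: j => [|j IH].
    by rewrite big_nil Normc.normc0 expr0 subrr mulr0 mul0r.
  rewrite big_nat_recr//=; apply: le_trans (le_normcD _ _) _.
  apply: le_trans (lerD IH (step j)) _.
  rewrite exprS; move: (2^-1 ^+ j) => f.
  by rewrite [leLHS](_ : _ = 2 * (1 - 2^-1 * f) * X) ?lexx//; field.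
apply: le_trans (sum_le k) _; have h0 : 0 <= 2^-1 ^+ k :> R by rewrite exprn_ge0.
rewrite [leRHS](_ : _ = 2 * X); last by rewrite /X; ring.
have := mulr_ge0 h0 X0; move: (2^-1 ^+ k) => f; lra.
Qed.

Hypothesis ZP : exists2 C : R, 0 <= C &
  forall xi tau s z, 0 <= tau <= T -> 0 < s -> nrm (Z z s xi tau) <= C * major s (pn z).

(** The time singularity of [Phi] is integrable and [Z] has none, so the composition of
    the two is dominated by the majorant itself. *)
Lemma Lambda_le : exists2 C : R, 0 <= C &
  forall x t xi tau, 0 <= tau -> tau < t -> t <= T ->
    nrm (Lambda mu N alpha_ alpha w a b x t xi tau) <= C * major (t - tau) (pn (x - xi)).
Proof.
have [CZ CZ0 HZ] := ZP; have [CP CP0 HP] := Phiker_le; have [D D0 HD] := compose_le.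
have v01 : 0 < v <= 1 by rewrite v_gt0 ltW.
have tc := time_const_ge0 v_gt0.
pose c1 : R := D * (CZ * CP * (time_const v * T `^ v)).
have c10 : 0 <= c1 by rewrite mulr_ge0// mulr_ge0// mulr_ge0 ?powR_ge0.
exists (CZ + c1) => [|x t xi tau tau0 taut tT]; first exact: addr_ge0.
have tauT : 0 <= tau <= T by rewrite tau0 (le_trans (ltW taut)).
have s0 : 0 < t - tau by rewrite subr_gt0.
have sT : t - tau <= T by lra.
apply: le_trans (le_normcD _ _) _; rewrite mulrDl; apply: lerD; first exact: HZ.
pose l th := CP * (th - tau) `^ (v - 1).
have l0 th : 0 <= l th by rewrite mulr_ge0 ?powR_ge0.
have I : int_le leb `]tau, t[ (fun th => CZ * l th) (CZ * (CP * (time_const v * (t - tau) `^ v))).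
  have I0 := int_leZ _ CP0 (int_le_time_left v01 taut).
  have I1 := int_leZ _ CZ0 (I0 (measurable_itv _)).
  exact: I1 (measurable_itv _).
have HK th y : tau < th < t -> nrm (Z (x - y) (t - th) y th) <= CZ * major (t - th) (pn (x - y)).
  move=> /andP[h1 h2]; apply: HZ; last by rewrite subr_gt0.
  by rewrite (le_trans tau0 (ltW h1)) (le_trans (ltW h2)).
have HL th y : tau < th < t -> nrm (Phiker mu N alpha_ alpha w a b y th xi tau) <=
    l th * major (th - tau) (pn (y - xi)).
  by move=> /andP[h1 h2]; apply: HP => //; exact: le_trans (ltW h2) tT.
have := HD (fun y th => Z (x - y) (t - th) y th)
  (fun y th => Phiker mu N alpha_ alpha w a b y th xi tau) (fun=> CZ) l _ x t xi tau
  taut sT (fun=> CZ0) l0 HK HL I.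
move=> /le_trans; apply; apply: ler_wpM2r; first exact: major_ge0.
rewrite /c1 -(mulrA CZ CP); do 4 (apply: ler_wpM2l => //).
by apply: ler_pow => //; exact: ltW.
Qed.

End iteration.

(** * Translation invariance *)

Section translation.
Variables (R : realType) (p : nat) (pp : prime p) (n : nat).
Local Notation V := 'Qp[pp]_n.
Implicit Types (x y z xi : V) (s t tau th r : R).
Variables (mu : {measure set borelQpn pp n -> \bar R}) (muP : is_haar mu).
Variables (N : nat) (alpha_ : nat -> R) (alpha T : R).
Variables (w : R -> V -> R) (a : nat -> V -> R -> R) (b : V -> R -> R) (h : V).
Hypothesis a_h : forall k x t, (k <= N)%N -> 0 <= t <= T -> a k (x + h) t = a k x t.
Hypothesis b_h : forall x t, 0 <= t <= T -> b (x + h) t = b x t.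

Let shiftB x xi : (x + h) - (xi + h) = x - xi.
Proof. by rewrite opprD addrACA subrr addr0. Qed.

(** When the coefficients are invariant under the translation by [h], so is every
    kernel under the simultaneous translation of both points, as the inner integrals
    are taken with respect to a translation invariant measure. *)
Lemma Zker_shift z s xi tau : 0 <= tau <= T ->
  Zker mu alpha w a z s (xi + h) tau = Zker mu alpha w a z s xi tau.
Proof. by move=> tauT; rewrite !Zker_heat a_h. Qed.

Lemma Rker_shift x t xi tau : 0 <= t <= T -> 0 <= tau <= T ->
  Rker mu N alpha_ alpha w a b (x + h) t (xi + h) tau = Rker mu N alpha_ alpha w a b x t xi tau.
Proof.
move=> tT tauT; have ZE : (fun z => Zker mu alpha w a z (t - tau) (xi + h) tau) =
    (fun z => Zker mu alpha w a z (t - tau) xi tau).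
  by apply/funext => z; exact: Zker_shift.
rewrite /Rker ZE (shiftB x xi) (Zker_shift _ _ _ tauT) (a_h x (leq0n N) tT) (a_h xi (leq0n N) tauT).
rewrite (b_h x tT); congr (_ + _ - _); apply: eq_big_nat => k /andP[_ kN].
by rewrite (a_h x kN tT).
Qed.

Lemma Riter_shift m x t xi tau : 0 <= tau -> t <= T -> tau < t ->
  Riter mu N alpha_ alpha w a b m (x + h) t (xi + h) tau = Riter mu N alpha_ alpha w a b m x t xi tau.
Proof.
elim: m x t xi => [|m IH] x t xi tau0 tT taut.
  by apply: Rker_shift; rewrite ?tau0 ?tT ?andbT ?(le_trans tau0 (ltW taut))// (le_trans (ltW taut)).
rewrite /=; apply: eq_cintegral => th; rewrite /= in_itv/= => /andP[h1 h2].
rewrite -[LHS](cintegral_shift muP _ h); apply: eq_cintegral => y _.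
have th0 := le_trans tau0 (ltW h1); have thT := le_trans (ltW h2) tT.
have tI : 0 <= t <= T by rewrite (le_trans th0 (ltW h2)).
have thI : 0 <= th <= T by rewrite th0.
by rewrite (IH y th xi tau0 thT h1) (Rker_shift x y tI thI).
Qed.

Lemma Phiker_shift x t xi tau : 0 <= tau -> t <= T -> tau < t ->
  Phiker mu N alpha_ alpha w a b (x + h) t (xi + h) tau = Phiker mu N alpha_ alpha w a b x t xi tau.
Proof.
move=> tau0 tT taut; rewrite /Phiker.
by under eq_fun => M do under eq_bigr => m _ do rewrite (Riter_shift m x xi tau0 tT taut).
Qed.

Lemma Lambda_shift x t xi tau : 0 <= tau -> t <= T -> tau < t ->
  Lambda mu N alpha_ alpha w a b (x + h) t (xi + h) tau = Lambda mu N alpha_ alpha w a b x t xi tau.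
Proof.
move=> tau0 tT taut; have tauT : 0 <= tau <= T by rewrite tau0 (le_trans (ltW taut)).
rewrite /Lambda (shiftB x xi) (Zker_shift _ _ _ tauT).
apply: (congr1 (fun u => _ + u)); apply: eq_cintegral => th; rewrite /= in_itv/= => /andP[h1 h2].
rewrite -[LHS](cintegral_shift muP _ h); apply: eq_cintegral => y _.
have thT := le_trans (ltW h2) tT.
have thI : 0 <= th <= T by rewrite (le_trans tau0 (ltW h1)).
by rewrite (Phiker_shift y xi tau0 thT h1) (shiftB x y) (Zker_shift _ _ _ thI).
Qed.

Lemma Lop_shift (phi : V -> R[i]) (f : V -> R -> R[i]) x t :
  (forall y, phi (y + h) = phi y) ->
  (forall y tau, 0 <= tau <= T -> f (y + h) tau = f y tau) -> 0 <= t <= T ->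
  Lop mu N alpha_ alpha w a b phi f (x + h) t = Lop mu N alpha_ alpha w a b phi f x t.
Proof.
move=> phih fh /andP[t0 tT]; rewrite /Lop; case: eqVneq => [_|tn0]; first exact: phih.
have tpos : 0 < t by rewrite lt_def tn0.
apply: (f_equal2 +%R).
  apply: eq_cintegral => tau; rewrite /= in_itv/= => /andP[h1 h2].
  rewrite -[LHS](cintegral_shift muP _ h); apply: eq_cintegral => y _.
  have tauI : 0 <= tau <= T by rewrite (ltW h1) (le_trans (ltW h2)).
  by rewrite (Lambda_shift x y (ltW h1) tT h2) (fh y tau tauI).
rewrite -[LHS](cintegral_shift muP _ h); apply: eq_cintegral => y _.
by rewrite (Lambda_shift x y (lexx 0) tT tpos) phih.
Qed.

End translation.

(** * Continuity of the solution operator *)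

Section solution_operator.
Variables (R : realType) (p : nat) (pp : prime p) (n : nat).
Local Notation V := 'Qp[pp]_n.
Local Notation pn := (pnorm R).
Local Notation d := (n%:R : R).
Local Notation leb := (@lebesgue_measure R).
Implicit Types (x y z xi : V) (s t tau th r : R).
Variables (mu : {measure set borelQpn pp n -> \bar R}) (muP : is_haar mu).
Variables (N : nat) (alpha_ : nat -> R) (alpha T g lam : R).
Variables (w : R -> V -> R) (a : nat -> V -> R -> R) (b : V -> R -> R).
Hypotheses (na : d < alpha) (T_gt0 : 0 < T) (lam_ge0 : 0 <= lam) (ngl : d < g - lam).
Local Notation Lam := (Lambda mu N alpha_ alpha w a b).
Local Notation L := (Lop mu N alpha_ alpha w a b).
Local Notation wt x := (1 + pn x `^ lam).

Hypothesis LP : exists2 C : R, 0 <= C &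
  forall x t xi tau, 0 <= tau -> tau < t -> t <= T ->
    nrm (Lam x t xi tau) <= C * major n alpha g (t - tau) (pn (x - xi)).

Lemma wt_ge1 x : 1 <= wt x. Proof. by rewrite lerDl powR_ge0. Qed.

Lemma wt_ge0 x : 0 <= wt x. Proof. exact: le_trans ler01 (wt_ge1 x). Qed.

(** An estimate for differences, because the integrals at hand need not be additive. *)
Lemma Lambda_near : exists2 C : R, 0 <= C &
  forall (phi psi : V -> R[i]) A D x t tau, 0 <= A -> 0 <= D ->
    0 <= tau -> tau < t -> t <= T ->
    (forall y, nrm (phi y - psi y) <= A * wt y) -> (forall y, nrm (psi y) <= D * wt y) ->
    nrm (cintegral mu setT (fun y : V => Lam x t y tau * phi y) -
         cintegral mu setT (fun y : V => Lam x t y tau * psi y)) <= C * A * wt x.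
Proof.
have [C1 C10 H1] := LP; have [C2 C20 H2] := major_weight muP T na lam_ge0 ngl.
exists (4 * (C1 * C2)) => [|phi psi A D x t tau A0 D0 tau0 taut tT phipsi psiD].
  by rewrite mulr_ge0// mulr_ge0.
have s0 : 0 < t - tau by rewrite subr_gt0.
have sT : 0 < t - tau <= T by rewrite s0; lra.
have IA := int_leZ measurableT (mulr_ge0 C10 A0) (H2 _ x sT).
have ID := int_leZ measurableT (mulr_ge0 C10 D0) (H2 _ x sT).
have near := @cintegral_near _ (borelQpn pp n) R mu setT
  (fun y : V => Lam x t y tau * phi y) (fun y : V => Lam x t y tau * psi y) _ _ _ _ measurableT IA ID.
have bound (u : R[i]) E y : nrm u <= E * wt y ->
    nrm (Lam x t y tau * u) <= C1 * E * (major n alpha g (t - tau) (pn (x - y)) * wt y).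
  move=> uE; rewrite Normc.normcM.
  apply: le_trans (ler_pM (nrm_ge0 _) (nrm_ge0 _) (H1 x t y tau tau0 taut tT) uE) _.
  by move: (major _ _ _ _ _) (_ `^ _) => m e; rewrite [leLHS](_ : _ = C1 * E * (m * (1 + e))) ?lexx//; ring.
apply: le_trans (near _ _) _ => [y _|y _|].
- by rewrite -mulrBr; apply: bound.
- exact: bound.
- by move: (_ `^ _) => e; rewrite [leLHS](_ : _ = 4 * (C1 * C2) * A * (1 + e)) ?lexx//; ring.
Qed.

Lemma int_le_cst t (c : R) : 0 < t <= T -> 0 <= c -> int_le leb `]0, t[ (fun=> c) (c * T).
Proof.
move=> /andP[t0 tT] c0; split=> //.
rewrite integral_cst//= lebesgue_measure_itv/= lte_fin t0 oppr0 adde0 -EFinM lee_fin.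
exact: ler_wpM2l.
Qed.

Lemma Lop_near : exists2 C : R, 0 <= C &
  forall (phi psi : V -> R[i]) (f f' : V -> R -> R[i]) A B D x t,
    0 <= A -> 0 <= B -> 0 <= D -> 0 <= t <= T ->
    (forall y, nrm (phi y - psi y) <= A * wt y) -> (forall y, nrm (psi y) <= D * wt y) ->
    (forall y tau, 0 <= tau <= T -> nrm (f y tau - f' y tau) <= B * wt y) ->
    (forall y tau, 0 <= tau <= T -> nrm (f' y tau) <= D * wt y) ->
    nrm (L phi f x t - L psi f' x t) <= C * (A + B) * wt x.
Proof.
have [C C0 H] := Lambda_near; pose C' : R := 1 + C + 4 * (C * T).
have CT0 : 0 <= C * T by rewrite mulr_ge0// ltW.
have C'0 : 0 <= C' by rewrite !addr_ge0// mulr_ge0.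
exists C' => // phi psi f f' A B D x t A0 B0 D0 /andP[t0 tT] Hphi Hpsi Hf Hf'.
have W0 := wt_ge0 x.
rewrite /Lop; case: eqVneq => [_|tn0].
  apply: le_trans (Hphi x) _; apply: ler_wpM2r => //.
  rewrite -[leLHS]mul1r; apply: ler_pM => //; last by rewrite lerDl.
  by rewrite /C' -addrA lerDl addr_ge0// mulr_ge0.
have tpos : 0 < t by rewrite lt_def tn0.
have tI : 0 < t <= T by rewrite tpos.
have I1 := int_le_cst tI (mulr_ge0 (mulr_ge0 C0 B0) W0).
have I2 := int_le_cst tI (mulr_ge0 (mulr_ge0 C0 D0) W0).
have time := @cintegral_near _ _ R leb `]0, t[%classic
  (fun tau => cintegral mu setT (fun xi : V => Lam x t xi tau * f xi tau))
  (fun tau => cintegral mu setT (fun xi : V => Lam x t xi tau * f' xi tau)) _ _ _ _ (measurable_itv _) I1 I2.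
have initial := H phi psi A D x t 0 A0 D0 (lexx 0) tpos tT Hphi Hpsi.
rewrite opprD addrACA; apply: le_trans (le_normcD _ _) _.
have H0 u : cintegral mu setT (fun xi : V => Lam x t xi u * 0) = 0.
  rewrite (@eq_cintegral _ _ _ mu setT _ (fun=> 0)) ?cintegral0// => y _.
  by rewrite mulr0.
apply: le_trans (lerD (time _ _) initial) _ => [tau|tau|].
- rewrite /= in_itv/= => /andP[h1 h2]; have tauT : 0 <= tau <= T.
    by rewrite (ltW h1) (le_trans (ltW h2)).
  exact: (H (f ^~ tau) (f' ^~ tau) B D x t tau B0 D0 (ltW h1) h2 tT
    (fun y => Hf y tau tauT) (fun y => Hf' y tau tauT)).
- rewrite /= in_itv/= => /andP[h1 h2]; have tauT : 0 <= tau <= T.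
    by rewrite (ltW h1) (le_trans (ltW h2)).
  have f'0 y : nrm (f' y tau - 0) <= D * wt y by rewrite subr0; exact: Hf'.
  have nrm00 y : nrm (0 : R[i]) <= 0 * wt y by rewrite Normc.normc0 mul0r.
  have := H (f' ^~ tau) (fun=> 0) D 0 x t tau D0 (lexx 0) (ltW h1) h2 tT f'0 nrm00.
  by rewrite H0 subr0.
- have CTA : 0 <= 4 * (C * T) * A * wt x by do 3 (apply: mulr_ge0 => //).
  have CB : 0 <= (1 + C) * B * wt x by rewrite !mulr_ge0// addr_ge0.
  have A1 : 0 <= A * wt x by exact: mulr_ge0.
  by move: (wt x) CTA CB A1 => u CTA CB A1; rewrite /C'; lra.
Qed.

End solution_operator.

(** * The weighted supremum norm *)

Section weighted_norm.
Variables (R : realType) (p : nat) (pp : prime p) (n : nat).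
Local Notation V := 'Qp[pp]_n.
Local Notation pn := (pnorm R).
Implicit Types (x : V) (t : R).
Variables (T lam : R) (T_gt0 : 0 < T).
Local Notation wt x := (1 + pn x `^ lam).
Variables (phi : V -> R -> R[i]) (D : R).
Hypothesis phiD : forall x t, 0 <= t <= T -> nrm (phi x t) <= D * wt x.

Let wt_gt0 x : 0 < wt x. Proof. by rewrite ltr_wpDr ?powR_ge0. Qed.

Let quotE x t : nrm (phi x t / (wt x)%:C) = nrm (phi x t) / wt x.
Proof. by rewrite mulrC -fmorphV nrmMr ger0_norm ?invr_ge0 ?(ltW (wt_gt0 x))// mulrC. Qed.

Let quot t := [set nrm (phi x t / (wt x)%:C) | x in [set: V]].

Let quot_ub t : 0 <= t <= T -> ubound (quot t) D.
Proof. by move=> tT _ [x _ <-]; rewrite quotE ler_pdivrMr//; exact: phiD. Qed.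

Let sup_quot_ub : ubound [set sup (quot t) | t in [set t : R | 0 <= t <= T]] D.
Proof.
move=> _ [t tT <-]; apply: ge_sup (quot_ub tT).
by exists (nrm (phi (0 : V) t / (wt (0 : V))%:C)); exists 0.
Qed.

(** The supremum of an unbounded set is [0] by convention, so the norm controls a
    function only once some bound [D] is known. *)
Lemma normM_le : normM T lam phi <= D.
Proof.
have T0 : 0 <= (0 : R) <= T by rewrite lexx ltW.
by apply: ge_sup sup_quot_ub; exists (sup (quot 0)); exists 0.
Qed.

Lemma le_normM x t : 0 <= t <= T -> nrm (phi x t) <= normM T lam phi * wt x.
Proof.
move=> tT; rewrite -ler_pdivrMr// -quotE.
apply: (@le_trans _ _ (sup (quot t))).
  by apply: ub_le_sup; [exists D; exact: quot_ub|exists x].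
by apply: ub_le_sup; [exists D; exact: sup_quot_ub|exists t].
Qed.

Lemma normM_ge0 : 0 <= normM T lam phi.
Proof.
have T0 : 0 <= (0 : R) <= T by rewrite lexx ltW.
by rewrite -(pmulr_lge0 _ (wt_gt0 (0 : V))); exact: le_trans (nrm_ge0 _) (le_normM (0 : V) T0).
Qed.

End weighted_norm.

(** * Boundedness of the solution operator *)

Section local_constancy_radius.
Variables (R : realType) (p : nat) (pp : prime p) (n : nat).
Local Notation V := 'Qp[pp]_n.
Local Notation pn := (pnorm R).

Lemma radius_le (x : V) (l m : int) : l <= m -> pn x <= p%:R ^ l -> pn x <= p%:R ^ m.
Proof. by move=> lm /le_trans; apply; rewrite ler_eXz2l// (pgt1 pp). Qed.

Lemma common_radius N (P : nat -> V -> Prop) :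
  (forall k, (k <= N)%N -> exists l : int, forall x, pn x <= p%:R ^ l -> P k x) ->
  exists l : int, forall k x, (k <= N)%N -> pn x <= p%:R ^ l -> P k x.
Proof.
elim: N => [|N IH] HP.
  by have [l H] := HP 0 (leqnn 0); exists l => k x; rewrite leqn0 => /eqP ->; exact: H.
have [l Hl] := IH (fun k kN => HP k (leqW kN)); have [m Hm] := HP N.+1 (leqnn _).
exists (Num.min l m) => k x; rewrite leq_eqVlt => /orP[/eqP ->|kN] xl.
  by apply: Hm; apply: radius_le xl; rewrite ge_min lexx orbT.
by apply: Hl => //; apply: radius_le xl; rewrite ge_min lexx.
Qed.

End local_constancy_radius.

Lemma exponent_ge (R : realType) N (e : nat -> R) :
  (forall k, (1 <= k < N)%N -> e k < e k.+1) ->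
  forall j k, (1 <= j)%N -> (j <= k)%N -> (k <= N)%N -> e j <= e k.
Proof.
move=> inc j k j1; elim: k => [|k IH]; first by rewrite leqn0 => /eqP j0; rewrite j0 in j1.
rewrite leq_eqVlt => /orP[/eqP -> //|jk] kN.
by apply: le_trans (IH jk (ltnW kN)) (ltW (inc k _)); rewrite kN (leq_trans j1).
Qed.

Lemma common_bound (R : realType) (I : Type) N (F : nat -> I -> R) (Q : I -> Prop) :
  (forall k, (k <= N)%N -> exists M : R, forall i, Q i -> `|F k i| <= M) ->
  exists M : R, forall k i, (k <= N)%N -> Q i -> `|F k i| <= M.
Proof.
elim: N => [|N IH] HF.
  by have [M H] := HF 0 (leqnn 0); exists M => k i; rewrite leqn0 => /eqP ->; exact: H.
have [M HM] := IH (fun k kN => HF k (leqW kN)); have [M' HM'] := HF N.+1 (leqnn _).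
exists (Num.max M M') => k i; rewrite leq_eqVlt => /orP[/eqP ->|kN] Qi; rewrite le_max.
  by rewrite HM' ?orbT.
by rewrite HM.
Qed.

Section operator_norm.
Variables (R : realType) (p : nat) (pp : prime p) (n : nat).
Local Notation V := 'Qp[pp]_n.
Local Notation pn := (pnorm R).
Local Notation d := (n%:R : R).
Implicit Types (x : V) (t : R) (phi psi : V -> R[i]) (f g : V -> R -> R[i]).
Variables (mu : {measure set borelQpn pp n -> \bar R}) (muP : is_haar mu).
Variables (N : nat) (alpha_ : nat -> R) (alpha T e lam : R).
Variables (w : R -> V -> R) (a : nat -> V -> R -> R) (b : V -> R -> R).
Hypotheses (na : d < alpha) (T_gt0 : 0 < T) (lam_ge0 : 0 <= lam) (nel : d < e - lam).
Hypothesis LP : exists2 C : R, 0 <= C &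
  forall x t xi tau, 0 <= tau -> tau < t -> t <= T ->
    nrm (Lambda mu N alpha_ alpha w a b x t xi tau) <=
    C * major n alpha e (t - tau) (pn (x - xi)).
Local Notation L := (Lop mu N alpha_ alpha w a b).
Local Notation wt x := (1 + pn x `^ lam).

Definition growth phi f (D : R) :=
  (forall x, nrm (phi x) <= D * wt x) /\
  forall x t, 0 <= t <= T -> nrm (f x t) <= D * wt x.

Lemma Ldom_growth phi f : Ldom T lam phi f -> exists2 D : R, 0 <= D & growth phi f D.
Proof.
move=> [[l [C [C0 _ HC]]] [m [D [D0 _ HD]]] _]; exists (C + D).
  by rewrite addr_ge0 ?ltW.
by split=> [x|x t tT]; [apply: le_trans (HC x) _|apply: le_trans (HD t tT x) _];
  apply: ler_wpM2r; rewrite ?wt_ge0// ?lerDl ?lerDr ltW.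
Qed.

Lemma growth0 D : 0 <= D -> growth (fun=> 0) (fun _=> fun=> 0) D.
Proof.
by move=> D0; split=> [x|x t _]; rewrite Normc.normc0; apply: mulr_ge0 => //; exact: wt_ge0.
Qed.

Lemma growth_le phi f C D : C <= D -> growth phi f C -> growth phi f D.
Proof.
move=> CD [h1 h2]; split=> [x|x t tT]; [apply: le_trans (h1 x) _|apply: le_trans (h2 x t tT) _];
  by apply: ler_wpM2r; rewrite ?wt_ge0.
Qed.

Lemma growthB phi f psi g C D : growth phi f C -> growth psi g D ->
  growth (fun x => phi x - psi x) (fun x t => f x t - g x t) (C + D).
Proof.
move=> [h1 h2] [h3 h4]; split=> [x|x t tT]; rewrite mulrDl.
  by apply: le_trans (le_normcD _ _) _; rewrite nrmN; apply: lerD.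
by apply: le_trans (le_normcD _ _) _; rewrite nrmN; apply: lerD; [exact: h2|exact: h4].
Qed.

Lemma normMM_ge0 phi f D : growth phi f D -> 0 <= normMM T lam phi f.
Proof.
move=> [h1 h2]; apply: addr_ge0; last exact: (normM_ge0 T_gt0 h2).
exact: (normM_ge0 T_gt0 (phi := fun x _ => phi x) (fun x t _ => h1 x)).
Qed.

(** The data are dominated with a constant [D] that may be large; it does not enter the
    estimate, which therefore gives continuity as well as boundedness. *)
Lemma Lop_lipschitz : exists2 C : R, 0 <= C & forall phi f psi g D, 0 <= D ->
  growth phi f D -> growth psi g D -> forall x t, 0 <= t <= T ->
  nrm (L phi f x t - L psi g x t) <=
  C * normMM T lam (fun x => phi x - psi x) (fun x t => f x t - g x t) * wt x.
Proof.
have [C C0 H] := Lop_near muP na T_gt0 lam_ge0 nel LP; exists C => //.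
move=> phi f psi g D D0 G G' x t tT; have [h1 h2] := growthB G G'.
have h1' : forall x t, 0 <= t <= T -> nrm (phi x - psi x) <= (D + D) * wt x by move=> y *; exact: h1.
have T0 : 0 <= (0 : R) <= T by rewrite lexx ltW.
have A1 y := le_normM (phi := fun y _ => phi y - psi y) h1' y T0.
have B1 y tau (tauT : 0 <= tau <= T) := le_normM (phi := fun y t => f y t - g y t) h2 y tauT.
have A0 := normM_ge0 (phi := fun y _ => phi y - psi y) T_gt0 h1'.
have B0 := normM_ge0 (phi := fun y t => f y t - g y t) T_gt0 h2.
exact: (H phi psi f g _ _ D x t A0 B0 D0 tT A1 G'.1 B1 G'.2).
Qed.

Lemma Lop0 x t : L (fun=> 0) (fun _=> fun=> 0) x t = 0.
Proof.
have K0 s : cintegral mu setT (fun y : V => Lambda mu N alpha_ alpha w a b x t y s * 0) = 0.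
  rewrite (@eq_cintegral _ _ _ mu setT _ (fun=> 0)) ?cintegral0// => y _.
  by rewrite mulr0.
rewrite /Lop; case: eqVneq => [_|_]; first exact: erefl.
rewrite -[RHS]addr0; apply: (f_equal2 +%R); last exact: K0.
rewrite -[RHS](cintegral0 (@lebesgue_measure R) `]0, t[).
by apply: eq_cintegral => s _; exact: K0.
Qed.

Lemma Lop_bounded : exists2 C : R, 0 <= C & forall phi f D, 0 <= D -> growth phi f D ->
  forall x t, 0 <= t <= T -> nrm (L phi f x t) <= C * normMM T lam phi f * wt x.
Proof.
have [C C0 H] := Lop_lipschitz; exists C => // phi f D D0 G x t tT.
have := H phi f _ _ D D0 G (growth0 D0) x t tT; rewrite Lop0 subr0.
by under eq_fun do rewrite subr0; under [X in normMM _ _ _ X]eq_fun do under eq_fun do rewrite subr0.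
Qed.

End operator_norm.

Theorem theorem8p1 (R : realType) (p : nat) (pp : prime p)
  (n : nat) (n_gt0 : (0 < n)%N)
  (haar : {measure set (borelQpn pp n) -> \bar R}) (haarP : is_haar haar)
  (N : nat) (N_gt0 : (0 < N)%N) (alpha_ : nat -> R) (alpha T v mu lam : R)
  (w : R -> 'Qp[pp]_n -> R)
  (a : nat -> 'Qp[pp]_n -> R -> R) (b : 'Qp[pp]_n -> R -> R)
  (alpha1_gt : n%:R < alpha_ 1%N)
  (alpha_incr : forall k, (1 <= k < N)%N -> alpha_ k < alpha_ k.+1)
  (alphaN_lt : alpha_ N < alpha)
  (w_alpha_k : forall k, (1 <= k <= N)%N -> is_weight (alpha_ k) (w (alpha_ k)))
  (w_alpha : is_weight alpha (w alpha))
  (T_gt0 : 0 < T) (v_01 : 0 < v < 1) (mu_gt0 : 0 < mu)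
  (a_M0 : forall k, (k <= N)%N -> in_M_unif T 0 (fun x t => (a k x t)%:C))
  (b_M0 : in_M_unif T 0 (fun x t => (b x t)%:C))
  (a0_hoelder : exists H : R, forall x t s, 0 <= t <= T -> 0 <= s <= T ->
     `|a 0%N x t - a 0%N x s| <= H * `|t - s| `^ v)
  (a0_ge : forall x t, 0 <= t <= T -> mu <= a 0%N x t)
  (alphaN1 : alpha_ N < n%:R + (alpha - n%:R) * (1 - v))
  (a_ge0 : forall k x t, (k <= N)%N -> 0 <= t <= T -> 0 <= a k x t)
  (a_bounded : forall k, (k <= N)%N ->
     exists M : R, forall x t, 0 <= t <= T -> `|a k x t| <= M)
  (a_cont : forall k, (k <= N)%N ->
     {within slab T, continuous (fun z : 'Qp[pp]_n * R => a k z.1 z.2)})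
  (b_bounded : exists M : R, forall x t, 0 <= t <= T -> `|b x t| <= M)
  (b_cont : {within slab T, continuous (fun z : 'Qp[pp]_n * R => b z.1 z.2)})
  (lam_ge0 : 0 <= lam)
  (lam_lt : lam < alpha_ 1%N - n%:R \/
     (forall k x t, (1 <= k <= N)%N -> 0 <= t <= T -> a k x t = 0) /\
     lam < alpha - n%:R) :
  let L := Lop haar N alpha_ alpha w a b in
  [/\ forall phi f, Ldom T lam phi f -> in_M_unif T lam (L phi f),
      exists C : R, forall phi f, Ldom T lam phi f ->
        normM T lam (L phi f) <= C * normMM T lam phi f &
      forall phi f, Ldom T lam phi f -> forall eps : R, 0 < eps ->
        exists2 delta : R, 0 < delta & forall psi g, Ldom T lam psi g ->
          normMM T lam (fun x => psi x - phi x) (fun x t => g x t - f x t)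
            < delta ->
          normM T lam (fun x t => L psi g x t - L phi f x t) < eps].
Proof.
move=> L; have /andP[v0 v1] := v_01.
have alpha1_le k : (1 <= k <= N)%N -> alpha_ 1%N <= alpha_ k.
  by move=> /andP[k1 kN]; exact: (exponent_ge alpha_incr).
have le_alphaN k : (1 <= k <= N)%N -> alpha_ k <= alpha_ N.
  by move=> /andP[k1 kN]; exact: (exponent_ge alpha_incr).
have N1 : (1 <= N <= N)%N by rewrite N_gt0 leqnn.
have na_k k : (1 <= k <= N)%N -> n%:R < alpha_ k.
  by move=> kN; exact: lt_le_trans alpha1_gt (alpha1_le k kN).
have na : n%:R < alpha by exact: lt_trans (na_k N N1) alphaN_lt.
have [H HP] := a0_hoelder.
(* in the presence of lower order terms the remainder decays at infinity no faster
   than [|x - xi| ^ (- alpha_ 1)] *)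
have [e [nel ea ek]] : exists e : R, [/\ n%:R < e - lam, e <= alpha &
    forall k, (1 <= k <= N)%N -> (e <= alpha_ k /\ alpha_ k - n%:R <= (alpha - n%:R) * (1 - v)) \/
      forall x t, 0 <= t <= T -> a k x t = 0].
  case: lam_lt => [l1|[az la]].
    exists (alpha_ 1%N); split; first by rewrite ltrBrDr addrC -ltrBrDr.
      exact: le_trans (alpha1_le N N1) (ltW alphaN_lt).
    move=> k kN; left; split; first exact: alpha1_le.
    by have := le_alphaN k kN; lra.
  exists alpha; split => //; first by rewrite ltrBrDr addrC -ltrBrDr.
  by move=> k kN; right => x t tT; exact: az.
have ne : n%:R < e by apply: lt_le_trans nel _; rewrite gerBl.
have [M MP] : exists M : R, forall k (z : 'Qp[pp]_n * R), (k <= N)%N -> 0 <= z.2 <= T ->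
    `|a k z.1 z.2| <= M.
  apply: common_bound => k kN; have [M HM] := a_bounded k kN.
  by exists M => z; exact: HM.
have [Mb MbP] := b_bounded.
have [l lP] : exists l : int, forall k h, (k <= N)%N -> pnorm R h <= p%:R ^ l ->
    forall x t, 0 <= t <= T -> a k (x + h) t = a k x t.
  apply: common_radius => k kN; have [l [C [_ lc _]]] := a_M0 k kN.
  by exists l => h hl x t tT; exact: (congr1 (@complex.Re R) (lc t tT x h hl)).
have [lb lbP] : exists l : int, forall h, pnorm R h <= p%:R ^ l ->
    forall x t, 0 <= t <= T -> b (x + h) t = b x t.
  have [lb [C [_ lc _]]] := b_M0.
  by exists lb => h hl x t tT; exact: (congr1 (@complex.Re R) (lc t tT x h hl)).
pose M' := Num.max M Mb.
have a0_bounds x t : 0 <= t <= T -> mu <= a 0%N x t <= M'.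
  move=> tT; rewrite a0_ge// le_max.
  by rewrite (le_trans (ler_norm _) (MP 0%N (x, t) (leq0n N) tT)).
have a_bd k x t : (1 <= k <= N)%N -> 0 <= t <= T -> `|a k x t| <= M'.
  by move=> /andP[_ kN] tT; rewrite le_max (MP k (x, t) kN tT).
have b_bd x t : 0 <= t <= T -> `|b x t| <= M'.
  by move=> tT; rewrite le_max (MbP x t tT) orbT.
have a0_lc x h t : 0 <= t <= T -> pnorm R h <= p%:R ^ l -> a 0%N (x + h) t = a 0%N x t.
  by move=> tT hl; exact: lP.
have RP := Rker_le haarP na w_alpha na_k w_alpha_k T_gt0 v1 mu_gt0 a0_bounds a_bd b_bd
  a0_lc HP ea ek.
have ZP : exists2 C : R, 0 <= C & forall xi tau s z, 0 <= tau <= T -> 0 < s ->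
    nrm (Zker haar alpha w a z s xi tau) <= C * major n alpha e s (pnorm R z).
  have [C C0 HC] := Zker_le haarP na w_alpha mu_gt0 a0_bounds; exists C => //.
  move=> xi tau s z tauT s0; apply: le_trans (HC xi tau s z tauT s0) _.
  apply: ler_wpM2l => //; rewrite -[leLHS]addr0; apply: lerD; last exact: profile_ge0.
  by apply: profile_le_exp => //; exact: scale_gt0.
have LP := Lambda_le haarP na T_gt0 v0 v1 ne RP ZP.
have [C C0 HC] := Lop_lipschitz haarP na T_gt0 lam_ge0 nel LP.
have [B B0 HB] := Lop_bounded haarP na T_gt0 lam_ge0 nel LP.
split.
- move=> phi f D; have [G G0 GP] := Ldom_growth D.
  have [[l1 [C1 [_ phi_lc _]]] [l2 [C2 [_ f_lc _]]] _] := D.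
  exists (Num.min (Num.min l lb) (Num.min l1 l2)), (B * normMM T lam phi f + 1).
  split; first by rewrite ltr_wpDl// mulr_ge0// (normMM_ge0 T_gt0 GP).
    move=> t tT x h; rewrite -/L => hl.
    apply: (@Lop_shift R p pp n haar haarP N alpha_ alpha T).
    + move=> k y s kN sT; apply: lP => //; apply: radius_le hl.
      by rewrite !ge_min lexx.
    + move=> y s sT; apply: lbP => //; apply: radius_le hl.
      by rewrite !ge_min lexx orbT.
    + move=> y; apply: phi_lc; apply: radius_le hl.
      by rewrite !ge_min lexx ?orbT.
    + move=> y s sT; apply: f_lc => //; apply: radius_le hl.
      by rewrite !ge_min lexx ?orbT.
    + exact: tT.
  move=> t tT x; apply: le_trans (HB phi f G G0 GP x t tT) _.
  by apply: ler_wpM2r; [exact: wt_ge0|rewrite lerDl].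
- exists B => phi f D; have [G G0 GP] := Ldom_growth D.
  by apply: (normM_le T_gt0) => x t tT; exact: (HB phi f G G0 GP x t tT).
- move=> phi f D eps eps0; have C1 : 0 < C + 1 by rewrite ltr_wpDl.
  exists (eps / (C + 1)); first exact: divr_gt0.
  move=> psi g D' close; have [G G0 GP] := Ldom_growth D; have [G' G'0 GP'] := Ldom_growth D'.
  have GG : 0 <= G + G' by exact: addr_ge0.
  have P1 : growth T lam phi f (G + G') by apply: growth_le GP; rewrite lerDl.
  have P2 : growth T lam psi g (G + G') by apply: growth_le GP'; rewrite lerDr.
  pose m := normMM T lam (fun x => psi x - phi x) (fun x t => g x t - f x t).
  have m0 : 0 <= m := normMM_ge0 T_gt0 (growthB P2 P1).
  apply: (@le_lt_trans _ _ (C * m)).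
    by apply: (normM_le T_gt0) => x t tT; exact: (HC psi g phi f _ GG P2 P1 x t tT).
  apply: (@le_lt_trans _ _ ((C + 1) * m)).
    by apply: ler_wpM2r => //; rewrite lerDl.
  by rewrite mulrC -ltr_pdivlMr.
Qed.
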